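(* Consider the Whitham modulated systems associated with the Euler--Korteweg system: in Eulerian coordinates $$(\mathrm{E})\quad\left\{\begin{array}{l}\partial_TK+\partial_X(\sigma K)=0,\\ \partial_T\langle\rho_0\rangle+\partial_X\langle\rho_0u_0\rangle=0,\\ \partial_T\langle u_0\rangle+\partial_X\langle\tfrac12u_0^2\rangle+\partial_X\langle g_0\rangle=0,\\ \partial_T\langle\rho_0u_0\rangle+\partial_X\Big\langle\rho_0u_0^2+\rho_0g_0+K(\partial_\theta\rho_0)\dfrac{\partial\mathscr E}{\partial\rho_x}(\rho_0,K\partial_\theta\rho_0)-\mathscr E_0\Big\rangle=0,\end{array}\right.$$ and in mass Lagrangian coordinates $$(\mathrm{L})\quad\left\{\begin{array}{l}\partial_Sk-\partial_Y(jk)=0,\\ \partial_S\langle v_0\rangle-\partial_Y\langle w_0\rangle=0,\\ \partial_S\langle w_0\rangle+\partial_Y\langle p_0\rangle=0,\\ \partial_S\langle v_0w_0\rangle+\partial_Y\Big\langle-\tfrac12w_0^2+v_0p_0+\epsilon_0-k(\partial_\theta v_0)\dfrac{\partial\epsilon}{\partial v_y}(v_0,k\partial_\theta v_0)\Big\rangle=0.\end{array}\right.$$ Away from vacuum, there is a mass Lagrangian system of coordinates $(S,Y)$ changing system $(\mathrm E)$ into system $(\mathrm L)$. In particular, these systems are simultaneously hyperbolic. Moreover, a sufficient condition for the hyperbolicity of $(\mathrm E)$ and $(\mathrm L)$ is that $$\mathrm e:=\langle\epsilon_0\rangle+\tfrac12\langle w_0^2\rangle-\tfrac12\langle w_0\rangle^2$$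 be a strictly convex function of $(\mathrm v,k,\Delta/k)$, or equivalently that $$\mathrm E:=\langle\rho_0\rangle\,\mathrm e=\langle\mathscr E_0\rangle+\frac12\langle\rho_0u_0^2\rangle-\frac12\frac{\langle\rho_0u_0\rangle^2}{\langle\rho_0\rangle}$$ be a strictly convex function of $(\varrho,K,D/K)$, where $$\mathrm v:=\langle v_0\rangle,\quad\Delta:=\langle v_0w_0\rangle-\langle v_0\rangle\langle w_0\rangle,\quad\varrho:=\langle\rho_0\rangle,\quad D:=\langle\rho_0\rangle\langle u_0\rangle-\langle\rho_0u_0\rangle.$$
   Context: **Euler--Korteweg system.** In Eulerian coordinates: $\partial_t\rho+\partial_x(\rho u)=0$, $\partial_tu+u\partial_xu+\partial_x(\mathsf E_\rho\mathscr E)=0$, with energy density $\mathscr E=\mathscr E(\rho,\rho_x)$ and $\mathsf E_\rho\mathscr E=\partial\mathscr E/\partial\rho-\mathrm D_x(\partial\mathscr E/\partial\rho_x)$. In mass Lagrangian coordinates ($\mathrm dy=\rho\,\mathrm dx-\rho u\,\mathrm dt$), with $v=1/\rho$: $\partial_tv=\partial_yu$, $\partial_tu=\partial_y(\mathsf E_v\epsilon)$, with specific energy $\epsilon=\epsilon(v,v_y)$ and $\mathsf E_v\epsilon=\partial\epsilon/\partial v-\mathrm D_y(\partial\epsilon/\partial v_y)$. The energies are smooth and related by $\mathscr E=\rho\,\epsilon$, i.e. $\mathscr E(\rho,\rho_x)=\rho\,\epsilon(1/\rho,-\rho_x/\rho^3)$. **Eulerian profiles.** $\langle\cdot\rangle$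 is the mean over $\theta\in[0,1]$. In $(\mathrm E)$, for each $(T,X)$ the functions $(\rho_0,u_0)(T,X,\theta)$ are $1$-periodic in $\theta$ and $(\rho_0,u_0)(T,X,\theta)=(R,U)(\theta/K(T,X))$, where $(R,U)(\xi)$ is a $1/K$-periodic solution of $$R(U-\sigma)=j,\qquad R_\xi\frac{\partial\mathscr E}{\partial\rho_x}(R,R_\xi)-\mathscr E(R,R_\xi)+\frac{j^2}{2R}+\mu R=-\lambda,$$ that is, the profile (depending on $\xi=x-\sigma t$) of a traveling wave of speed $\sigma$; $(j,\sigma,\lambda,\mu)$ depend only on $(T,X)$. Moreover $$g_0:=\frac{\partial\mathscr E}{\partial\rho}(\rho_0,K\partial_\theta\rho_0)-K\mathrm D_\theta\Big(\frac{\partial\mathscr E}{\partial\rho_x}(\rho_0,K\partial_\theta\rho_0)\Big),\qquad\mathscr E_0:=\mathscr E(\rho_0,K\partial_\theta\rho_0).$$ **Lagrangian profiles.** In $(\mathrm L)$, for each $(S,Y)$, $(v_0,w_0)(S,Y,\theta)=(V,W)(\theta/k(S,Y))$, where $(V,W)(\zeta)$ is a $1/k$-periodic solution of $$W-jV=\sigma,\qquad V_\zeta\frac{\partial\epsilon}{\partial v_y}(V,V_\zeta)-\epsilon(V,V_\zeta)+\frac{j^2V^2}{2}+\lambda V=-\mu,$$ i.e. the profile (depending on $\zeta=y+jt$) of a traveling wave of speed $-j$. Moreover $$p_0:=-\frac{\partial\epsilon}{\partial v}(v_0,k\partial_\theta v_0)+k\mathrm D_\theta\Big(\frac{\partial\epsilon}{\partial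 v_y}(v_0,k\partial_\theta v_0)\Big),\qquad\epsilon_0:=\epsilon(v_0,k\partial_\theta v_0).$$ **Correspondence.** Eulerian and Lagrangian profiles with the same parameters $(j,\sigma,\lambda,\mu)$ are in one-to-one correspondence through $R(\xi)V(Z(\xi))=1$, $U(\xi)=W(Z(\xi))$, $\mathrm dZ/\mathrm d\xi=R=1/V(Z)$, $Z(0)=0$, $1/k=Z(1/K)$. ''Away from vacuum'' means that densities and specific volumes (hence $\langle\rho_0\rangle$ and $\langle v_0\rangle$) are positive and finite. **Mass Lagrangian change of coordinates at the modulation level.** $S=T$ and $\mathrm dY=\langle\rho_0\rangle\,\mathrm dX-\langle\rho_0u_0\rangle\,\mathrm dT$ ($Y$ is defined up to a constant, on a simply connected domain, for smooth solutions of $(\mathrm E)$), the Eulerian profile $(R,U)$ and the Lagrangian profile $(V,W)$ having the same parameters $(j,\sigma,\lambda,\mu)$ and being related by $R(\xi)V(Z(\xi))=1$, $U(\xi)=W(Z(\xi))$, where $\mathrm dZ/\mathrm d\xi=R=1/V(Z)$, $Z(0)=0$, and $1/k=Z(1/K)$. **Hyperbolicity and convexity.** The mean values in $(\mathrm E)$ and $(\mathrm L)$ are functions of the local parameters of the manifold of periodic profiles, e.g. $(j,\sigma,\lambda,\mu)$. A system $\partial_T\mathbf W(\mathbf P)+\partial_X\mathbf F(\mathbf P)=0$ is hyperbolic where $D\mathbf W$ is invertible and $(D\mathbf W)^{-1}D\mathbf F$ is diagonalizable with real eigenvalues. In the last part of the statement, $\mathrm e$ (resp. $\mathrm E$) is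 regarded as a smooth function of the indicated three variables, and strict convexity is meant in the sense usual for hyperbolic systems of conservation laws (positive definite Hessian). *)

(* Defs.v *)
(* Library: MathComp and MathComp-Analysis. *)
From HB Require Import structures.
From mathcomp Require Import all_boot all_order all_algebra.
From mathcomp Require Import all_classical all_reals all_analysis.

Set Implicit Arguments.
Unset Strict Implicit.
Unset Printing Implicit Defensive.

Import Order.TTheory GRing.Theory Num.Theory.
Import numFieldNormedType.Exports.

Local Open Scope classical_set_scope.
Local Open Scope ring_scope.

Section Calculus.
Context {R : realType}.

(* For finite-dimensional V and open D this is the class C^k(D): all iterated
   directional derivatives up to order k exist and are continuous on D. *)
Fixpoint Ck_on {V W : normedModType R} (k : nat) (D : set V) (f : V -> W)
    : Prop :=
  (forall x, D x -> {for x, continuous f}) /\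
  match k with
  | 0%N => True
  | k'.+1 => forall v : V, (forall x, D x -> derivable f x v) /\
                           Ck_on k' D (fun x => 'D_v f x)
  end.

Definition smooth_on {V W : normedModType R} (D : set V) (f : V -> W) : Prop :=
  forall k, Ck_on k D f.

Definition partial1 (f : R -> R -> R) (a b : R) : R :=
  derive1 (fun t => f t b) a.

Definition partial2 (f : R -> R -> R) (a b : R) : R := derive1 (f a) b.

Definition hessian {n : nat} (h : 'rV[R]_n -> R) (x : 'rV[R]_n) : 'M[R]_n :=
  \matrix_(i, j)
    'D_(delta_mx 0 i) (fun y => 'D_(delta_mx 0 j) h y) x.

Definition positive_definite {n : nat} (A : 'M[R]_n) : Prop :=
  forall z : 'rV[R]_n, z != 0 -> 0 < (z *m A *m z^T) 0 0.

(* Near p, f is a smooth function h of q1, ..., qm taken as independent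
   variables (whence the rank condition), and the Hessian of h with respect to
   these variables is positive definite at the point q(p). *)
Definition strictly_convex_in {n m : nat} (q : 'rV[R]_n -> 'rV[R]_m)
    (f : 'rV[R]_n -> R) (p : 'rV[R]_n) : Prop :=
  \rank (jacobian q p) = m /\
  exists (h : 'rV[R]_m -> R) (O : set 'rV[R]_m),
    [/\ open O, O (q p), smooth_on O h,
        \forall p' \near p, f p' = h (q p')
      & positive_definite (hessian h (q p))].

(* The library's jacobian acts on row vectors, so that DW and DF are the
   transposes of jacobian W and jacobian F. The base field being the reals,
   diagonalizable means diagonalizable with real eigenvalues. *)
Definition hyperbolic_at {n : nat} (W F : 'rV[R]_n -> 'rV[R]_n)
    (p : 'rV[R]_n) : Prop :=
  let DW := (jacobian W p)^T in
  let DF := (jacobian F p)^T in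
  DW \in unitmx /\ diagonalizable (invmx DW *m DF).

(* d/dt W(P) + d/dx F(P) = 0 on D, points of the plane being pairs (t, x). *)
Definition solves_on {n : nat} (W F : 'rV[R]_n -> 'rV[R]_n)
    (D : set (R * R)) (P : R * R -> 'rV[R]_n) : Prop :=
  forall z, D z -> forall i : 'I_n,
    'D_((1, 0) : R * R) (fun y => W (P y) 0 i) z
    + 'D_((0, 1) : R * R) (fun y => F (P y) 0 i) z = 0.

Definition simply_connected (D : set (R * R)) : Prop :=
  (forall a b, D a -> D b -> exists g : R -> R * R,
     [/\ {within `[0, 1], continuous g}, g @` `[0, 1] `<=` D,
         g 0 = a & g 1 = b]) /\
  (forall g : R -> R * R,
     {within `[0, 1], continuous g} -> g @` `[0, 1] `<=` D -> g 0 = g 1 ->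
     exists (H : R * R -> R * R) (c : R * R),
       [/\ {within `[0, 1] `*` `[0, 1], continuous H},
           H @` (`[0, 1] `*` `[0, 1]) `<=` D,
           forall s, `[0, 1]%classic s -> H (s, 0) = H (s, 1),
           forall t, `[0, 1]%classic t -> H (0, t) = g t
         & forall t, `[0, 1]%classic t -> H (1, t) = c]).

Definition mean (f : R -> R) : R := Rintegral lebesgue_measure `[0, 1] f.

Definition vec3 (a b c : R) : 'rV[R]_3 := \row_i [:: a; b; c]`_i.
Definition vec4 (a b c d : R) : 'rV[R]_4 := \row_i [:: a; b; c; d]`_i.

End Calculus.

Section Whitham.
Context {R : realType}.
Variable eps : R -> R -> R.

(* eps v q is the specific energy, q standing for v_y; it is only meaningful
   for v > 0. *)
Definition smooth_energy : Prop :=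
  smooth_on [set z : R * R | 0 < z.1] (fun z => eps z.1 z.2).

(* rho eps(1/rho, -rho_x/rho^3), with q standing for rho_x. *)
Definition Een (rho q : R) : R := rho * eps (rho^-1) (- q / rho ^+ 3).

(* A parameter p is the row vector (j, sigma, lambda, mu). *)
Definition par_j (p : 'rV[R]_4) : R := p 0 (@Ordinal 4 0 isT).
Definition par_sigma (p : 'rV[R]_4) : R := p 0 (@Ordinal 4 1 isT).
Definition par_lambda (p : 'rV[R]_4) : R := p 0 (@Ordinal 4 2 isT).
Definition par_mu (p : 'rV[R]_4) : R := p 0 (@Ordinal 4 3 isT).

Section Eulerian.
Variables (K : 'rV[R]_4 -> R) (Rho U : 'rV[R]_4 -> R -> R).

(* A smooth family of traveling-wave profiles (Rho, U)(p, xi), away from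
   vacuum, in which p = (j, sigma, lambda, mu) is used as local coordinates on
   the manifold of periodic profiles; (K p)^-1 is a period of the profile. *)
Record eulerian_profiles (Om : set 'rV[R]_4) : Prop := {
  K_smooth : smooth_on Om K;
  Rho_smooth : smooth_on (Om `*` [set: R]) (fun z => Rho z.1 z.2);
  U_smooth : smooth_on (Om `*` [set: R]) (fun z => U z.1 z.2);
  K_gt0 : forall p, Om p -> 0 < K p;
  Rho_gt0 : forall p x, Om p -> 0 < Rho p x;
  Rho_periodic : forall p x, Om p -> Rho p (x + (K p)^-1) = Rho p x;
  U_periodic : forall p x, Om p -> U p (x + (K p)^-1) = U p x;
  euler_mass : forall p x, Om p -> Rho p x * (U p x - par_sigma p) = par_j p;
  euler_ode : forall p x, Om p ->
    derive1 (Rho p) x * partial2 Een (Rho p x) (derive1 (Rho p) x)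
    - Een (Rho p x) (derive1 (Rho p) x)
    + par_j p ^+ 2 / (2 * Rho p x) + par_mu p * Rho p x = - par_lambda p
}.

(* Functions of the rescaled phase t = theta, 1-periodic. K_drho0 is
   K * d_theta rho0, and Erhox0 is dE/d(rho_x) at (rho0, K_drho0). *)
Definition rho0 (p : 'rV[R]_4) (t : R) : R := Rho p (t / K p).
Definition u0 (p : 'rV[R]_4) (t : R) : R := U p (t / K p).
Definition K_drho0 (p : 'rV[R]_4) (t : R) : R := K p * derive1 (rho0 p) t.
Definition E0 (p : 'rV[R]_4) (t : R) : R := Een (rho0 p t) (K_drho0 p t).
Definition Erhox0 (p : 'rV[R]_4) (t : R) : R :=
  partial2 Een (rho0 p t) (K_drho0 p t).
Definition g0 (p : 'rV[R]_4) (t : R) : R :=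
  partial1 Een (rho0 p t) (K_drho0 p t) - K p * derive1 (Erhox0 p) t.

Definition mean_rho p : R := mean (rho0 p).
Definition mean_u p : R := mean (u0 p).
Definition mean_rhou p : R := mean (fun t => rho0 p t * u0 p t).

Definition WE (p : 'rV[R]_4) : 'rV[R]_4 :=
  vec4 (K p) (mean_rho p) (mean_u p) (mean_rhou p).

Definition FE (p : 'rV[R]_4) : 'rV[R]_4 :=
  vec4 (par_sigma p * K p)
       (mean_rhou p)
       (mean (fun t => u0 p t ^+ 2 / 2) + mean (g0 p))
       (mean (fun t => rho0 p t * u0 p t ^+ 2 + rho0 p t * g0 p t
                       + K_drho0 p t * Erhox0 p t - E0 p t)).

Definition energyE (p : 'rV[R]_4) : R :=
  mean (E0 p) + mean (fun t => rho0 p t * u0 p t ^+ 2) / 2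
  - (mean_rhou p ^+ 2 / mean_rho p) / 2.

Definition DE (p : 'rV[R]_4) : R := mean_rho p * mean_u p - mean_rhou p.

Definition varsE (p : 'rV[R]_4) : 'rV[R]_3 := vec3 (mean_rho p) (K p) (DE p / K p).

(* dY = <rho0> dX - <rho0 u0> dT along the modulation P on D. *)
Definition mass_coordinate (D : set (R * R)) (P : R * R -> 'rV[R]_4)
    (Y : R * R -> R) : Prop :=
  smooth_on D Y /\
  forall z, D z ->
    is_derive z ((0, 1) : R * R) Y (mean_rho (P z)) /\
    is_derive z ((1, 0) : R * R) Y (- mean_rhou (P z)).

End Eulerian.

Section Lagrangian.
Variables (k : 'rV[R]_4 -> R) (V W : 'rV[R]_4 -> R -> R).

Record lagrangian_profiles (Om : set 'rV[R]_4) : Prop := {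
  k_smooth : smooth_on Om k;
  V_smooth : smooth_on (Om `*` [set: R]) (fun z => V z.1 z.2);
  W_smooth : smooth_on (Om `*` [set: R]) (fun z => W z.1 z.2);
  k_gt0 : forall p, Om p -> 0 < k p;
  V_gt0 : forall p x, Om p -> 0 < V p x;
  V_periodic : forall p x, Om p -> V p (x + (k p)^-1) = V p x;
  W_periodic : forall p x, Om p -> W p (x + (k p)^-1) = W p x;
  lagr_mass : forall p x, Om p -> W p x - par_j p * V p x = par_sigma p;
  lagr_ode : forall p x, Om p ->
    derive1 (V p) x * partial2 eps (V p x) (derive1 (V p) x)
    - eps (V p x) (derive1 (V p) x)
    + par_j p ^+ 2 * V p x ^+ 2 / 2 + par_lambda p * V p x = - par_mu p
}.

Definition v0 (p : 'rV[R]_4) (t : R) : R := V p (t / k p).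
Definition w0 (p : 'rV[R]_4) (t : R) : R := W p (t / k p).
Definition k_dv0 (p : 'rV[R]_4) (t : R) : R := k p * derive1 (v0 p) t.
Definition eps0 (p : 'rV[R]_4) (t : R) : R := eps (v0 p t) (k_dv0 p t).
Definition epsvy0 (p : 'rV[R]_4) (t : R) : R :=
  partial2 eps (v0 p t) (k_dv0 p t).
Definition p0 (p : 'rV[R]_4) (t : R) : R :=
  - partial1 eps (v0 p t) (k_dv0 p t) + k p * derive1 (epsvy0 p) t.

Definition mean_v p : R := mean (v0 p).
Definition mean_w p : R := mean (w0 p).
Definition mean_vw p : R := mean (fun t => v0 p t * w0 p t).

Definition WL (p : 'rV[R]_4) : 'rV[R]_4 :=
  vec4 (k p) (mean_v p) (mean_w p) (mean_vw p).

Definition FL (p : 'rV[R]_4) : 'rV[R]_4 :=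
  vec4 (- (par_j p * k p))
       (- mean_w p)
       (mean (p0 p))
       (mean (fun t => - (w0 p t ^+ 2 / 2) + v0 p t * p0 p t + eps0 p t
                       - k_dv0 p t * epsvy0 p t)).

Definition energyL (p : 'rV[R]_4) : R :=
  mean (eps0 p) + mean (fun t => w0 p t ^+ 2) / 2 - mean_w p ^+ 2 / 2.

Definition DeltaL (p : 'rV[R]_4) : R := mean_vw p - mean_v p * mean_w p.

Definition varsL (p : 'rV[R]_4) : 'rV[R]_3 := vec3 (mean_v p) (k p) (DeltaL p / k p).

End Lagrangian.

(* The mass Lagrangian phase zeta = Z(xi), with dZ/dxi = Rho = 1/V(Z). *)
Definition corresponding_profiles (Om : set 'rV[R]_4)
    (K : 'rV[R]_4 -> R) (Rho U : 'rV[R]_4 -> R -> R)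
    (k : 'rV[R]_4 -> R) (V W : 'rV[R]_4 -> R -> R) : Prop :=
  forall p, Om p -> exists Z : R -> R,
    [/\ Z 0 = 0, forall x : R, is_derive x (1 : R) Z (Rho p x),
        forall x, Rho p x * V p (Z x) = 1, forall x, U p x = W p (Z x)
      & (k p)^-1 = Z (K p)^-1].

End Whitham.

(* Main.v *)
Require Import Defs.
From HB Require Import structures.
From mathcomp Require Import all_boot all_order all_algebra.
From mathcomp Require Import all_classical all_reals all_analysis.
From mathcomp Require Import ring lra.
From mathcomp.real_closed Require complex.
Import Order.TTheory GRing.Theory Num.Theory.
Import numFieldNormedType.Exports.
Local Open Scope classical_set_scope.
Local Open Scope ring_scope.

(** Away from vacuum every mean in (E) and (L) is an elementary expression in
    j, sigma, k, v = <v0>, <v0^2> and the two integration constants of the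
    profile equation; the Eulerian densities are those of (L), together with 1,
    divided by v, and the Eulerian fluxes are F + w A / v for a Lagrangian
    density A of flux F.  Closedness of <rho0> dX - <rho0 u0> dT then yields the
    mass coordinate, along which the two systems are exchanged, and the two
    Jacobian pencils differ by an invertible factor, a dilation by v and a
    translation by w.

    The variables (v, k, delta), delta = Delta / k, and their Eulerian
    counterparts are exchanged by the involution (y0, y1, y2) |->
    (1/y0, y1/y0, y2/y0), and e = h(v, k, delta) becomes the perspective
    y0 h(1/y0, y1/y0, y2/y0), whose Hessian is that of h up to congruence.

    The function theta = <V' eps_{v_y}> / k satisfies
    d theta = - (j <v0^2> dj + v dlambda + dmu) / k, which is equivalent to
    de = (lambda + j^2 v) dv + (theta + j delta) dk + j k d delta.
    Strict convexity of e = h excludes constant profiles, and the Hessian of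
    w^2/2 + h symmetrizes (L). *)

(** * Differential calculus *)

(** Smoothness is given through iterated directional derivatives only; differentiability, the chain
    rule, symmetry of second derivatives and differentiation of means all have to be recovered from
    it. The main obstacle is that the profile equation is a first integral: its derivative is [V']
    times the Euler-Lagrange equation, and a constant profile solves the one without solving the
    other. The exchange of (E) and (L) must cover such profiles too, so it runs with two
    undetermined constants; only the convexity part identifies them with [- lambda] and [mu]. There
    the rank condition contained in strict convexity rules constant profiles out, because Delta is
    [j] times a variance. The function theta is the action of the profile over one period; varied at
    fixed rescaled phase, it has no boundary term, which is why its differential is so short.
    Convexity concerns three variables, whereas the invertibility of the Jacobian of the densities
    needs four independent differentials. The fourth direction is sigma. The profiles are not
    assumed to be independent of sigma, so the invariance of [v], [k] and delta has to be extracted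
    from the equality of the mixed derivatives of theta. *)

Lemma is_derive_line (R : realType) (V W : normedModType R) (f : V -> W)
    (x v : V) (t : R) :
  derivable f (x + t *: v) v ->
  is_derive t (1 : R) (fun s => f (x + s *: v)) ('D_v f (x + t *: v)).
Proof.
have E : (fun h : R => h^-1 *: (((fun s => f (x + s *: v)) \o shift t) (h *: 1)
    - f (x + t *: v))) =
    (fun h => h^-1 *: ((f \o shift (x + t *: v)) (h *: v) - f (x + t *: v))).
  apply/funext => h /=; congr (_ *: (f _ - _)).
  by rewrite [h *: 1]mulr1 scalerDl addrCA.
move=> df; split; first by rewrite /derivable E.
by rewrite /derive E.
Qed.

Lemma derivable_line_mvt (R : realType) (V : normedModType R) (f : V -> R)
    (x v : V) :
  (forall s : R, 0 <= s <= 1 -> derivable f (x + s *: v) v) ->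
  exists2 c : R, 0 <= c <= 1 & f (x + v) - f x = 'D_v f (x + c *: v).
Proof.
move=> df; pose g s := f (x + s *: v).
have dg (s : R) : s \in `[0, 1] -> is_derive s (1 : R) g ('D_v f (x + s *: v)).
  by rewrite in_itv /= => s01; apply/is_derive_line/df.
have cg : {within `[0, 1], continuous g}.
  by apply: derivable_within_continuous => s /dg /@ex_derive.
have dgo (s : R) : s \in `]0, 1[ -> is_derive s (1 : R) g ('D_v f (x + s *: v)).
  by rewrite in_itv /= => /andP[c0 c1]; apply: dg; rewrite in_itv /= !ltW.
have [c c01 E] := MVT_segment (@ler01 R) dgo cg.
exists c; first by move: c01; rewrite in_itv.
by move: E; rewrite /g scale1r scale0r addr0 subr0 mulr1.
Qed.

(** Restricted to the line through [x] along [v], this is the one-variable chain rule for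
    [s |-> a * s]; derivability in the single direction [v] suffices. *)
Lemma deriveZr (R : realType) (V W : normedModType R) (f : V -> W)
    (x v : V) (a : R) :
  derivable f x v -> is_derive x (a *: v) f (a *: 'D_v f x).
Proof.
move=> df; have [->|a0] := eqVneq a 0.
  by rewrite !scale0r; exact: is_derive0.
have L : is_derive (0 : R) (1 : R) (fun s : R => f (x + s *: v)) ('D_v f x).
  have := @is_derive_line R V W f x v 0; rewrite scale0r addr0; exact.
have M : is_derive (0 : R) (1 : R) (fun s : R => a * s) a.
  by apply: is_derive_eq; rewrite [_ *: _]mulr1.
have dL : differentiable (fun s : R => f (x + s *: v)) 0.
  exact/derivable1_diffP/ex_derive.
have dM : differentiable (fun s : R => a * s) 0.
  exact/derivable1_diffP/ex_derive.
have dLM : differentiable ((fun s : R => f (x + s *: v)) \o (fun s : R => a * s)) 0.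
  by apply: differentiable_comp => //; rewrite mulr0.
have E : (fun h : R => f (h *: (a *: v) + x)) =
    (fun s : R => f (x + s *: v)) \o (fun s : R => a * s).
  by apply/funext => h /=; rewrite addrC scalerA [h * a]mulrC.
split; first by apply/derivable1P; rewrite E; apply/derivable1_diffP.
have -> : 'D_(a *: v) f x = 'D_1 (fun h : R => f (h *: (a *: v) + x)) 0.
  rewrite /derive; set g1 := fun h : R => h^-1 *: _; set g2 := fun h : R => h^-1 *: _.
  suff -> : g1 = g2 by [].
  by apply/funext => h; rewrite /g1 /g2 /= addr0 scale0r add0r [h%:A]mulr1.
have dL0 : differentiable (fun s : R => f (x + s *: v)) (a * 0) by rewrite mulr0.
rewrite E deriveE // diff_comp //= -[X in 'd _ _ X]deriveE //.
rewrite (@derive_val _ _ _ _ _ _ _ M) mulr0 -[X in 'd _ _ X]mulr1.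
by rewrite [LHS]linearZ /= -deriveE // (@derive_val _ _ _ _ _ _ _ L).
Qed.

(** * Continuous directional derivatives and differentiability *)

Section ContinuousDirectional.
Variables (R : realType) (V : normedModType R) (f : V -> R) (D : set V).
Hypotheses (openD : open D) (df : forall x v, D x -> derivable f x v).

Lemma open_ball_sub (P : V -> Prop) (x : V) :
  D x -> (\forall y \near x, P y) ->
  exists2 d : R, 0 < d & forall y, `|y| < d -> D (x + y) /\ P (x + y).
Proof.
move=> Dx nP.
have : \forall y \near x, D y /\ P y.
  by apply: filterI => //; exact: open_nbhs_nbhs.
move=> /nbhs_ballP[d /= d0 xdP]; exists d => // y yd.
by apply: xdP; rewrite -ball_normE /ball_ /= opprD addrA subrr sub0r normrN.
Qed.

Lemma derive_mvt (x v : V) :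
  (forall s : R, 0 <= s <= 1 -> D (x + s *: v)) ->
  exists2 c : R, 0 <= c <= 1 & f (x + v) - f x = 'D_v f (x + c *: v).
Proof. by move=> xv; apply: derivable_line_mvt => s /xv /df. Qed.

Lemma derive_mvtZ (x v : V) (h : R) :
  (forall s : R, 0 <= s <= 1 -> D (x + s *: (h *: v))) ->
  exists2 c : R, 0 <= c <= 1 &
    f (x + h *: v) - f x = h * 'D_v f (x + c *: (h *: v)).
Proof.
move=> xv; have [c c01 ->] := derive_mvt _ _ xv; exists c => //.
by have [_ ->] := deriveZr R V R f (x + c *: (h *: v)) v h (df _ _ (xv _ c01)).
Qed.

(** The increment along [h *: (u + v)] is split at [x + h *: u], and the mean value theorem on each
    of the two legs gives a derivative at a point tending to [x], where both directional derivatives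
    are continuous. *)
Lemma deriveDr (x u v : V) : D x ->
  {for x, continuous (fun y => 'D_u f y)} -> {for x, continuous (fun y => 'D_v f y)} ->
  'D_(u + v) f x = 'D_u f x + 'D_v f x.
Proof.
move=> Dx cu cv; rewrite /derive; apply: cvg_lim => //.
apply/cvgrPdist_le => e e0.
have e20 : 0 < e / 2 by rewrite divr_gt0.
move/cvgrPdist_le : cu => /(_ _ e20) cu.
move/cvgrPdist_le : cv => /(_ _ e20) cv.
have [d d0 xd] := open_ball_sub _ _ Dx (filterI cu cv).
have M0 : 0 < `|u| + `|v| + 1 by rewrite ltr_wpDl // addr_ge0.
(* Covers the points of both legs: [b = 0] on the first one, [a = 1] on the second. *)
have small (h a b : R) : `|h| < d / (`|u| + `|v| + 1) -> 0 <= a <= 1 ->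
    0 <= b <= 1 -> `|(a * h) *: u + (b * h) *: v| < d.
  rewrite ltr_pdivlMr // => hd /andP[a0 a1] /andP[b0 b1].
  apply: le_lt_trans hd; rewrite (le_trans (ler_normD _ _)) // !normrZ.
  rewrite (ger0_norm a0) (ger0_norm b0) !mulrDr mulr1.
  rewrite -[leLHS]addr0 lerD // lerD // ler_wpM2r // ler_piMl //.
near=> h.
have h0 : h != 0 by near: h; exact: nbhs_dnbhs_neq.
have hd : `|h| < d / (`|u| + `|v| + 1).
  near: h; apply: dnbhs0_lt; exact: divr_gt0.
have I1 : 0 <= (1 : R) <= 1 by rewrite ler01 lexx.
have I0 : 0 <= (0 : R) <= 1 by rewrite ler01 lexx.
have [a a01 Ea] : exists2 c : R, 0 <= c <= 1 &
    f (x + h *: u) - f x = h * 'D_u f (x + c *: (h *: u)).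
  apply: derive_mvtZ => s s01.
  have /xd[+ _] := small h s 0 hd s01 I0.
  by rewrite mul0r scale0r addr0 scalerA.
have [b b01 Eb] : exists2 c : R, 0 <= c <= 1 &
    f (x + h *: u + h *: v) - f (x + h *: u) =
    h * 'D_v f (x + h *: u + c *: (h *: v)).
  apply: derive_mvtZ => s s01.
  have /xd[+ _] := small h 1 s hd I1 s01.
  by rewrite mul1r scalerA addrA.
have -> : (f \o shift x) (h *: (u + v)) - f x =
    h * ('D_u f (x + a *: (h *: u)) + 'D_v f (x + h *: u + b *: (h *: v))).
  by rewrite mulrDr -Ea -Eb /= scalerDr [_ + x]addrC [RHS]addrC !addrA subrK.
rewrite [_ *: _]mulrA mulVf // mul1r opprD addrACA.
apply: le_trans (ler_normD _ _) _; rewrite [leRHS]splitr; apply: lerD.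
  have /xd[_ [+ _]] := small h a 0 hd a01 I0.
  by rewrite mul0r scale0r addr0 scalerA.
have /xd[_ [_ +]] := small h 1 b hd I1 b01.
by rewrite mul1r scalerA addrA.
Unshelve. all: by end_near. Qed.

End ContinuousDirectional.

(** The coordinate forms must be continuous, for the continuity of the differential built from them
    and for the Lipschitz bound on the error; the vectors [e] span but need not be independent. *)
Definition findim {R : realType} (V : normedModType R) : Prop :=
  exists (n : nat) (e : 'I_n -> V) (c : 'I_n -> {linear V -> R^o}),
    (forall i, continuous (c i)) /\ forall x, x = \sum_i c i x *: e i.

Section Differentiability.
Variables (R : realType) (V : normedModType R) (f : V -> R) (D : set V).
Hypotheses (openD : open D) (df : forall x v, D x -> derivable f x v).
Hypothesis cdf : forall x v, D x -> {for x, continuous (fun y => 'D_v f y)}.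

Lemma derive_lincomb n (e : 'I_n -> V) (a : 'I_n -> R) x : D x ->
  'D_(\sum_i a i *: e i) f x = \sum_i a i * 'D_(e i) f x.
Proof.
move=> Dx; elim/big_rec2 : _ => [|i y z _ IH]; first by rewrite derive0.
rewrite (@deriveDr R V f D) //; [|exact: cdf..].
by have [_ ->] := deriveZr R V R f x (e i) (a i) (df _ _ Dx); rewrite IH.
Qed.

(** The mean value theorem along the segment to [x + h], in the direction [h], gives one
    intermediate point; expanding both derivatives in coordinates leaves an error controlled by the
    oscillation of finitely many partial derivatives. *)
Lemma C1_differentiable x : findim V -> D x -> differentiable f x.
Proof.
move=> [n [e [c [cc ce]]]] Dx.
have derE y v : D y -> 'D_v f y = \sum_i c i v * 'D_(e i) f y.
  by move=> Dy; rewrite {1}(ce v); exact: derive_lincomb.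
have [M M0 cM] : exists2 M : R, 0 < M & forall i h, `|c i h| <= M * `|h|.
  have k i : exists k : R, 0 < k /\ forall h, `|c i h| <= k * `|h|.
    by have [k k0 kP] := linear_lipschitz (cc i); exists k.
  have [K KP] := choice k.
  exists (1 + \sum_i K i).
    by rewrite ltr_pwDl // sumr_ge0 // => i _; case: (KP i) => /ltW.
  move=> i h; apply: le_trans ((KP i).2 h) _; rewrite ler_wpM2r //.
  rewrite (bigD1 i) //= addrCA lerDl addr_ge0 // sumr_ge0 // => j _.
  by case: (KP j) => /ltW.
have Llin : linear_for ( *:%R : R -> R^o -> R^o) (fun v : V => 'D_v f x : R^o).
  move=> a u v /=; rewrite !derE // scaler_sumr -big_split /=.
  by apply: eq_bigr => i _; rewrite linearP mulrDl -[in LHS]mulrA.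
pose L : {linear V -> R^o} := HB.pack (fun v : V => 'D_v f x : R^o)
  (GRing.isLinear.Build R V R^o *:%R (fun v : V => 'D_v f x : R^o) Llin).
have Lc : continuous L.
  move=> v; rewrite /continuous_at.
  have -> : (L : V -> R^o) = (fun v => \sum_i c i v * 'D_(e i) f x).
    by apply/funext => w /=; rewrite derE.
  apply: cvg_big => [|i _]; [exact: add_continuous|apply: cvgMl; exact: cc].
have E : f \o shift x = cst (f x) + L +o_ 0 id.
  apply/eqaddoP => eps eps0.
  (* [n.+1] rather than [n] keeps the denominator positive in dimension 0. *)
  have eM : 0 < eps / (M * n.+1%:R) by rewrite divr_gt0 // mulr_gt0.
  have near_e : \forall y \near x, forall i,
      `|'D_(e i) f x - 'D_(e i) f y| <= eps / (M * n.+1%:R).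
    apply: filter_forall => i.
    by have /cvgrPdist_le /(_ _ eM) := cdf x (e i) Dx.
  have [d d0 dP] := open_ball_sub R V D openD _ x Dx near_e.
  near=> h; have hd : `|h| < d by near: h; exact: nbhs0_lt.
  have seg (s : R) : 0 <= s <= 1 -> `|s *: h| < d.
    move=> /andP[s0 s1]; rewrite normrZ ger0_norm //.
    by apply: le_lt_trans hd; rewrite ler_piMl.
  have [s /seg sd Es] := derive_mvt R V f D df x h (fun s s01 => (dP _ (seg s s01)).1).
  have [Ds nD] := dP _ sd.
  rewrite -[X in `|X| <= _]/(f (h + x) - (f x + 'D_h f x)) opprD addrA.
  rewrite [h + x]addrC Es !derE // -sumrB.
  apply: le_trans (ler_norm_sum _ _ _) _.
  apply: (@le_trans _ _ (\sum_(i < n) eps / n.+1%:R * `|h|)).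
    apply: ler_sum => i _; rewrite -mulrBr normrM.
    have B := nD i; rewrite distrC in B.
    apply: le_trans (ler_pM (normr_ge0 _) (normr_ge0 _) (cM i h) B) _.
    rewrite le_eqVlt; apply/orP; left; apply/eqP.
    have Mn : M != 0 by rewrite gt_eqF.
    have N0 : n.+1%:R != 0 :> R by rewrite pnatr_eq0.
    by move: N0; move: (n.+1%:R) => N N0; field; rewrite Mn N0.
  rewrite sumr_const card_ord -[leLHS]mulr_natr [leLHS]mulrAC.
  apply: ler_wpM2r => //.
  rewrite -mulrA; apply: ler_piMr; first exact: ltW.
  by rewrite ler_pdivrMl // mulr1 ler_nat.
apply/diff_locallyP; rewrite (diff_unique Lc E); split => //.
Unshelve. all: by end_near. Qed.

End Differentiability.

(** * Differentiation rules at a point *)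

Section PointwiseDerivatives.
Variables (R : realType) (V : normedModType R) (x v : V).
Implicit Types f g : V -> R.

Lemma is_der_cst (a : R) : is_derive x v (fun=> a) (0 : R).
Proof. exact: is_derive_cst. Qed.

Lemma is_der_add f g (df dg : R) : is_derive x v f df -> is_derive x v g dg ->
  is_derive x v (fun y => f y + g y) (df + dg).
Proof. by move=> hf hg; exact: is_deriveD. Qed.

Lemma is_der_opp f (df : R) : is_derive x v f df ->
  is_derive x v (fun y => - f y) (- df).
Proof. by move=> hf; exact: is_deriveN. Qed.

Lemma is_der_mul f g (df dg : R) : is_derive x v f df -> is_derive x v g dg ->
  is_derive x v (fun y => f y * g y) (f x * dg + g x * df).
Proof. by move=> hf hg; exact: is_deriveM. Qed.

Lemma is_der_inv f (df : R) : f x != 0 -> is_derive x v f df ->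
  is_derive x v (fun y => (f y)^-1) (- (f x ^+ 2)^-1 * df).
Proof. by move=> f0 [df1 <-]; split; [exact: derivableV|rewrite deriveV]. Qed.

Lemma is_der_exp n f (df : R) : is_derive x v f df ->
  is_derive x v (fun y => f y ^+ n.+1) (n.+1%:R * f x ^+ n * df).
Proof.
move=> hf; elim: n => [|n IHn].
  by rewrite expr0 !mul1r; under eq_fun do rewrite expr1.
under eq_fun do rewrite exprS.
apply: is_derive_eq (is_der_mul _ _ _ _ hf IHn) _.
by rewrite -[in RHS]natr1 exprS; ring.
Qed.

End PointwiseDerivatives.

Arguments is_der_cst {R V}.
Arguments is_der_add {R V x v f g df dg}.
Arguments is_der_opp {R V x v f df}.
Arguments is_der_mul {R V x v f g df dg}.
Arguments is_der_inv {R V} x v f {df}.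
Arguments is_der_exp {R V x v} n {f df}.

(** The inner map is only derivable along [v]: composing it with the line [h |-> h *: v + x] reduces
    the statement to the chain rule for differentiable maps. *)
Lemma is_der_comp (R : realType) (V1 V2 W : normedModType R) (g : V2 -> W)
    (f : V1 -> V2) (x v : V1) (df : V2) :
  differentiable g (f x) -> is_derive x v f df ->
  is_derive x v (fun y => g (f y)) ('D_df g (f x)).
Proof.
move=> dg [/derivable1P/derivable1_diffP dF <-].
pose F (h : R) := f (h *: v + x).
have F0 : F 0 = f x by rewrite /F scale0r add0r.
have dg0 : differentiable g (F 0) by rewrite F0.
have dgF : differentiable (g \o F) 0 by exact: differentiable_comp.
have DE (W' : normedModType R) (k : V1 -> W') :
    'D_v k x = 'D_1 (fun h : R => k (h *: v + x)) 0.
  rewrite /derive; set g1 := fun h : R => h^-1 *: _.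
  set g2 := fun h : R => h^-1 *: _.
  suff -> : g1 = g2 by [].
  by apply/funext => h; rewrite /g1 /g2 /= addr0 scale0r add0r [h%:A]mulr1.
split; first by apply/derivable1P/derivable1_diffP.
rewrite DE [RHS]deriveE // [in RHS]DE -[fun h : R => f _]/F.
by rewrite -[fun h : R => g _]/(g \o F) !deriveE // diff_comp //= F0.
Qed.

Arguments is_der_comp {R V1 V2 W} g f x v {df}.

Section FiniteDimension.
Variable R : realType.

Lemma findim_R : findim (R : normedModType R).
Proof.
exists 1%N, (fun=> 1), (fun=> idfun); split; first by move=> _ x; exact: cvg_id.
by move=> x; rewrite big_ord1 /= [_ *: _]mulr1.
Qed.

Lemma findim_rV n : findim ('rV[R]_n : normedModType R).
Proof.
have @c (i : 'I_n) : {linear 'rV[R]_n -> R^o}.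
  by exists (fun N : 'rV[R]_n => N 0 i); do 2![eexists]; do ?[constructor];
    rewrite ?mxE// => ? *; rewrite ?mxE//; move=> ?; rewrite !mxE.
exists n, (fun i => delta_mx 0 i), c; split; last exact: row_sum_delta.
by move=> i; exact: coord_continuous.
Qed.

Lemma findim_pair (V1 V2 : normedModType R) :
  findim V1 -> findim V2 -> findim ((V1 * V2)%type : normedModType R).
Proof.
move=> [m [e [c [cc ce]]]] [n [e' [c' [cc' ce']]]].
pose d0 (i : 'I_(m + n)) (z : (V1 * V2)%type) : R^o :=
  match fintype.split i with inl j => c j z.1 | inr j => c' j z.2 end.
have dlin i : linear_for ( *:%R : R -> R^o -> R^o) (d0 i).
  by rewrite /d0; case: (fintype.split i) => j a u v; rewrite /= linearP.
pose d i : {linear (V1 * V2)%type -> R^o} := HB.pack (d0 i)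
  (GRing.isLinear.Build R (V1 * V2)%type R^o *:%R (d0 i) (dlin i)).
exists (m + n)%N, (fun i => match fintype.split i with inl j => (e j, 0)
  | inr j => (0, e' j) end), d; split.
  move=> i z; rewrite /d /= /d0; case: (fintype.split i) => j.
    by apply: (@continuous_comp _ _ _ fst (c j)); [exact: cvg_fst|exact: cc].
  by apply: (@continuous_comp _ _ _ snd (c' j)); [exact: cvg_snd|exact: cc'].
move=> [x y]; rewrite big_split_ord /=.
under eq_bigr => i _ do rewrite /d /= /d0 (unsplitK (inl i)) /=.
under [X in _ + X]eq_bigr => i _ do rewrite /d /= /d0 (unsplitK (inr i)) /=.
have -> : \sum_(i < m) c i x *: (e i, 0 : V2) = (x, 0).
  rewrite [in RHS](ce x); elim/big_rec2 : _ => [//|i u _ _ ->].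
  by congr pair; rewrite /= scaler0 addr0.
have -> : \sum_(i < n) c' i y *: (0 : V1, e' i) = (0, y).
  rewrite [in RHS](ce' y); elim/big_rec2 : _ => [//|i u _ _ ->].
  by congr pair; rewrite /= scaler0 addr0.
by congr pair; rewrite /= ?addr0 ?add0r.
Qed.

End FiniteDimension.

(** * Closure properties of the classes C^k *)

Section CkCalculus.
Variable R : realType.
Implicit Types V W : normedModType R.

Lemma Ck_on_continuous V W k (D : set V) (f : V -> W) x :
  Ck_on k D f -> D x -> {for x, continuous f}.
Proof. by case: k => [|k] [cf _]; exact: cf. Qed.

Lemma Ck_on_derivable V W k (D : set V) (f : V -> W) x v :
  Ck_on k.+1 D f -> D x -> derivable f x v.
Proof. by move=> [_ /(_ v)[df _]]; exact: df. Qed.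

Lemma Ck_on_derive V W k (D : set V) (f : V -> W) v :
  Ck_on k.+1 D f -> Ck_on k D (fun x => 'D_v f x).
Proof. by move=> [_ /(_ v)[_]]. Qed.

Lemma Ck_onS V W k (D : set V) (f : V -> W) : Ck_on k.+1 D f -> Ck_on k D f.
Proof.
elim: k f => [|k IH] f [cf df]; split => // v; split; first exact: (df v).1.
by apply: IH; exact: (df v).2.
Qed.

Lemma Ck_on0 V W k (D : set V) (f : V -> W) : Ck_on k D f -> Ck_on 0 D f.
Proof. by elim: k => // k IH /Ck_onS/IH. Qed.

Lemma Ck_on_sub V W k (D D' : set V) (f : V -> W) :
  D' `<=` D -> Ck_on k D f -> Ck_on k D' f.
Proof.
move=> D'D; elim: k f => [|k IH] f [cf df]; split => //.
- by move=> x /D'D; exact: cf.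
- by move=> x /D'D; exact: cf.
- move=> v; split; first by move=> x /D'D; exact: (df v).1.
  by apply: IH; exact: (df v).2.
Qed.

Lemma open_near_eq V (T : Type) (D : set V) (f g : V -> T) x :
  open D -> (forall y, D y -> f y = g y) -> D x -> {near x, f =1 g}.
Proof. by move=> oD fg Dx; apply: filterS (open_nbhs_nbhs (conj oD Dx)). Qed.

Lemma near_eq_continuous V W (f g : V -> W) x :
  {near x, f =1 g} -> {for x, continuous f} -> {for x, continuous g}.
Proof.
move=> fg cf; suff : g @ x --> g x by [].
rewrite -(nbhs_singleton fg); apply: cvg_trans cf; apply: near_eq_cvg.
by apply: filterS fg.
Qed.

Lemma Ck_on_ext V W k (D : set V) (f g : V -> W) : open D ->
  (forall x, D x -> f x = g x) -> Ck_on k D f -> Ck_on k D g.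
Proof.
move=> oD; elim: k f g => [|k IH] f g fg [cf df]; split => //.
- move=> x Dx; apply: near_eq_continuous (cf _ Dx).
  exact: (open_near_eq _ _ _ _ _ _ oD fg Dx).
- move=> x Dx; apply: near_eq_continuous (cf _ Dx).
  exact: (open_near_eq _ _ _ _ _ _ oD fg Dx).
- move=> v; split.
    move=> x Dx; have nfg := open_near_eq _ _ _ _ _ _ oD fg Dx.
    exact: near_eq_derivable nfg ((df v).1 _ Dx).
  apply: IH (df v).2 => x Dx; apply: near_eq_derive.
  exact: (open_near_eq _ _ _ _ _ _ oD fg Dx).
Qed.

Lemma Ck_on_local V W k (D : set V) (f : V -> W) :
  (forall x, D x -> exists2 B : set V, B x & Ck_on k B f) -> Ck_on k D f.
Proof.
elim: k f => [|k IH] f H; split => //.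
- by move=> x /H[B Bx /Ck_on_continuous]; apply.
- by move=> x /H[B Bx /Ck_on_continuous]; apply.
- move=> v; split; first by move=> x /H[B Bx /Ck_on_derivable]; apply.
  by apply: IH => x /H[B Bx /(Ck_on_derive _ _ _ _ _ v)]; exists B.
Qed.

(** Induction step behind the closure properties: on an open set the derivatives may be replaced by
    any explicit formula for them. *)
Lemma Ck_on_step V W k (D : set V) (f : V -> W) (df : V -> V -> W) :
  open D -> (forall x, D x -> {for x, continuous f}) ->
  (forall x v, D x -> is_derive x v f (df v x)) ->
  (forall v, Ck_on k D (df v)) -> Ck_on k.+1 D f.
Proof.
move=> oD cf dfP kdf; split => // v; split.
  by move=> x /(dfP _ v)/@ex_derive.
by apply: Ck_on_ext (kdf v) => // x /(dfP _ v)[_ ->].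
Qed.

Lemma Ck_on_cst V W k (D : set V) (a : W) : open D -> Ck_on k D (fun=> a).
Proof.
move=> oD; elim: k a => [|k IH] a; first by split => // x _; exact: cvg_cst.
apply: (Ck_on_step _ _ _ _ _ (fun _ _ => 0)) => // x *; exact: cvg_cst.
Qed.

Lemma is_der_linear V W (L : {linear V -> W}) (x v : V) : continuous L ->
  is_derive x v L (L v).
Proof.
move=> cL; have dL := linear_differentiable x cL.
by split; [exact: diff_derivable|rewrite deriveE // diff_lin].
Qed.

Lemma Ck_on_linear V W k (D : set V) (L : {linear V -> W}) : open D ->
  continuous L -> Ck_on k D L.
Proof.
move=> oD cL; case: k => [|k]; first by split => // x _; exact: cL.
apply: (Ck_on_step _ _ _ _ _ (fun v _ => L v)) => //.
- by move=> x _; exact: cL.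
- by move=> x v _; exact: is_der_linear.
- by move=> v; exact: Ck_on_cst.
Qed.

Lemma Ck_on_linear_comp V W W' k (D : set V) (L : {linear W -> W'}) (f : V -> W) :
  open D -> continuous L -> Ck_on k D f -> Ck_on k D (fun x => L (f x)).
Proof.
move=> oD cL; elim: k f => [|k IH] f Cf.
  split => // x Dx; apply: continuous_comp; last exact: cL.
  exact: Ck_on_continuous Cf Dx.
apply: (Ck_on_step _ _ _ _ _ (fun v x => L ('D_v f x))) => //.
- move=> x Dx; apply: continuous_comp; last exact: cL.
  exact: Ck_on_continuous Cf Dx.
- move=> x v Dx.
  have dL : differentiable L (f x) by exact: linear_differentiable.
  have df := derivableP (Ck_on_derivable _ _ _ _ _ _ v Cf Dx).
  have := is_der_comp L f x v dL df.
  by have [_ ->] := is_der_linear W W' L (f x) ('D_v f x) cL.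
- by move=> v; apply: IH; exact: Ck_on_derive.
Qed.

Lemma Ck_on_add V k (D : set V) (f g : V -> R) : open D ->
  Ck_on k D f -> Ck_on k D g -> Ck_on k D (fun x => f x + g x).
Proof.
move=> oD; elim: k f g => [|k IH] f g Cf Cg.
  split => // x Dx; apply: cvgD; [exact: Ck_on_continuous Cf Dx|exact: Ck_on_continuous Cg Dx].
apply: (Ck_on_step _ _ _ _ _ (fun v x => 'D_v f x + 'D_v g x)) => //.
- move=> x Dx; apply: cvgD; [exact: Ck_on_continuous Cf Dx|exact: Ck_on_continuous Cg Dx].
- move=> x v Dx; apply: is_der_add; apply: derivableP;
    [exact: Ck_on_derivable Cf Dx|exact: Ck_on_derivable Cg Dx].
- by move=> v; apply: IH; exact: Ck_on_derive.
Qed.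

Lemma Ck_on_mul V k (D : set V) (f g : V -> R) : open D ->
  Ck_on k D f -> Ck_on k D g -> Ck_on k D (fun x => f x * g x).
Proof.
move=> oD; elim: k f g => [|k IH] f g Cf Cg.
  split => // x Dx; apply: cvgM; [exact: Ck_on_continuous Cf Dx|exact: Ck_on_continuous Cg Dx].
apply: (Ck_on_step _ _ _ _ _ (fun v x => f x * 'D_v g x + g x * 'D_v f x)) => //.
- move=> x Dx; apply: cvgM; [exact: Ck_on_continuous Cf Dx|exact: Ck_on_continuous Cg Dx].
- move=> x v Dx; apply: is_der_mul; apply: derivableP;
    [exact: Ck_on_derivable Cf Dx|exact: Ck_on_derivable Cg Dx].
- move=> v; apply: Ck_on_add => //; apply: IH;
    by [exact: Ck_onS|exact: Ck_on_derive].
Qed.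

Lemma Ck_on_opp V k (D : set V) (f : V -> R) : open D ->
  Ck_on k D f -> Ck_on k D (fun x => - f x).
Proof.
move=> oD Cf; under eq_fun do rewrite -mulN1r.
by apply: Ck_on_mul => //; exact: Ck_on_cst.
Qed.

Lemma Ck_on_inv V k (D : set V) (f : V -> R) : open D ->
  (forall x, D x -> f x != 0) -> Ck_on k D f -> Ck_on k D (fun x => (f x)^-1).
Proof.
move=> oD f0; elim: k => [|k IH] Cf.
  by split => // x Dx; apply: cvgV; [exact: f0|exact: Ck_on_continuous Cf Dx].
apply: (Ck_on_step _ _ _ _ _ (fun v x => - (f x ^+ 2)^-1 * 'D_v f x)) => //.
- by move=> x Dx; apply: cvgV; [exact: f0|exact: Ck_on_continuous Cf Dx].
- move=> x v Dx; apply: is_der_inv; first exact: f0.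
  apply: derivableP; exact: Ck_on_derivable Cf Dx.
- move=> v; apply: Ck_on_mul => //; last exact: Ck_on_derive.
  apply: Ck_on_opp => //; under eq_fun do rewrite expr2 invfM.
  by apply: Ck_on_mul => //; apply: IH; exact: Ck_onS.
Qed.

Lemma is_der_pair V W W' (f : V -> W) (g : V -> W') (x v : V) df dg :
  is_derive x v f df -> is_derive x v g dg ->
  is_derive x v (fun y => (f y, g y)) (df, dg).
Proof.
move=> [df1 <-] [dg1 <-]; rewrite /derivable /derive in df1 dg1 *.
have H : (fun h : R => h^-1 *: (((fun y => (f y, g y)) \o shift x) (h *: v)
    - (f x, g x))) @ 0^' --> ('D_v f x, 'D_v g x).
  exact: (@cvg_pair _ _ _ _ (nbhs ('D_v f x)) (nbhs ('D_v g x))).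
by split; [apply/cvg_ex; eexists; exact: H|exact: cvg_lim H].
Qed.

Lemma Ck_on_pair V W W' k (D : set V) (f : V -> W) (g : V -> W') : open D ->
  Ck_on k D f -> Ck_on k D g -> Ck_on k D (fun x => (f x, g x)).
Proof.
move=> oD; elim: k f g => [|k IH] f g Cf Cg.
  split => // x Dx.
  by apply: cvg_pair; [exact: Ck_on_continuous Cf Dx|exact: Ck_on_continuous Cg Dx].
apply: (Ck_on_step _ _ _ _ _ (fun v x => ('D_v f x, 'D_v g x))) => //.
- by move=> x Dx; apply: cvg_pair; [exact: Ck_on_continuous Cf Dx|exact: Ck_on_continuous Cg Dx].
- move=> x v Dx; apply: is_der_pair; apply: derivableP;
    [exact: Ck_on_derivable Cf Dx|exact: Ck_on_derivable Cg Dx].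
- by move=> v; apply: IH; exact: Ck_on_derive.
Qed.

Lemma Ck_on_differentiable V k (D : set V) (f : V -> R) x : findim V -> open D ->
  Ck_on k.+1 D f -> D x -> differentiable f x.
Proof.
move=> fV oD Cf Dx; apply: (C1_differentiable _ _ _ D) => //.
- by move=> y v; exact: Ck_on_derivable Cf.
- by move=> y v; apply: Ck_on_continuous; exact: Ck_on_derive Cf.
Qed.

Lemma Ck_on_sum V k n (D : set V) (f : 'I_n -> V -> R) : open D ->
  (forall i, Ck_on k D (f i)) -> Ck_on k D (fun x => \sum_i f i x).
Proof.
move=> oD Cf; elim: n f Cf => [|n IH] f Cf.
  by under eq_fun do rewrite big_ord0; exact: Ck_on_cst.
under eq_fun do rewrite big_ord_recl.
by apply: Ck_on_add => //; apply: IH.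
Qed.

(** In the chain rule the direction ['D_v f x] depends on [x], so the derivative of [g] is expanded
    over the fixed directions [e i]; the induction hypothesis then applies to [f] with each of these
    derivatives of [g]. *)
Lemma Ck_on_comp V W k (D : set V) (E : set W) (f : V -> W) (g : W -> R) :
  findim W -> open D -> open E -> (forall x, D x -> E (f x)) ->
  Ck_on k D f -> Ck_on k E g -> Ck_on k D (fun x => g (f x)).
Proof.
move=> fW oD oE fDE; have [n [e [c [cc ce]]]] := fW.
elim: k f g fDE => [|k IH] f g fDE Cf Cg.
  split => // x Dx; apply: continuous_comp; first exact: Ck_on_continuous Cf Dx.
  by apply: Ck_on_continuous Cg _; exact: fDE.
apply: (Ck_on_step _ _ _ _ _
  (fun v x => \sum_i c i ('D_v f x) * 'D_(e i) g (f x))) => //.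
- move=> x Dx; apply: continuous_comp; first exact: Ck_on_continuous Cf Dx.
  by apply: Ck_on_continuous Cg _; exact: fDE.
- move=> x v Dx; have Ef := fDE _ Dx.
  have dg := Ck_on_differentiable _ _ _ _ _ fW oE Cg Ef.
  have df := derivableP (Ck_on_derivable _ _ _ _ _ _ v Cf Dx).
  have := is_der_comp g f x v dg df.
  rewrite [in X in is_derive _ _ _ X](ce ('D_v f x)) (derive_lincomb _ _ _ E) //.
  - by move=> y u; exact: Ck_on_derivable Cg.
  - by move=> y u; apply: Ck_on_continuous; exact: Ck_on_derive Cg.
- move=> v; apply: Ck_on_sum => // i; apply: Ck_on_mul => //.
    apply: Ck_on_linear_comp => //; exact: Ck_on_derive.
  by apply: (IH f (fun y => 'D_(e i) g y)) => //;
    [exact: Ck_onS|exact: Ck_on_derive].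
Qed.

End CkCalculus.

Arguments is_der_linear {R V W}.

(** * Means *)

Section Mean.
Variable R : realType.
Implicit Types (f g F : R -> R) (a c e : R).

Definition continuous01 f := forall t : R, 0 <= t <= 1 -> {for t, continuous f}.

Lemma continuous01_within f : continuous01 f -> {within `[0, 1], continuous f}.
Proof.
by move=> cf; apply: continuous_in_subspaceT => t; rewrite inE /= in_itv /= => /cf.
Qed.

Lemma continuous01_integrable f : continuous01 f ->
  (@lebesgue_measure R).-integrable `[0, 1] (EFin \o f).
Proof.
move=> cf; apply: continuous_compact_integrable; first exact: segment_compact.
exact: continuous01_within.
Qed.

Lemma eq_mean f g : (forall t, 0 <= t <= 1 -> f t = g t) -> mean f = mean g.
Proof.
by move=> fg; apply: eq_Rintegral => t; rewrite inE /= in_itv /= => /fg.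
Qed.

Lemma mean_cst a : mean (fun=> a) = a.
Proof.
rewrite /mean Rintegral_cst; last exact: measurable_itv.
rewrite [X in fine X]lebesgue_measure_itv /= lte_fin ltr01 oppr0 adde0 mulr1.
by [].
Qed.

Lemma meanD f g : continuous01 f -> continuous01 g ->
  mean (fun t => f t + g t) = mean f + mean g.
Proof.
by move=> cf cg; rewrite /mean RintegralD //; exact: continuous01_integrable.
Qed.

Lemma meanZ a f : continuous01 f -> mean (fun t => a * f t) = a * mean f.
Proof.
by move=> cf; rewrite /mean RintegralZl //; exact: continuous01_integrable.
Qed.

Lemma meanB f g : continuous01 f -> continuous01 g ->
  mean (fun t => f t - g t) = mean f - mean g.
Proof.
by move=> cf cg; rewrite /mean RintegralB //; exact: continuous01_integrable.
Qed.

Lemma le_mean f g : continuous01 f -> continuous01 g ->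
  (forall t, 0 <= t <= 1 -> f t <= g t) -> mean f <= mean g.
Proof.
move=> /continuous01_integrable cf /continuous01_integrable cg fg.
apply: (le_Rintegral _ cf cg) => [|t]; first exact: measurable_itv.
by rewrite /= in_itv /= => /fg.
Qed.

Lemma mean_dist_le f g e : continuous01 f -> continuous01 g ->
  (forall t, 0 <= t <= 1 -> `|f t - g t| <= e) -> `|mean f - mean g| <= e.
Proof.
move=> cf cg fg; have cc a : continuous01 (fun=> a) by move=> t _; exact: cvg_cst.
have cB : continuous01 (fun t => f t - g t).
  by move=> t t01; apply: cvgB; [exact: cf|exact: cg].
rewrite -meanB // ler_norml -{1}(mean_cst (- e)) -[X in _ && (_ <= X)](mean_cst e).
by apply/andP; split; apply: le_mean => // t /fg; rewrite ler_norml => /andP[].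
Qed.

Lemma mean_FTC f F : continuous01 f ->
  (forall t : R, 0 <= t <= 1 -> is_derive t (1 : R) F (f t)) -> mean f = F 1 - F 0.
Proof.
move=> cf dF; rewrite /mean /Rintegral.
have cF (t : R) : 0 <= t <= 1 -> {for t, continuous F}.
  by move=> /dF/@ex_derive/derivable1_diffP/differentiable_continuous.
have I0 : 0 <= (0 : R) <= 1 by rewrite lexx ler01.
have I1 : 0 <= (1 : R) <= 1 by rewrite lexx ler01.
rewrite (@continuous_FTC2 R f F 0 1) //.
- exact: continuous01_within.
- split; [|exact: cvg_at_right_filter (cF _ I0)|exact: cvg_at_left_filter (cF _ I1)].
  move=> t; rewrite in_itv /= => /andP[t0 t1].
  by apply: ex_derive; apply: dF; rewrite !ltW.
- move=> t; rewrite in_itv /= => /andP[t0 t1].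
  by rewrite derive1E; apply: derive_val; apply: dF; rewrite !ltW.
Qed.

(** The lower limit -1 makes the primitive differentiable from both sides at 0, where the intervals
    of integration used later begin. *)
Lemma primitive_ex f : continuous f ->
  exists F, forall x : R, -1 < x -> is_derive x (1 : R) F (f x).
Proof.
move=> cf; pose F (x : R) := (\int[lebesgue_measure]_(t in [set` `[-1, x]]) f t)%R.
exists F => x x1; have x1' : x < x + 1 by rewrite ltrDl.
have fi : (@lebesgue_measure R).-integrable `[-1, x + 1] (EFin \o f).
  apply: continuous_compact_integrable; first exact: segment_compact.
  exact: continuous_subspaceT.
have [dF EF] := continuous_FTC1_closed x1' fi x1 (cf x).
by split; [exact: dF|rewrite -derive1E].
Qed.

(** Compactness of the unit interval makes the continuity at the points [(p, t)] uniform in [t]. *)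
Lemma tube (V : normedModType R) (g : V * R -> R) (p : V) e :
  (forall t : R, 0 <= t <= 1 -> {for (p, t), continuous g}) -> 0 < e ->
  \forall q \near p, forall t : R, 0 <= t <= 1 -> `|g (q, t) - g (p, t)| <= e.
Proof.
move=> cg e0; have e20 : 0 < e / 2 by rewrite divr_gt0.
have /compact_near_coveringP cov := @segment_compact R 0 1.
have H := cov V (nbhs p) (fun q t => `|g (q, t) - g (p, t)| <= e) (nbhs_filter p).
apply: filterS (H _).
  by move=> q + t t01; apply; rewrite /= in_itv.
move=> t; rewrite /= in_itv /= => t01.
have /cvgrPdist_le /(_ _ e20) : {for (p, t), continuous g} by exact: cg.
move=> [[A B] /= [nA nB] AB]; exists (B, A) => //= -[s q] /= [Bs Aq].
have H1 := AB (q, s) (conj Aq Bs).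
have H2 := AB (p, s) (conj (nbhs_singleton nA) Bs).
apply: le_trans (ler_distD (g (p, t)) _ _) _.
by rewrite (splitr e) [X in X + _]distrC lerD.
Qed.

Lemma continuous_slice (V W : normedModType R) (g : V * R -> W) (p : V) (t : R) :
  {for (p, t), continuous g} -> {for t, continuous (fun s => g (p, s))}.
Proof.
move=> cg; apply: (@continuous_comp _ _ _ (fun s : R => (p, s)) g) => //.
apply: (@cvg_pair _ _ _ _ (nbhs p) (nbhs t)); [exact: cvg_cst|exact: cvg_id].
Qed.

Lemma continuous_section (V W : normedModType R) (g : V * R -> W)
    (p : V) (t : R) :
  {for (p, t), continuous g} -> {for p, continuous (fun q => g (q, t))}.
Proof.
move=> cg; apply: (@continuous_comp _ _ _ (fun q : V => (q, t)) g) => //.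
apply: (@cvg_pair _ _ _ _ (nbhs p) (nbhs t)); [exact: cvg_id|exact: cvg_cst].
Qed.

(** * Means depending on a parameter *)

Section ParametricMean.
Variables (V : normedModType R) (D : set V) (E : set (V * R)).
Hypotheses (openD : open D) (openE : open E).
Hypothesis DE : forall p (t : R), D p -> 0 <= t <= 1 -> E (p, t).

Let slice01 (g : V * R -> R) p : (forall z, E z -> {for z, continuous g}) ->
  D p -> continuous01 (fun t => g (p, t)).
Proof. by move=> cg Dp t t01; apply: continuous_slice; apply: cg; exact: DE. Qed.

Lemma mean_continuous (g : V * R -> R) p :
  (forall z, E z -> {for z, continuous g}) -> D p ->
  {for p, continuous (fun q => mean (fun t => g (q, t)))}.
Proof.
move=> cg Dp; apply/cvgrPdist_le => e e0.
have cgp (t : R) : 0 <= t <= 1 -> {for (p, t), continuous g}.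
  by move=> t01; apply: cg; exact: DE.
near=> q; have Dq : D q by near: q; exact: open_nbhs_nbhs.
rewrite distrC; apply: mean_dist_le; [exact: slice01..|].
near: q; exact: tube.
Unshelve. all: by end_near. Qed.

Lemma is_derive_slice (g : V * R -> R) (q v : V) (s : R) :
  derivable g (q, s) (v, 0) ->
  is_derive q v (fun p => g (p, s)) ('D_(v, 0) g (q, s)).
Proof.
have EE : (fun h : R => h^-1 *: (((fun p => g (p, s)) \o shift q) (h *: v) - g (q, s)))
    = (fun h => h^-1 *: ((g \o shift (q, s)) (h *: (v, 0)) - g (q, s))).
  apply/funext => h /=; congr (_ *: (g _ - _)).
  by congr pair; rewrite /= scaler0 add0r.
by move=> dg; split; rewrite /derivable /derive EE.
Qed.

(** Differentiation under the integral sign: for each [t] the difference quotient in the parameter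
    is a derivative at an intermediate point, and [tube] bounds its distance to the derivative at
    [p] uniformly in [t]. *)
Lemma is_derive_mean (g : V * R -> R) p v :
  (forall z, E z -> {for z, continuous g}) ->
  (forall z, E z -> derivable g z (v, 0)) ->
  (forall z, E z -> {for z, continuous (fun z => 'D_(v, 0) g z)}) -> D p ->
  is_derive p v (fun q => mean (fun t => g (q, t)))
    (mean (fun t => 'D_(v, 0) g (p, t))).
Proof.
move=> cg dg cdg Dp; set F := fun q => _; set dF := mean _.
suff H : (fun h : R => h^-1 *: ((F \o shift p) (h *: v) - F p)) @ 0^' --> dF.
  by split; [apply/cvg_ex; exists dF|exact: cvg_lim H].
apply/cvgrPdist_le => e e0.
have cdgp (t : R) : 0 <= t <= 1 ->
    {for (p, t), continuous (fun z => 'D_(v, 0) g z)}.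
  by move=> t01; apply: cdg; exact: DE.
have [d d0 dP] := open_ball_sub _ _ _ openD _ _ Dp (tube _ _ _ _ cdgp e0).
have M0 : 0 < `|v| + 1 by rewrite ltr_wpDl.
near=> h; have h0 : h != 0 by near: h; exact: nbhs_dnbhs_neq.
have hd : `|h| < d / (`|v| + 1) by near: h; apply: dnbhs0_lt; exact: divr_gt0.
have seg (s : R) : 0 <= s <= 1 -> `|s *: (h *: v)| < d.
  move=> /andP[s0 s1]; rewrite ltr_pdivlMr // in hd; apply: le_lt_trans hd.
  rewrite !normrZ ger0_norm // mulrDr mulr1.
  apply: le_trans (_ : `|h| * `|v| <= _); last by rewrite lerDl.
  by rewrite ler_piMl // mulr_ge0.
have I1 : 0 <= (1 : R) <= 1 by rewrite ler01 lexx.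
have Dh : D (h *: v + p) by have [] := dP _ (seg _ I1); rewrite scale1r addrC.
have cS q : D q -> continuous01 (fun t => g (q, t)) by exact: slice01.
rewrite /= /F [_ *: _]mulrC -meanB; [|exact: cS..].
have cB : continuous01 (fun t => g (h *: v + p, t) - g (p, t)).
  by move=> t t01; apply: cvgB; [exact: cS Dh t t01|exact: cS Dp t t01].
rewrite [X in _ - X]mulrC -meanZ //; apply: mean_dist_le.
- exact: (slice01 (fun z => 'D_(v, 0) g z) p cdg Dp).
- by move=> t t01; apply: cvgM; [exact: cvg_cst|exact: cB].
move=> t t01.
have ds (s : R) : 0 <= s <= 1 -> is_derive (p + s *: (h *: v)) v
    (fun q => g (q, t)) ('D_(v, 0) g (p + s *: (h *: v), t)).
  move=> s01; apply: is_derive_slice; apply: dg; apply: DE => //.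
  exact: (dP _ (seg s s01)).1.
have dsZ (s : R) : 0 <= s <= 1 -> is_derive (p + s *: (h *: v)) (h *: v)
    (fun q => g (q, t)) (h *: 'D_(v, 0) g (p + s *: (h *: v), t)).
  by move=> /ds[d1 <-]; exact: deriveZr.
have [c c01 Ec] := derivable_line_mvt _ _ (fun q => g (q, t)) p (h *: v)
  (fun s s01 => @ex_derive _ _ _ _ _ _ _ (dsZ s s01)).
have [_ Ec'] := dsZ c c01.
rewrite [h *: v + p]addrC Ec Ec' [h *: _]mulrC [_ * (_ * h)]mulrC mulfK //.
by have [_ /(_ _ t01)] := dP _ (seg _ c01); rewrite distrC.
Unshelve. all: by end_near. Qed.

End ParametricMean.

End Mean.

(** * Smoothness of means and symmetry of second derivatives *)

Section Smooth.
Variable R : realType.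
Implicit Types V W : normedModType R.

Lemma Ck_on_mean V k (D : set V) (E : set (V * R)) (g : V * R -> R) :
  open D -> open E -> (forall p (t : R), D p -> 0 <= t <= 1 -> E (p, t)) ->
  Ck_on k E g -> Ck_on k D (fun p => mean (fun t => g (p, t))).
Proof.
move=> oD oE DE; elim: k g => [|k IH] g Cg.
  split => // p Dp; apply: (mean_continuous _ _ D E) => //.
  by move=> z Ez; exact: Ck_on_continuous Cg Ez.
have cg z : E z -> {for z, continuous g} by exact: Ck_on_continuous Cg.
have dg v z : E z -> derivable g z v by exact: Ck_on_derivable Cg.
have cdg v : Ck_on k E (fun z => 'D_v g z) by exact: Ck_on_derive.
apply: (Ck_on_step _ _ _ _ _ _
  (fun v p => mean (fun t => 'D_(v, 0) g (p, t)))) => //.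
- by move=> p Dp; exact: (mean_continuous _ _ D E).
- move=> p v Dp; apply: (is_derive_mean _ _ D E) => // [z|z Ez]; first exact: dg.
  exact: Ck_on_continuous (cdg (v, 0)) Ez.
- by move=> v; apply: (IH (fun z => 'D_(v, 0) g z)); exact: cdg.
Qed.

(** Two mean value theorems: along [h *: u] for [y |-> f (y + h *: v) - f y], then along [h *: v]
    for the derivative in the direction [u]. *)
Lemma second_difference V (D : set V) (f : V -> R) (x u v : V) (h : R) :
  open D -> Ck_on 2 D f ->
  (forall a b : R, 0 <= a <= 1 -> 0 <= b <= 1 ->
     D (x + (a * h) *: u + (b * h) *: v)) ->
  exists a b : R, [/\ 0 <= a <= 1, 0 <= b <= 1 &
    f (x + h *: u + h *: v) - f (x + h *: u) - f (x + h *: v) + f x =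
    h * h * 'D_v (fun y => 'D_u f y) (x + (a * h) *: u + (b * h) *: v)].
Proof.
move=> oD Cf xD; have I1 : 0 <= (1 : R) <= 1 by rewrite ler01 lexx.
have I0 : 0 <= (0 : R) <= 1 by rewrite ler01 lexx.
have dE (s : R) : 0 <= s <= 1 -> is_derive (x + s *: (h *: u)) (h *: u)
    (fun y => f (y + h *: v) - f y)
    (h * ('D_u f (x + s *: (h *: u) + h *: v) - 'D_u f (x + s *: (h *: u)))).
  move=> s01; rewrite !scalerA mulrBr.
  have D1 := xD s 1 s01 I1; have D0 := xD s 0 s01 I0.
  rewrite mul1r in D1; rewrite mul0r scale0r addr0 in D0.
  have [d0 e0] := deriveZr _ _ _ f _ u h (Ck_on_derivable _ _ _ _ _ _ _ u Cf D0).
  have [d1 e1] := deriveZr _ _ _ f _ u h (Ck_on_derivable _ _ _ _ _ _ _ u Cf D1).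
  have S1 : is_derive (x + (s * h) *: u) (h *: u) (fun y => f (y + h *: v))
      (h * 'D_u f (x + (s * h) *: u + h *: v)).
    have EE : (fun k : R => k^-1 *: (((fun y => f (y + h *: v)) \o
        shift (x + (s * h) *: u)) (k *: (h *: u)) - f (x + (s * h) *: u + h *: v)))
      = (fun k : R => k^-1 *: ((f \o shift (x + (s * h) *: u + h *: v))
          (k *: (h *: u)) - f (x + (s * h) *: u + h *: v))).
      by apply/funext => k /=; rewrite !addrA.
    by split; rewrite /derivable /derive EE.
  have S0 : is_derive (x + (s * h) *: u) (h *: u) f (h * 'D_u f (x + (s * h) *: u)).
    by split.
  exact: (is_der_add S1 (is_der_opp S0)).
have [a a01 Ea] := derivable_line_mvt _ _ (fun y => f (y + h *: v) - f y) x
  (h *: u) (fun s s01 => @ex_derive _ _ _ _ _ _ _ (dE s s01)).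
have [_ Ea'] := dE a a01; rewrite Ea' !scalerA in Ea.
have Cu : Ck_on 1 D (fun y => 'D_u f y) by exact: Ck_on_derive.
have Ds (s : R) : 0 <= s <= 1 -> D (x + (a * h) *: u + s *: (h *: v)).
  by move=> s01; rewrite scalerA; exact: xD.
have dU (s : R) (s01 : 0 <= s <= 1) := deriveZr _ _ _ (fun y => 'D_u f y) _ v h
  (Ck_on_derivable _ _ _ _ _ _ _ v Cu (Ds s s01)).
have [b b01 Eb] := derivable_line_mvt _ _ (fun y => 'D_u f y)
  (x + (a * h) *: u) (h *: v) (fun s s01 => @ex_derive _ _ _ _ _ _ _ (dU s s01)).
have [_ Eb'] := dU b b01; rewrite Eb' !scalerA in Eb.
exists a, b; split; [exact: a01|exact: b01|].
set A := 'D_v _ _ in Eb *; set B := f (x + h *: u + h *: v) in Ea *.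
set B1 := f (x + h *: u) in Ea *; set B2 := f (x + h *: v) in Ea *.
have -> : B - B1 - B2 + f x = B - B1 - (B2 - f x) by ring.
by rewrite Ea Eb -mulrA.
Qed.

(** The second difference is symmetric in [u] and [v], so it equals [h * h] times each of the two
    mixed derivatives, taken at points close to [x]; their continuity at [x] concludes. *)
Lemma schwarz V (D : set V) (f : V -> R) (x u v : V) :
  open D -> Ck_on 2 D f -> D x ->
  'D_u (fun y => 'D_v f y) x = 'D_v (fun y => 'D_u f y) x.
Proof.
move=> oD Cf Dx.
have cc (w w' : V) : {for x, continuous (fun z => 'D_w (fun y => 'D_w' f y) z)}.
  apply: (@Ck_on_continuous R V R 0 D) => //.
  by apply: Ck_on_derive; exact: Ck_on_derive.
apply/eqP; rewrite -subr_eq0 -normr_le0; apply/ler_addgt0Pr => e e0; rewrite add0r.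
have e20 : 0 < e / 2 by rewrite divr_gt0.
have /cvgrPdist_le /(_ _ e20) cuv := cc u v.
have /cvgrPdist_le /(_ _ e20) cvu := cc v u.
have [d d0 dP] := open_ball_sub _ _ _ oD _ _ Dx (filterI cuv cvu).
have M0 : 0 < `|u| + `|v| + 1 by rewrite ltr_wpDl // addr_ge0.
pose h := d / (`|u| + `|v| + 1) / 2.
have h0 : 0 < h by rewrite !divr_gt0.
have small (a b : R) : 0 <= a <= 1 -> 0 <= b <= 1 ->
    `|(a * h) *: u + (b * h) *: v| < d.
  move=> /andP[a0 a1] /andP[b0 b1].
  have hd : h * (`|u| + `|v| + 1) < d.
    by rewrite /h mulrAC divfK ?gt_eqF // ltr_pdivrMr // ltr_pMr // ltr1n.
  have nh (c : R) : 0 <= c -> c <= 1 -> `|c * h| <= h.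
    move=> c0 c1; have h0' := ltW h0.
    by rewrite (ger0_norm (mulr_ge0 c0 h0')); exact: ler_piMl.
  apply: le_lt_trans hd; apply: le_trans (ler_normD _ _) _.
  rewrite [`|(a * h) *: u|]normrZ [`|(b * h) *: v|]normrZ !mulrDr mulr1.
  rewrite -[leLHS]addr0; apply: lerD; last exact: ltW.
  by apply: lerD; apply: ler_wpM2r => //; exact: nh.
have P1 (a b : R) (a01 : 0 <= a <= 1) (b01 : 0 <= b <= 1) :
    D (x + (a * h) *: u + (b * h) *: v).
  by rewrite -addrA; exact: (dP _ (small a b a01 b01)).1.
have P2 (a b : R) (a01 : 0 <= a <= 1) (b01 : 0 <= b <= 1) :
    D (x + (a * h) *: v + (b * h) *: u).
  by rewrite addrAC; exact: P1.
have [a [b [a01 b01 E1]]] := second_difference _ D f x u v h oD Cf P1.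
have [b' [a' [b01' a01' E2]]] := second_difference _ D f x v u h oD Cf P2.
have E : 'D_v (fun y => 'D_u f y) (x + (a * h) *: u + (b * h) *: v) =
         'D_u (fun y => 'D_v f y) (x + (b' * h) *: v + (a' * h) *: u).
  have hh : h * h != 0 by rewrite mulf_neq0 // gt_eqF.
  apply: (mulfI hh); apply: (etrans (esym E1)); apply: (etrans _ E2).
  rewrite (addrAC x (h *: v) (h *: u)).
  by rewrite (addrAC (f (x + h *: u + h *: v)) (- f (x + h *: v))).
have [_ [_ B1]] := dP _ (small a b a01 b01); rewrite addrA in B1.
have [_ [B2 _]] := dP _ (small a' b' a01' b01').
rewrite addrA addrAC -E in B2.
move: B1 B2; set X := 'D_v _ x; set Y := 'D_u _ x; set Z := 'D_v _ _.
move: X Y Z => X Y Z XZ YZ; apply: le_trans (ler_distD Z Y X) _.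
by rewrite (splitr e); apply: lerD YZ _; rewrite distrC.
Qed.

End Smooth.

Section SmoothCalculus.
Variable R : realType.
Implicit Types V W : normedModType R.

Lemma smooth_on_ext V W (D : set V) (f g : V -> W) : open D ->
  (forall x, D x -> f x = g x) -> smooth_on D f -> smooth_on D g.
Proof. by move=> oD fg Cf k; exact: Ck_on_ext (Cf k). Qed.

Lemma smooth_on_sub V W (D D' : set V) (f : V -> W) :
  D' `<=` D -> smooth_on D f -> smooth_on D' f.
Proof. by move=> DD Cf k; exact: Ck_on_sub (Cf k). Qed.

Lemma smooth_on_cst V W (D : set V) (a : W) : open D -> smooth_on D (fun=> a).
Proof. by move=> oD k; exact: Ck_on_cst. Qed.

Lemma smooth_on_linear V W (D : set V) (L : {linear V -> W}) : open D ->
  continuous L -> smooth_on D L.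
Proof. by move=> oD cL k; exact: Ck_on_linear. Qed.

Lemma smooth_on_add V (D : set V) (f g : V -> R) : open D ->
  smooth_on D f -> smooth_on D g -> smooth_on D (fun x => f x + g x).
Proof. by move=> oD Cf Cg k; exact: Ck_on_add. Qed.

Lemma smooth_on_opp V (D : set V) (f : V -> R) : open D ->
  smooth_on D f -> smooth_on D (fun x => - f x).
Proof. by move=> oD Cf k; exact: Ck_on_opp. Qed.

Lemma smooth_on_mul V (D : set V) (f g : V -> R) : open D ->
  smooth_on D f -> smooth_on D g -> smooth_on D (fun x => f x * g x).
Proof. by move=> oD Cf Cg k; exact: Ck_on_mul. Qed.

Lemma smooth_on_exp V (D : set V) (f : V -> R) n : open D ->
  smooth_on D f -> smooth_on D (fun x => f x ^+ n).
Proof.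
move=> oD Cf; elim: n => [|n IH].
  by under eq_fun do rewrite expr0; exact: smooth_on_cst.
by under eq_fun do rewrite exprS; exact: smooth_on_mul.
Qed.

Lemma smooth_on_inv V (D : set V) (f : V -> R) : open D ->
  (forall x, D x -> f x != 0) -> smooth_on D f ->
  smooth_on D (fun x => (f x)^-1).
Proof. by move=> oD f0 Cf k; exact: Ck_on_inv. Qed.

Lemma smooth_on_pair V W W' (D : set V) (f : V -> W) (g : V -> W') : open D ->
  smooth_on D f -> smooth_on D g -> smooth_on D (fun x => (f x, g x)).
Proof. by move=> oD Cf Cg k; exact: Ck_on_pair. Qed.

Lemma smooth_on_comp V W (D : set V) (E : set W) (f : V -> W) (g : W -> R) :
  findim W -> open D -> open E -> (forall x, D x -> E (f x)) ->
  smooth_on D f -> smooth_on E g -> smooth_on D (fun x => g (f x)).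
Proof. by move=> fW oD oE DE Cf Cg k; exact: (Ck_on_comp _ _ _ _ D E). Qed.

Lemma smooth_on_derive V W (D : set V) (f : V -> W) v :
  smooth_on D f -> smooth_on D (fun x => 'D_v f x).
Proof. by move=> Cf k; exact: Ck_on_derive. Qed.

Lemma smooth_on_continuous V W (D : set V) (f : V -> W) x :
  smooth_on D f -> D x -> {for x, continuous f}.
Proof. by move=> /(_ 0) Cf; exact: Ck_on_continuous Cf. Qed.

Lemma smooth_on_is_derive V W (D : set V) (f : V -> W) x v :
  smooth_on D f -> D x -> is_derive x v f ('D_v f x).
Proof.
by move=> /(_ 1) Cf Dx; apply: derivableP; exact: Ck_on_derivable Cf Dx.
Qed.

Lemma smooth_on_differentiable V (D : set V) (f : V -> R) x :
  findim V -> open D -> smooth_on D f -> D x -> differentiable f x.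
Proof. by move=> fV oD /(_ 1) Cf Dx; exact: Ck_on_differentiable Cf Dx. Qed.

Lemma smooth_on_deriveD V (D : set V) (f : V -> R) x u v : open D ->
  smooth_on D f -> D x -> 'D_(u + v) f x = 'D_u f x + 'D_v f x.
Proof.
move=> oD Cf Dx; apply: (deriveDr _ _ _ D) => //.
- by move=> y w Dy; exact: Ck_on_derivable (Cf 1) Dy.
- exact: smooth_on_continuous (smooth_on_derive _ _ _ _ u Cf) Dx.
- exact: smooth_on_continuous (smooth_on_derive _ _ _ _ v Cf) Dx.
Qed.

Lemma smooth_on_deriveZ V (D : set V) (f : V -> R) x v a :
  smooth_on D f -> D x -> 'D_(a *: v) f x = a * 'D_v f x.
Proof.
by move=> Cf Dx; have [_ ->] := deriveZr _ _ _ f x v a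
  (Ck_on_derivable _ _ _ _ _ _ _ v (Cf 1) Dx).
Qed.

Lemma smooth_on_mean V (D : set V) (E : set (V * R)) (g : V * R -> R) :
  open D -> open E -> (forall p (t : R), D p -> 0 <= t <= 1 -> E (p, t)) ->
  smooth_on E g -> smooth_on D (fun p => mean (fun t => g (p, t))).
Proof. by move=> oD oE DE Cg k; exact: (Ck_on_mean _ _ _ D E). Qed.

Lemma smooth_on_is_derive_mean V (D : set V) (E : set (V * R))
    (g : V * R -> R) p v :
  open D -> open E -> (forall p (t : R), D p -> 0 <= t <= 1 -> E (p, t)) ->
  smooth_on E g -> D p ->
  is_derive p v (fun q => mean (fun t => g (q, t)))
    (mean (fun t => 'D_(v, 0) g (p, t))).
Proof.
move=> oD oE DE Cg Dp; apply: (is_derive_mean _ _ D E) => // z Ez.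
- exact: smooth_on_continuous Cg Ez.
- exact: Ck_on_derivable (Cg 1) Ez.
- exact: smooth_on_continuous (smooth_on_derive _ _ _ _ _ Cg) Ez.
Qed.

End SmoothCalculus.

Arguments smooth_on_ext {R V W D} f {g}.
Arguments smooth_on_linear {R V W D}.
Arguments smooth_on_comp {R V W}.
Arguments smooth_on_derive {R V W}.
Arguments smooth_on_is_derive {R V W} D {f}.

Section Plane.
Variable R : realType.
Implicit Types (D : set (R * R)) (f : R * R -> R).

Lemma findim_plane : findim ((R * R)%type : normedModType R).
Proof. by apply: findim_pair; exact: findim_R. Qed.

Lemma plane_decomp (v : R * R) : v = v.1 *: ((1, 0) : R * R) + v.2 *: ((0, 1) : R * R).
Proof.
case: v => a b; congr pair; rewrite /= scaler0 ?addr0 ?add0r;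
  exact: esym (mulr1 _).
Qed.

Lemma derive_plane D f z v : open D -> smooth_on D f -> D z ->
  'D_v f z = v.1 * 'D_((1, 0) : R * R) f z + v.2 * 'D_((0, 1) : R * R) f z.
Proof.
move=> oD Cf Dz; rewrite {1}(plane_decomp v).
by rewrite (smooth_on_deriveD _ _ D) // !(smooth_on_deriveZ _ _ D).
Qed.

End Plane.

(** * Closed forms on simply connected plane domains *)

Section ClosedForms.
Variables (R : realType) (D : set (R * R)) (a b : R * R -> R).
Hypotheses (openD : open D) (sa : smooth_on D a) (sb : smooth_on D b).
Hypothesis closed : forall z, D z ->
  'D_((1, 0) : R * R) a z + 'D_((0, 1) : R * R) b z = 0.

(** With points written [(T, X)], this is [dF = a dX - b dT], a form which is closed exactly when
    [a_T + b_X = 0]. *)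
Definition is_potential (B : set (R * R)) (F : R * R -> R) : Prop :=
  forall z v, B z -> is_derive z v F (v.2 * a z - v.1 * b z).

Lemma ball_segment (V : normedModType R) (c z z' : V) (r s : R) :
  ball c r z -> ball c r z' -> 0 <= s <= 1 -> ball c r (z + s *: (z' - z)).
Proof.
rewrite -ball_normE /ball_ /= => zr z'r /andP[s0 s1].
have -> : c - (z + s *: (z' - z)) = (1 - s) *: (c - z) + s *: (c - z').
  rewrite scalerBl scale1r opprD addrA -[RHS]addrA; congr (_ + _).
  by rewrite -!scalerN -scalerDr; congr (_ *: _); rewrite !opprB addrA subrK.
apply: le_lt_trans (ler_normD _ _) _.
rewrite !normrZ [`|s|]ger0_norm // [`|1 - s|]ger0_norm ?subr_ge0 //.
have [->|sn0] := eqVneq s 0; first by rewrite subr0 mul1r mul0r addr0.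
have {sn0}s0 : 0 < s by rewrite lt_neqAle eq_sym sn0.
have -> : r = (1 - s) * r + s * r by ring.
by apply: ler_ltD; [rewrite ler_wpM2l ?subr_ge0 // ltW|rewrite ltr_pM2l].
Qed.

(** Poincare lemma by the homotopy formula: the potential at [z] is the integral of the form along
    the segment from [c] to [z]. It is a mean with parameter [z], hence smooth. *)
Lemma local_potential c r : ball c r `<=` D ->
  exists2 F, smooth_on (ball c r) F & is_potential (ball c r) F.
Proof.
move=> cD; set B := ball c r; have oB : open B by exact: ball_open.
have cB (z : R * R) : B z -> B c.
  rewrite /B -ball_normE /ball_ /= subrr normr0; exact: le_lt_trans.
pose ga (x : (R * R) * R) : R * R :=
  (c.1 + x.2 * (x.1.1 - c.1), c.2 + x.2 * (x.1.2 - c.2)).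
pose T : set ((R * R) * R) := setT.
have oT : open T by exact: openT.
have l11 : continuous (fst \o fst : (R * R) * R -> R).
  by move=> x; apply: continuous_comp; exact: cvg_fst.
have l12 : continuous (snd \o fst : (R * R) * R -> R).
  by move=> x; apply: continuous_comp; [exact: cvg_fst|exact: cvg_snd].
have l2 : continuous (snd : (R * R) * R -> R) by move=> x; exact: cvg_snd.
have s11 : smooth_on T (fun x => x.1.1).
  exact: (smooth_on_linear (fst \o fst : {linear _ -> R})).
have s12 : smooth_on T (fun x => x.1.2).
  exact: (smooth_on_linear (snd \o fst : {linear _ -> R})).
have s2 : smooth_on T (fun x => x.2).
  exact: (smooth_on_linear (snd : {linear _ -> R})).
have sga : smooth_on T ga.
  apply: smooth_on_pair => //; apply: smooth_on_add => //;
    try exact: smooth_on_cst; apply: smooth_on_mul => //;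
    apply: smooth_on_add => //; exact: smooth_on_cst.
have cga : continuous ga by move=> x; exact: smooth_on_continuous sga _.
pose E := ga @^-1` D.
have oE : open E by apply: open_comp => // x _; exact: cga.
have gaE z (s : R) : ga (z, s) = c + s *: (z - c).
  by rewrite /ga; congr pair.
have BE z (s : R) : B z -> 0 <= s <= 1 -> E (z, s).
  by move=> Bz s01; apply: cD; rewrite gaE; apply: ball_segment (cB _ Bz) Bz s01.
pose g (x : (R * R) * R) :=
  (x.1.2 - c.2) * a (ga x) - (x.1.1 - c.1) * b (ga x).
have sE (W : normedModType R) (f : _ -> W) : smooth_on T f -> smooth_on E f.
  exact: smooth_on_sub.
have scomp (f : R * R -> R) : smooth_on D f -> smooth_on E (fun x => f (ga x)).
  by move=> sf; apply: (smooth_on_comp E D ga f) => //;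
    [exact: findim_plane|exact: sE].
have sg : smooth_on E g.
  apply: smooth_on_add => //; last apply: smooth_on_opp => //;
    apply: smooth_on_mul => //; try exact: scomp;
    apply: smooth_on_add => //; try exact: smooth_on_cst; exact: sE.
exists (fun z => mean (fun s => g (z, s))).
  exact: (smooth_on_mean _ _ B E).
move=> z v Bz.
have [dF eF] := smooth_on_is_derive_mean _ _ B E g z v oB oE BE sg Bz.
split => //; rewrite eF; set w := z - c.
(* By closedness the integrand differentiated along [v] is the derivative of [G] in [s], so its mean
   is [G 1 - G 0]. *)
pose G (s : R) := s * (v.2 * a (c + s *: w) - v.1 * b (c + s *: w)).
have -> : v.2 * a z - v.1 * b z = G 1 - G 0.
  have cw : c + (1 : R) *: w = z by rewrite scale1r /w addrC subrK.
  by rewrite /G mul0r subr0 mul1r cw.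
apply: mean_FTC.
  move=> s s01; apply: (@continuous_slice R _ _ (fun x => 'D_(v, 0) g x)).
  exact: (smooth_on_continuous _ _ _ E (fun x => 'D_(v, 0) g x) (z, s)
    (smooth_on_derive E g (v, 0) sg) (BE _ _ Bz s01)).
move=> s s01; have Es := BE _ _ Bz s01.
have Ds : D (c + s *: w) by rewrite -gaE.
have line (f : R * R -> R) : smooth_on D f ->
    is_derive s (1 : R) (fun s => f (c + s *: w)) ('D_w f (c + s *: w)).
  by move=> sf; apply: is_derive_line; exact: Ck_on_derivable (sf 1) Ds.
have dga (f : R * R -> R) : smooth_on D f ->
    is_derive ((z, s) : (R * R) * R) (v, 0) (fun x => f (ga x))
      (s * 'D_v f (c + s *: w)).
  move=> sf; have dE : is_derive ((z, s) : (R * R) * R) (v, 0) ga (s *: v).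
    have d11 := is_der_linear (fst \o fst : {linear _ -> R})
      ((z, s) : (R * R) * R) (v, 0) l11.
    have d12 := is_der_linear (snd \o fst : {linear _ -> R})
      ((z, s) : (R * R) * R) (v, 0) l12.
    have d2 := is_der_linear (snd : {linear _ -> R})
      ((z, s) : (R * R) * R) (v, 0) l2.
    have comp (f0 : (R * R) * R -> R) (k f0' : R) :
        is_derive ((z, s) : (R * R) * R) (v, 0) f0 f0' ->
        is_derive ((z, s) : (R * R) * R) (v, 0) (fun x => k + x.2 * (f0 x - k))
          (s * f0').
      move=> d0; have := is_der_add (is_der_cst _ _ k)
        (is_der_mul d2 (is_der_add d0
          (is_der_cst _ _ (- k)))).
      by move=> H; apply: (is_derive_eq H); rewrite /= mulr0 !addr0 add0r.
    exact: is_der_pair (comp _ _ _ d11) (comp _ _ _ d12).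
  rewrite -(smooth_on_deriveZ _ _ D f _ v s sf Ds).
  have df := smooth_on_differentiable _ _ D f _ (findim_plane R) openD sf Ds.
  by rewrite -gaE in df *; exact: is_der_comp.
have -> : 'D_(v, 0) g (z, s) =
    v.2 * a (c + s *: w) - v.1 * b (c + s *: w) +
    s * (v.2 * 'D_w a (c + s *: w) - v.1 * 'D_w b (c + s *: w)).
  have d11 := is_der_linear (fst \o fst : {linear _ -> R})
    ((z, s) : (R * R) * R) (v, 0) l11.
  have d12 := is_der_linear (snd \o fst : {linear _ -> R})
    ((z, s) : (R * R) * R) (v, 0) l12.
  have sub (f0 : (R * R) * R -> R) (k f0' : R) :
      is_derive ((z, s) : (R * R) * R) (v, 0) f0 f0' ->
      is_derive ((z, s) : (R * R) * R) (v, 0) (fun x => f0 x - k) f0'.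
    move=> d0; have := is_der_add d0 (is_der_cst _ _ (- k)).
    by rewrite addr0.
  have [_ ->] := is_der_add
    (is_der_mul (sub _ c.2 _ d12) (dga _ sa))
    (is_der_opp
      (is_der_mul (sub _ c.1 _ d11) (dga _ sb))).
  cbv beta; rewrite !gaE /= !(derive_plane _ D _ _ v) // !(derive_plane _ D _ _ w) //.
  have := closed _ Ds; rewrite -/w.
  set aT := 'D_(1, 0) a _; set bX := 'D_(0, 1) b _ => /eqP.
  rewrite addr_eq0 => /eqP ->; rewrite /w /=; ring.
have dG := is_der_mul (is_derive_id s (1 : R)) (is_der_add
  (is_der_mul (is_der_cst _ _ v.2) (line _ sa))
  (is_der_opp (is_der_mul (is_der_cst _ _ v.1) (line _ sb)))).
by apply: (is_derive_eq dG); rewrite /= mulr1; ring.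
Qed.

(** Balls are convex, so the segment from [z] to [z'] lies in both, and [F1 - F2] has zero
    derivative along it. *)
Lemma potential_unique c1 r1 F1 c2 r2 F2 z z' :
  is_potential (ball c1 r1) F1 -> is_potential (ball c2 r2) F2 ->
  ball c1 r1 z -> ball c1 r1 z' -> ball c2 r2 z -> ball c2 r2 z' ->
  F1 z' - F1 z = F2 z' - F2 z.
Proof.
move=> P1 P2 z1 z1' z2 z2'.
have dF (s : R) : 0 <= s <= 1 -> is_derive (z + s *: (z' - z)) (z' - z)
    (fun y => F1 y - F2 y) 0.
  move=> s01.
  have d1 := P1 _ (z' - z) (ball_segment _ _ _ _ _ _ z1 z1' s01).
  have d2 := P2 _ (z' - z) (ball_segment _ _ _ _ _ _ z2 z2' s01).
  have := is_der_add d1 (is_der_opp d2).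
  by rewrite subrr.
have [s s01] := derivable_line_mvt _ _ (fun y => F1 y - F2 y) z (z' - z)
  (fun s s01 => @ex_derive _ _ _ _ _ _ _ (dF s s01)).
have [_ ->] := dF s s01.
rewrite [z + (z' - z)]addrC subrK => /eqP; rewrite subr_eq0 => /eqP E.
by rewrite -[F1 z'](subrK (F2 z')) E; ring.
Qed.

(* The increment between z and z' of any potential on a ball containing both;
   arbitrary if there is no such ball. *)
Definition pot_diff (z z' : R * R) : R := get [set d | exists c r F,
  [/\ is_potential (ball c r) F, ball c r z, ball c r z' & d = F z' - F z]].

Lemma pot_diffE c r F z z' : is_potential (ball c r) F ->
  ball c r z -> ball c r z' -> pot_diff z z' = F z' - F z.
Proof.
move=> PF zr zr'; have := @getPex R [set d | exists c r F,
  [/\ is_potential (ball c r) F, ball c r z, ball c r z' & d = F z' - F z]].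
rewrite -/(pot_diff z z') => -[|c0 [r0 [F0 [PF0 z0 z0' ->]]]].
  by exists (F z' - F z), c, r, F.
exact: (potential_unique c0 r0 F0 c r F).
Qed.

(** [N^-1] is a Lebesgue number for the cover of [K] by the preimages of balls carrying a potential.
    The inequality is not strict because consecutive mesh points are exactly [N^-1] apart. *)
Definition fine_mesh (X : normedModType R) (K : set X) (H : X -> R * R)
    (N : nat) : Prop :=
  (0 < N)%N /\ forall x, K x -> exists c r F, is_potential (ball c r) F /\
    forall y, K y -> `|x - y| <= N%:R^-1 -> ball c r (H y).

Lemma fine_mesh_ex (X : normedModType R) (K : set X) (H : X -> R * R) :
  compact K -> {within K, continuous H} -> H @` K `<=` D ->
  exists N, fine_mesh X K H N.
Proof.
move=> /compact_near_coveringP cov cH HD.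
pose P N x := K x -> exists c r F, is_potential (ball c r) F /\
  forall y, K y -> `|x - y| <= N.+1%:R^-1 -> ball c r (H y).
suff : \forall N \near \oo, K `<=` P N.
  by move=> [N _ /(_ N (leqnn N)) HN]; exists N.+1; split => // x Kx; exact: HN.
apply: cov => x Kx.
have Dx : D (H x) by apply: HD; exists x.
have [r r0 rD] : exists2 r : R, 0 < r & ball (H x) r `<=` D.
  have /nbhs_ballP[r /= r0 rD] : nbhs (H x) D by exact: open_nbhs_nbhs.
  by exists r.
have [F _ PF] := local_potential _ _ rD.
have : \forall y \near within K (nbhs x), ball (H x) r (H y).
  have := cH x; rewrite /continuous_at /= nbhs_subspace_in // => cHx.
  by apply: cHx; exact: nbhsx_ballx.
move=> /nbhs_ballP[d /= d0 dK].
(* Half the radius is spent between [x] and [x'], half between [x'] and [y]. *)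
have d20 : 0 < d / 2 by rewrite divr_gt0.
exists (ball x (d / 2), [set N | N.+1%:R^-1 < d / 2]).
  split; first exact: nbhsx_ballx.
  by exact: near_infty_natSinv_lt (PosNum d20).
move=> [x' N] /= [xx' Nd] Kx'; exists (H x), r, F; split => // y Ky x'y.
apply: dK => //; rewrite -ball_normE /ball_ /= in xx' *.
apply: le_lt_trans (ler_distD x' _ _) _; rewrite (splitr d).
by apply: ltrD => //; exact: le_lt_trans Nd.
Qed.

Lemma telescope_pot_diff c r F (p : nat -> R * R) M :
  is_potential (ball c r) F -> (forall i, (i <= M)%N -> ball c r (p i)) ->
  \sum_(i < M) pot_diff (p i) (p i.+1) = F (p M) - F (p 0%N).
Proof.
move=> PF pB; rewrite -(big_mkord xpredT (fun i => pot_diff (p i) (p i.+1))).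
rewrite -(telescope_sumr (fun i => F (p i)) (leq0n M)).
rewrite [LHS]big_nat [RHS]big_nat; apply: eq_bigr => i /andP[_ iM].
by rewrite (pot_diffE c r F) //; apply: pB => //; exact: ltnW.
Qed.

Lemma pot_diffC c r F z z' : is_potential (ball c r) F ->
  ball c r z -> ball c r z' -> pot_diff z z' = - pot_diff z' z.
Proof. by move=> PF zr zr'; rewrite !(pot_diffE c r F) // opprB. Qed.

(* For a fine mesh this is the integral of the closed form along g. *)
Definition path_sum (g : R -> R * R) (N : nat) : R :=
  \sum_(j < N) pot_diff (g (j%:R / N%:R)) (g (j.+1%:R / N%:R)).

Lemma sum_block (f : nat -> R) N M :
  \sum_(k < N * M) f k = \sum_(j < N) \sum_(i < M) f (j * M + i)%N.
Proof.
elim: N => [|N IH]; first by rewrite mul0n !big_ord0.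
rewrite big_ord_recr /= -IH mulSn addnC.
rewrite -(big_mkord xpredT f) (@big_cat_nat _ _ _ (N * M)) //= ?leq_addr //.
rewrite big_mkord; congr (_ + _).
have := big_addn 0 (N * M + M) (N * M) xpredT f; rewrite add0n => ->.
by rewrite addKn big_mkord; apply: eq_bigr => i _; rewrite addnC.
Qed.

Lemma fine_meshM (X : normedModType R) (K : set X) (H : X -> R * R) N M :
  (0 < M)%N -> fine_mesh X K H N -> fine_mesh X K H (N * M).
Proof.
move=> M0 [N0 HN]; split; first by rewrite muln_gt0 N0.
move=> x /HN[c [r [F [PF HF]]]]; exists c, r, F; split => // y Ky xy.
apply: HF => //; apply: le_trans xy _.
by rewrite lef_pV2 ?posrE ?ltr0n ?muln_gt0 ?N0 // ler_nat leq_pmulr.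
Qed.

Let I01 : set R := `[0, 1]%classic.

Lemma mesh01 i N : (0 < N)%N -> (i <= N)%N -> I01 (i%:R / N%:R).
Proof.
move=> N0 iN; rewrite /I01 /= in_itv /= divr_ge0 //=.
by rewrite ler_pdivrMr ?ltr0n // mul1r ler_nat.
Qed.

(** The [M] steps refining one step of the coarse mesh stay in the ball attached to that step, where
    the potential differences telescope. *)
Lemma path_sum_refine g N M : (0 < M)%N -> fine_mesh _ I01 g N ->
  path_sum g (N * M) = path_sum g N.
Proof.
move=> M0 [N0 HN]; rewrite /path_sum.
rewrite (sum_block (fun k => pot_diff (g (k%:R / (N * M)%:R))
  (g (k.+1%:R / (N * M)%:R)))).
have Nn0 : N%:R != 0 :> R by rewrite pnatr_eq0 -lt0n.
have Mn0 : M%:R != 0 :> R by rewrite pnatr_eq0 -lt0n.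
apply: eq_bigr => -[j jN] _ /=.
have [c [r [F [PF HF]]]] := HN _ (mesh01 j N N0 (ltnW jN)).
pose p i := g ((j * M + i)%:R / (N * M)%:R).
have pB i : (i <= M)%N -> ball c r (p i).
  move=> iM; apply: HF.
    apply: mesh01; first by rewrite muln_gt0 N0.
    by rewrite (leq_trans (_ : _ <= j * M + M)%N) ?leq_add2l // addnC -mulSn leq_mul2r jN orbT.
  have -> : j%:R / N%:R - (j * M + i)%:R / (N * M)%:R = - (i%:R / M%:R / N%:R) :> R.
    by rewrite natrD !natrM; field; rewrite Nn0.
  rewrite normrN ger0_norm ?divr_ge0 // ler_piMl ?invr_ge0 //.
  by rewrite ler_pdivrMr ?ltr0n // mul1r ler_nat.
have p0 : p 0%N = g (j%:R / N%:R).
  by rewrite /p addn0 !natrM -mulf_div divff // mulr1.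
have pM : p M = g (j.+1%:R / N%:R).
  by rewrite /p addnC -mulSn !natrM -mulf_div divff // mulr1.
under eq_bigr => i _ do rewrite -addnS -/(p i) -/(p i.+1).
rewrite (telescope_pot_diff c r F p M PF pB) -p0 -pM.
by rewrite (pot_diffE c r F) //; apply: pB.
Qed.

(** On each cell of the [N] by [N] grid a single potential is available, so consecutive rows differ
    by a telescoping sum over the vertical sides; it vanishes because every row is a closed loop.
    The last row is a constant path. *)
Lemma path_sum_null_homotopic (g : R -> R * R) (H : R * R -> R * R) c N :
  (forall s, I01 s -> H (s, 0) = H (s, 1)) ->
  (forall t, I01 t -> H (0, t) = g t) -> (forall t, I01 t -> H (1, t) = c) ->
  fine_mesh _ (I01 `*` I01) H N -> path_sum g N = 0.
Proof.
move=> Hloop H0 H1 [N0 HN].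
have i01 i : (i <= N)%N -> I01 (i%:R / N%:R) by exact: mesh01.
pose p i j := H (i%:R / N%:R, j%:R / N%:R).
pose row i := \sum_(j < N) pot_diff (p i j) (p i j.+1).
have N1 : (N%:R / N%:R = 1 :> R) by rewrite divff // pnatr_eq0 -lt0n.
have step i : (i < N)%N -> row i.+1 = row i.
  move=> iN; apply/eqP; rewrite -subr_eq0 /row -sumrB; apply/eqP.
  rewrite (eq_bigr (fun j : 'I_N => pot_diff (p i j.+1) (p i.+1 j.+1) -
      pot_diff (p i j) (p i.+1 j))); last first.
    move=> [j jN] _ /=.
    have [c0 [r [F [PF HF]]]] := HN (i%:R / N%:R, j%:R / N%:R)
      (conj (i01 i (ltnW iN)) (i01 j (ltnW jN))).
    have pB i' j' : (i <= i' <= i.+1)%N -> (j <= j' <= j.+1)%N -> ball c0 r (p i' j').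
      move=> /andP[i1 i2] /andP[j1 j2]; apply: HF.
        by split; apply: i01; [exact: leq_trans iN|exact: leq_trans jN].
      have near1 m m' : (m <= m' <= m.+1)%N ->
          `|m%:R / N%:R - m'%:R / N%:R| <= N%:R^-1 :> R.
        move=> /andP[m1 m2]; rewrite -mulrBl -normrN -mulNr opprB -natrB //.
        rewrite ger0_norm ?divr_ge0 // ler_piMl ?invr_ge0 //.
        by rewrite -[1]/(1%:R) ler_nat leq_subLR addn1.
      by rewrite prod_normE /= ge_max !near1 // ?i1 ?j1.
    rewrite !(pot_diffE c0 r F) //; try (by apply: pB; rewrite !leqnn ?leqnSn);
    by ring.
  rewrite -(big_mkord xpredT (fun j => pot_diff (p i j.+1) (p i.+1 j.+1) -
    pot_diff (p i j) (p i.+1 j))) telescope_sumr //.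
  rewrite /p N1 mul0r !Hloop ?subrr //; apply: i01 => //; exact: ltnW.
have rowE i : (i <= N)%N -> row i = row 0%N.
  by elim: i => // i IH iN; rewrite step // IH // ltnW.
have -> : path_sum g N = row 0%N.
  apply: eq_bigr => -[j jN] _ /=; rewrite /p mul0r !H0 //; apply: i01 => //.
  exact: ltnW.
rewrite -(rowE N) // /row /p N1 big1 // => -[j jN] _ /=.
rewrite !H1; [|exact: i01|apply: i01; exact: ltnW].
have J0 : I01 0 by rewrite /I01 /= in_itv /= lexx ler01.
have J1 : I01 1 by rewrite /I01 /= in_itv /= lexx ler01.
have [c0 [r [F [PF HF]]]] := HN (1, 0) (conj J1 J0).
have cB : ball c0 r c.
  by rewrite -(H1 0) //; apply: HF; rewrite // subrr normr0 invr_ge0.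
by rewrite (pot_diffE c0 r F) // subrr.
Qed.

(** Composition with it extends a path from the unit interval to the whole line, so that paths
    become continuous everywhere. *)
Definition clamp (t : R) : R := Num.max 0 (Num.min 1 t).

Lemma clamp_continuous : continuous clamp.
Proof.
move=> t; apply: (@continuous_max R R (fun=> 0) (fun t => Num.min 1 t)).
  exact: cvg_cst.
by apply: (@continuous_min R R (fun=> 1) id); [exact: cvg_cst|exact: cvg_id].
Qed.

Lemma clamp01 t : I01 (clamp t).
Proof.
by rewrite /I01 /clamp /= in_itv /= le_max lexx /= ge_max ler01 ge_min lexx.
Qed.

Lemma clamp_id t : I01 t -> clamp t = t.
Proof.
rewrite /I01 /clamp /= in_itv /= => /andP[t0 t1].
by rewrite (min_idPr t1) (max_idPr t0).
Qed.

Lemma clamp_le0 t : t <= 0 -> clamp t = 0.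
Proof.
move=> t0; apply/max_idPl; rewrite ge_min t0 orbT //.
Qed.

Lemma clamp_ge1 t : 1 <= t -> clamp t = 1.
Proof. by move=> t1; rewrite /clamp (min_idPl t1); apply/max_idPr. Qed.

Hypothesis scD : simply_connected D.

Lemma path_ex z z' : D z -> D z' -> exists g : R -> R * R,
  [/\ continuous g, forall t, D (g t), g 0 = z & g 1 = z'].
Proof.
move=> Dz Dz'; have [g [cg gD g0 g1]] := scD.1 _ _ Dz Dz'.
exists (g \o clamp); split.
- move=> t U nU.
  have cgt : \forall y \near within I01 (nbhs (clamp t)), U (g y).
    by rewrite nbhs_subspace_in; [exact: (cg (clamp t) U nU)|exact: clamp01].
  suff : nbhs t [set u | U (g (clamp u))] by [].
  have H : nbhs t [set u | I01 (clamp u) -> U (g (clamp u))] :=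
    clamp_continuous t _ cgt.
  by apply: filterS H => u; apply; exact: clamp01.
- by move=> t; apply: gD; exists (clamp t) => //; exact: clamp01.
- by rewrite /= clamp_le0.
- by rewrite /= clamp_ge1.
Qed.

(** The loop made of [g], the segment from [z] to [z'] and [g'] reversed is null homotopic, so its
    path sum is zero; the segment stays in one ball and contributes [F z' - F z]. *)
Lemma path_sum_close (z0 z z' : R * R) (g g' : R -> R * R) c r F N N' :
  is_potential (ball c r) F -> ball c r `<=` D -> ball c r z -> ball c r z' ->
  continuous g -> (forall t, D (g t)) -> g 0 = z0 -> g 1 = z ->
  continuous g' -> (forall t, D (g' t)) -> g' 0 = z0 -> g' 1 = z' ->
  fine_mesh _ I01 g N -> fine_mesh _ I01 g' N' ->
  path_sum g' N' - path_sum g N = F z' - F z.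
Proof.
move=> PF BD Bz Bz' cg gD g0 g1 cg' gD' g0' g1' fg fg'.
pose seg (t : R) := z + t *: (z' - z).
have segB t : I01 t -> ball c r (seg t).
  by rewrite /I01 /= in_itv /=; exact: ball_segment.
(* Each clamp is frozen outside its own third of the unit interval: the three arcs are concatenated
   by adding displacements, and continuity requires no gluing. *)
pose loop (t : R) := g (clamp (3 * t)) + (seg (clamp (3 * t - 1)) - z) +
  (g' (clamp (3 - 3 * t)) - z').
have seg1 : seg 1 = z' by rewrite /seg scale1r addrC subrK.
have c0 : clamp 0 = 0 by rewrite clamp_le0.
have c1 : clamp 1 = 1 by rewrite clamp_ge1.
have loopA t : 0 <= t -> t <= 1 -> loop (t / 3) = g t.
  move=> t0 t1; rewrite /loop; have -> : 3 * (t / 3) = t by field.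
  rewrite [clamp (t - 1)]clamp_le0 ?subr_le0 // [clamp (3 - t)]clamp_ge1; last by lra.
  rewrite clamp_id; last by rewrite /I01 /= in_itv /= t0.
  by rewrite /seg scale0r addr0 subrr addr0 g1' subrr addr0.
have loopB t : 0 <= t -> t <= 1 -> loop ((1 + t) / 3) = seg t.
  move=> t0 t1; rewrite /loop.
  have -> : 3 * ((1 + t) / 3) = 1 + t by field.
  rewrite [clamp (1 + t)]clamp_ge1 ?lerDl //.
  rewrite [clamp (3 - _)]clamp_ge1; last by lra.
  rewrite g1 g1' subrr addr0 addrC subrK clamp_id; first by congr seg; ring.
  by rewrite /I01 /= in_itv /= [1 + t]addrC addrK t0.
have loopC t : 0 <= t -> t <= 1 -> loop ((2 + t) / 3) = g' (1 - t).
  move=> t0 t1; rewrite /loop.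
  have -> : 3 * ((2 + t) / 3) = 2 + t by field.
  rewrite clamp_ge1; last by lra.
  rewrite clamp_ge1; last by lra.
  rewrite g1 clamp_id; last by rewrite /I01 /= in_itv /=; lra.
  rewrite seg1 [z + (z' - z)]addrC subrK addrC subrK.
  by congr g'; ring.
have cloop : continuous loop.
  have cc (k l : R) : continuous (fun t => clamp (k * t + l)).
    move=> t; apply: (@continuous_comp _ _ _ (fun t => k * t + l) clamp).
      by apply: cvgD; [apply: cvgMr; exact: cvg_id|exact: cvg_cst].
    exact: clamp_continuous.
  have cseg : continuous seg.
    by move=> t; apply: cvgD; [exact: cvg_cst|apply: cvgZl; exact: cvg_id].
  have ccomp (h : R -> R * R) (k l : R) : continuous h ->
      continuous (fun t : R => h (clamp (k * t + l))).
    move=> ch t.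
    exact: (@continuous_comp _ _ _ (fun t : R => clamp (k * t + l)) h t (cc k l t) (ch _)).
  have E1 : (fun t : R => g (clamp (3 * t))) = (fun t : R => g (clamp (3 * t + 0))).
    by apply/funext => t; rewrite addr0.
  have E2 : (fun t : R => g' (clamp (3 - 3 * t))) =
      (fun t : R => g' (clamp (- 3 * t + 3))).
    by apply/funext => t; rewrite addrC mulNr.
  have C1 : continuous (fun t : R => g (clamp (3 * t))) by rewrite E1; exact: ccomp.
  have C2 : continuous (fun t : R => g' (clamp (3 - 3 * t))).
    by rewrite E2; exact: ccomp.
  have C3 : continuous (fun t : R => seg (clamp (3 * t - 1))) by exact: ccomp.
  move=> t; apply: cvgD; last by apply: cvgB; [exact: C2|exact: cvg_cst].
  by apply: cvgD; [exact: C1|apply: cvgB; [exact: C3|exact: cvg_cst]].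
have loopD : loop @` I01 `<=` D.
  move=> _ [t + <-]; rewrite /I01 /= in_itv /= => /andP[t0 t1].
  have [t3|t3] := leP (3 * t) 1.
    have -> : t = (3 * t) / 3 by field.
    by rewrite loopA // mulr_ge0.
  have [t3'|t3'] := leP (3 * t) 2.
    have -> : t = (1 + (3 * t - 1)) / 3 by field.
    rewrite loopB; [|lra..]; apply: BD; apply: segB.
    by rewrite /I01 /= in_itv /=; lra.
  have -> : t = (2 + (3 * t - 2)) / 3 by field.
  by rewrite loopC; [exact: gD'|lra..].
have loop01 : loop 0 = loop 1.
  have E0 : loop 0 = g 0 by rewrite -(loopA 0) // mul0r.
  have E1 : loop 1 = g' 0.
    by rewrite -(subrr 1) -(loopC 1) //; congr loop; field.
  by rewrite E0 E1 g0 g0'.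
have [H [k [cH HD Hloop H0 H1]]] :=
  scD.2 loop (continuous_subspaceT cloop) loopD loop01.
have [NH fH] : exists N, fine_mesh _ (I01 `*` I01) H N.
  apply: fine_mesh_ex => //; apply: compact_setX; exact: segment_compact.
have [[N0 _] [N0' _] [NH0 _]] := And3 fg fg' fH.
(* A common multiple of the three mesh sizes: the mesh [3 * M] is fine for the homotopy, has nodes
   at 1/3 and 2/3, and induces the mesh [M] on each of the three arcs. *)
pose M := (N * N' * NH)%N.
have M0 : (0 < M)%N by rewrite !muln_gt0 N0 N0' NH0.
have fM : fine_mesh _ I01 g M.
  by rewrite /M -mulnA; apply: fine_meshM => //; rewrite muln_gt0 N0'.
have fM' : fine_mesh _ I01 g' M.
  rewrite /M mulnAC mulnC; apply: fine_meshM => //; by rewrite muln_gt0 N0.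
have fH3 : fine_mesh _ (I01 `*` I01) H (3 * M).
  rewrite /M mulnA mulnC; apply: fine_meshM => //.
  by rewrite !muln_gt0 N0 N0'.
have SM : path_sum g M = path_sum g N.
  by rewrite /M -mulnA path_sum_refine // muln_gt0 N0'.
have SM' : path_sum g' M = path_sum g' N'.
  by rewrite /M mulnAC mulnC path_sum_refine // muln_gt0 N0.
clearbody M.
have := path_sum_null_homotopic _ _ _ _ Hloop H0 H1 fH3; rewrite /path_sum.
rewrite (sum_block (fun k => pot_diff (loop (k%:R / (3 * M)%:R))
  (loop (k.+1%:R / (3 * M)%:R)))).
have Mn0 : M%:R != 0 :> R by rewrite pnatr_eq0 -lt0n.
have idx j i : (j * M + i)%:R / (3 * M)%:R = (j%:R + i%:R / M%:R) / 3 :> R.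
  by rewrite natrD !natrM; field; rewrite Mn0.
under eq_bigr => j _ do under eq_bigr => i _ do rewrite -addnS !idx.
have m01 i : (i <= M)%N -> 0 <= (i%:R / M%:R : R) <= 1.
  by move=> iM; have := mesh01 i M M0 iM; rewrite /I01 /= in_itv.
rewrite 3!big_ord_recl big_ord0 addr0 /=.
rewrite [X in X + _](_ : _ = path_sum g M); last first.
  apply: eq_bigr => -[i iM] _ /=; rewrite !add0r.
  by have /andP[? ?] := m01 i (ltnW iM); have /andP[? ?] := m01 _ iM; rewrite !loopA.
rewrite [X in _ + (X + _)](_ : _ = F z' - F z); last first.
  pose p i := seg (i%:R / M%:R).
  have pB i : (i <= M)%N -> ball c r (p i) by move=> iM; apply: segB; exact: mesh01.
  have -> : F z' - F z = F (p M) - F (p 0%N).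
    by rewrite /p divff // mul0r seg1 /seg scale0r addr0.
  rewrite -(telescope_pot_diff c r F p M) //.
  apply: eq_bigr => -[i iM] _ /=; rewrite /bump /= addn0.
  by have /andP[? ?] := m01 i (ltnW iM); have /andP[? ?] := m01 _ iM; rewrite !loopB.
(* The last third runs [g'] backwards, whence the reversal of the indices and the antisymmetry of
   [pot_diff]. *)
rewrite [X in _ + (_ + X)](_ : _ = - path_sum g' M); last first.
  rewrite /path_sum [in RHS](reindex_inj rev_ord_inj) /= -sumrN.
  apply: eq_bigr => -[i iM] _ /=; rewrite /bump /= addn0.
  have /andP[? ?] := m01 i (ltnW iM); have /andP[? ?] := m01 _ iM.
  rewrite -[in 2%:R + _]/(2 : R) !loopC // subnSK //.
  have [c2 [r2 [F2 [PF2 HF2]]]] := fM'.2 _ (mesh01 (M - i) M M0 (leq_subr _ _)).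
  have -> : 1 - i%:R / M%:R = (M - i)%:R / M%:R :> R.
    by rewrite natrB ?(ltnW iM) // mulrBl divff.
  have -> : 1 - i.+1%:R / M%:R = (M - i.+1)%:R / M%:R :> R.
    by rewrite natrB // mulrBl divff.
  apply: (pot_diffC c2 r2 F2) => //; apply: HF2.
  - exact: mesh01 M0 (leq_subr _ _).
  - by rewrite subrr normr0 invr_ge0.
  - exact: mesh01 M0 (leq_subr _ _).
  - rewrite -(subnSK iM) -mulrBl -natr1 addrAC subrr add0r mul1r.
    by rewrite ger0_norm.
rewrite SM SM'.
rewrite -/(path_sum g' N') -/(path_sum g N).
by rewrite addrA => /eqP; rewrite subr_eq0 => /eqP <-; ring.
Qed.

(** The potential is the path sum along a chosen path from a base point. Near every point it differs
    from a local potential by a constant, by [path_sum_close], although the paths are chosen without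
    any regularity in [z]. *)
Theorem potential_ex : exists2 Y, smooth_on D Y & is_potential D Y.
Proof.
have [[z0 Dz0]|D0] := pselect (exists z0, D z0); last first.
  exists (fun=> 0) => [k|z v Dz]; last by exfalso; apply: D0; exists z.
  by apply: Ck_on_local => z Dz; exfalso; apply: D0; exists z.
have pathP z : exists g : R -> R * R, exists N, D z ->
    [/\ continuous g, forall t, D (g t), g 0 = z0, g 1 = z & fine_mesh _ I01 g N].
  have [Dz|nD] := pselect (D z); last by exists (fun=> z), 0%N.
  have [g [cg gD g0 g1]] := path_ex z0 z Dz0 Dz.
  have [N fN] : exists N, fine_mesh _ I01 g N.
    apply: fine_mesh_ex; [exact: segment_compact|exact: continuous_subspaceT|].
    by move=> _ [t _ <-].
  by exists g, N.
have [G GP] := choice pathP; have {GP}[N NP] := choice GP.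
pose Y z := path_sum (G z) (N z).
have YF z : D z -> exists r F, [/\ 0 < r, ball z r `<=` D, smooth_on (ball z r) F,
    is_potential (ball z r) F & forall y, ball z r y -> Y y = F y + (Y z - F z)].
  move=> Dz; have /nbhs_ballP[r /= r0 rD] : nbhs z D by exact: open_nbhs_nbhs.
  have [F sF PF] := local_potential z r rD; exists r, F; split => // y zy.
  have [cg gD g0 g1 fg] := NP z Dz; have [cg' gD' g0' g1' fg'] := NP y (rD _ zy).
  have E := path_sum_close z0 z y (G z) (G y) z r F (N z) (N y) PF rD
    (ballxx z r0) zy cg gD g0 g1 cg' gD' g0' g1' fg fg'.
  by rewrite /Y -[path_sum (G y) (N y)](subrK (path_sum (G z) (N z))) E; ring.
exists Y => [k|z v Dz].
  apply: Ck_on_local => z /YF[r [F [r0 rD sF PF YE]]].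
  exists (ball z r); first exact: ballxx.
  apply: (Ck_on_ext _ _ _ _ _ (fun y => F y + (Y z - F z))).
  - exact: ball_open.
  - by move=> y /YE.
  - apply: Ck_on_add; [exact: ball_open|exact: sF|].
    apply: Ck_on_cst; exact: ball_open.
have [r [F [r0 rD sF PF YE]]] := YF z Dz.
apply: (@near_eq_is_derive _ _ _ (fun y => F y + (Y z - F z))).
  by apply: filterS (nbhsx_ballx z r r0) => y /YE ->.
have := is_der_add (PF z v (ballxx z r0)) (is_der_cst _ _ (Y z - F z)).
by rewrite addr0.
Qed.

End ClosedForms.

(** * Changes of coordinates (T, Y) *)

Section ChangeOfCoordinates.
Variables (R : realType) (D : set (R * R)) (Y : R * R -> R).
Hypotheses (openD : open D) (sY : smooth_on D Y).
Hypothesis YX_gt0 : forall z, D z -> 0 < 'D_((0, 1) : R * R) Y z.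

Let Phi (z : R * R) : R * R := (z.1, Y z).
Let YT z := 'D_((1, 0) : R * R) Y z.
Let YX z := 'D_((0, 1) : R * R) Y z.

Let mvtY (z z' : R * R) :
  (forall s : R, 0 <= s <= 1 -> D (z + s *: (z' - z))) ->
  exists2 s : R, 0 <= s <= 1 &
    Y z' - Y z = (z'.1 - z.1) * YT (z + s *: (z' - z)) +
                 (z'.2 - z.2) * YX (z + s *: (z' - z)).
Proof.
move=> zz'; have [s s01] := derivable_line_mvt _ _ Y z (z' - z)
  (fun s s01 => Ck_on_derivable _ _ _ _ _ _ _ _ (sY 1) (zz' s s01)).
rewrite [z + (z' - z)]addrC subrK (derive_plane _ D) //; last exact: zz'.
by exists s.
Qed.

(** At fixed [T] the segment between two points stays in the slice, and [Y] is strictly increasing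
    along it. *)
Lemma interval_slices_injective :
  (forall T : R, is_interval [set X | D (T, X)]) -> {in D &, injective Phi}.
Proof.
move=> itv [T X] [T' X']; rewrite !inE => Dz Dz' [TT YY]; subst T'.
have seg s : 0 <= s <= 1 -> D ((T, X) + s *: ((T, X') - (T, X))).
  move=> /andP[s0 s1].
  have -> : (T, X) + s *: ((T, X') - (T, X)) = (T, X + s * (X' - X)).
    by congr pair; rewrite /= subrr scaler0 addr0.
  have [XX|/ltW XX] := leP X X'.
    apply: (itv T X X') => //; rewrite lerDl mulr_ge0 ?subr_ge0 //=.
    by rewrite -lerBrDl ler_piMl ?subr_ge0.
  apply: (itv T X' X) => //; rewrite gerDl mulr_ge0_le0 ?subr_le0 // andbT.
  have : (1 - s) * (X' - X) <= 0 by rewrite mulr_ge0_le0 ?subr_ge0 ?subr_le0.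
  by rewrite mulrBl mul1r => ?; lra.
have [s s01] := mvtY _ _ seg.
rewrite YY /= !subrr mul0r add0r => /esym/eqP; rewrite mulf_eq0.
case/orP; first by rewrite subr_eq0 => /eqP ->.
by rewrite (gt_eqF (YX_gt0 _ (seg s s01))).
Qed.

(** Openness of [Phi] by monotonicity in one variable: at [T0] the function [Y] increases with [X];
    by continuity its values at [X0 - e] and [X0 + e] still bracket [y] when [(T, y)] is close to
    [Phi z], and the intermediate value theorem supplies a preimage. *)
Lemma Phi_nbhs (z : R * R) (U : set (R * R)) : D z -> nbhs z U ->
  nbhs (Phi z) (Phi @` (D `&` U)).
Proof.
move=> Dz nU.
have /nbhs_ballP[r /= r0 zr] : nbhs z (D `&` U).
  by apply: filterI => //; exact: open_nbhs_nbhs.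
case: z Dz nU zr => T0 X0 Dz nU zr; pose e := r / 2.
have e0 : 0 < e by rewrite divr_gt0.
have er : e < r by rewrite /e ltr_pdivrMr // ltr_pMr // ltr1n.
have inball T X : `|T - T0| < r -> `|X - X0| <= e -> D (T, X) /\ U (T, X).
  move=> TT XX; apply: zr; split; rewrite -ball_normE /ball_ /= distrC //.
  exact: le_lt_trans er.
have I1 : 0 <= (1 : R) <= 1 by rewrite ler01 lexx.
have incr (X X' : R) : X < X' -> `|X - X0| <= e -> `|X' - X0| <= e ->
    Y (T0, X) < Y (T0, X').
  move=> XX B B'; have zz (s : R) : 0 <= s <= 1 ->
      D ((T0, X) + s *: ((T0, X') - (T0, X))).
    move=> /andP[s0 s1].
    have -> : (T0, X) + s *: ((T0, X') - (T0, X)) = (T0, X + s * (X' - X)).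
      by congr pair; rewrite /= subrr scaler0 addr0.
    have [] // := inball T0 (X + s * (X' - X)); first by rewrite subrr normr0.
    move: B B'; rewrite !ler_norml => /andP[B1 B2] /andP[B3 B4]; apply/andP; split.
      apply: le_trans B1 _; rewrite lerD2r lerDl mulr_ge0 // subr_ge0 ltW //.
    apply: le_trans _ B4; rewrite lerD2r -lerBrDl ler_piMl // subr_ge0 ltW //.
  have [s s01 E] := mvtY _ _ zz.
  rewrite -subr_gt0 E /= subrr mul0r add0r mulr_gt0 ?subr_gt0 //.
  exact: YX_gt0 (zz s s01).
have n0 : `|X0 - X0| <= e by rewrite subrr normr0 ltW.
have nm : `|X0 - e - X0| <= e by rewrite addrAC subrr add0r normrN gtr0_norm.
have np : `|X0 + e - X0| <= e by rewrite addrAC subrr add0r gtr0_norm.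
have lo : Y (T0, X0 - e) < Y (T0, X0) by apply: incr => //; rewrite ltrBlDr ltrDl.
have hi : Y (T0, X0) < Y (T0, X0 + e) by apply: incr => //; rewrite ltrDl.
(* Half the smaller gap: changes of less than [k] in the end values of [Y] and in [y] cannot destroy
   the bracketing. *)
pose k := Num.min (Y (T0, X0) - Y (T0, X0 - e)) (Y (T0, X0 + e) - Y (T0, X0)) / 2.
have k0 : 0 < k by rewrite divr_gt0 // lt_min !subr_gt0 lo hi.
have klo : Y (T0, X0 - e) + k <= Y (T0, X0) - k.
  rewrite lerBrDr -addrA /k -splitr -lerBrDl; by rewrite ge_min lexx.
have khi : Y (T0, X0) + k <= Y (T0, X0 + e) - k.
  rewrite lerBrDr -addrA /k -splitr -lerBrDl; by rewrite ge_min lexx orbT.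
have cT X : D (T0, X) -> \forall T \near T0, `|Y (T0, X) - Y (T, X)| < k.
  move=> DX; have cY : {for T0, continuous (fun T => Y (T, X))}.
    apply: (@continuous_comp _ _ _ (fun T : R => (T, X)) Y).
      apply: (@cvg_pair _ _ _ _ (nbhs T0) (nbhs X)); [exact: cvg_id|exact: cvg_cst].
    exact: smooth_on_continuous sY DX.
  by have /cvgrPdist_lt /(_ _ k0) := cY.
have r00 : `|T0 - T0| < r by rewrite subrr normr0.
have n1 := cT _ (inball T0 _ r00 nm).1; have n2 := cT _ (inball T0 _ r00 np).1.
have nr : \forall T \near T0, `|T - T0| < r.
  by apply/nbhs_ballP; exists r => // T; rewrite -ball_normE /ball_ /= distrC.
have ny : \forall y \near Y (T0, X0), `|y - Y (T0, X0)| < k.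
  by apply/nbhs_ballP; exists k => // y; rewrite -ball_normE /ball_ /= distrC.
exists ([set T | [/\ `|Y (T0, X0 - e) - Y (T, X0 - e)| < k,
   `|Y (T0, X0 + e) - Y (T, X0 + e)| < k & `|T - T0| < r]],
   [set y | `|y - Y (T0, X0)| < k]).
  by split => //; near=> T; split; near: T.
move=> [T y] /= [[H1 H2 H3] H4].
have inb X : X \in `[X0 - e, X0 + e] -> `|X - X0| <= e.
  by rewrite in_itv /= ler_norml => /andP[? ?]; lra.
have cYT : {within `[X0 - e, X0 + e], continuous (fun X => Y (T, X))}.
  apply: continuous_in_subspaceT => X; rewrite inE /= => XI.
  apply: (@continuous_comp _ _ _ (fun X : R => (T, X)) Y).
    apply: (@cvg_pair _ _ _ _ (nbhs T) (nbhs X)); [exact: cvg_cst|exact: cvg_id].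
  by apply: smooth_on_continuous sY _; have [] := inball T X H3 (inb X XI).
have le_e : X0 - e <= X0 + e by lra.
have [|X XI XE] := IVT le_e cYT (v := y).
  rewrite ge_min le_max; apply/andP; split; apply/orP; [left|right].
    by move: H1 H4; rewrite !ltr_norml => /andP[? ?] /andP[? ?]; lra.
  by move: H2 H4; rewrite !ltr_norml => /andP[? ?] /andP[? ?]; lra.
by exists (T, X); [exact: inball H3 (inb X XI)|rewrite /Phi /= XE].
Unshelve. all: by end_near. Qed.

Hypothesis injPhi : {in D &, injective Phi}.

Lemma Phi_image_open : open (Phi @` D).
Proof.
rewrite openE => w [z Dz <-]; apply: filterS (Phi_nbhs _ setT Dz filterT).
by move=> y [x [Dx _] <-]; exists x.
Qed.

Lemma coordinate_inverse_ex : exists Psi : R * R -> R * R,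
  forall z, D z -> Psi (Phi z) = z.
Proof.
have H w : exists z, forall z', D z' -> Phi z' = w -> z = z'.
  have [[z [Dz zw]]|n] := pselect (exists z, D z /\ Phi z = w).
    by exists z => z' Dz' zw'; apply: injPhi; rewrite ?inE // zw zw'.
  by exists w => z' Dz' zw'; exfalso; apply: n; exists z'.
by have [Psi PsiP] := choice H; exists Psi => z Dz; exact: PsiP.
Qed.

Variable Psi : R * R -> R * R.
Hypothesis PhiK : forall z, D z -> Psi (Phi z) = z.

Lemma Psi_continuous w : (Phi @` D) w -> {for w, continuous Psi}.
Proof.
move=> [z Dz <-] U; rewrite PhiK // => nU.
by apply: filterS (Phi_nbhs _ _ Dz nU) => _ [y [Dy Uy] <-]; rewrite /= PhiK.
Qed.

(** From [dY = Y_T dT + Y_X dX]: the rate of change of [X] when [(T, Y)] moves with velocity [v]. *)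
Definition slope (v z : R * R) : R := (v.2 - v.1 * YT z) / YX z.

Lemma smooth_on_slope v : smooth_on D (slope v).
Proof.
apply: smooth_on_mul => //.
  apply: smooth_on_add => //; first exact: smooth_on_cst.
  apply: smooth_on_opp => //; apply: smooth_on_mul => //.
    exact: smooth_on_cst.
  exact: smooth_on_derive.
apply: smooth_on_inv => //; last exact: smooth_on_derive.
by move=> z /YX_gt0; rewrite lt0r => /andP[].
Qed.

(** The mean value theorem for [Y] between [z] and [Psi (h *: v + w)] shows that the difference
    quotient of the second component is exactly the slope at an intermediate point, which tends to
    [z] because [Phi] is open. *)
Lemma is_derive_Psi w v : (Phi @` D) w ->
  is_derive w v Psi (v.1, slope v (Psi w)).
Proof.
move=> Ew; have [z Dz zw] := Ew.
have Psiw : Psi w = z by rewrite -zw PhiK.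
have near_line (U : set (R * R)) : nbhs z U ->
    \forall h \near (0 : R), exists2 y, D y /\ U y & Phi y = h *: v + w.
  move=> nU; have nE := Phi_nbhs _ _ Dz nU; rewrite zw in nE.
  have cl : {for (0 : R), continuous (fun h : R => h *: v + w)}.
    by apply: cvgD; [apply: cvgZl; exact: cvg_id|exact: cvg_cst].
  rewrite -[w in nbhs w]add0r -[X in nbhs (X + w)](scale0r v) in nE.
  have H : nbhs (0 : R) [set h | (Phi @` (D `&` U)) (h *: v + w)] := cl _ nE.
  by apply: filterS H => h [y yU Ey]; exists y.
have Psi_line (U : set (R * R)) : nbhs z U ->
    \forall h \near (0 : R), U (Psi (h *: v + w)) /\
      Phi (Psi (h *: v + w)) = h *: v + w.
  move=> nU; apply: filterS (near_line _ nU) => h [y [Dy Uy] <-].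
  by rewrite PhiK.
have w1 : z.1 = w.1 by rewrite -zw.
have w2 : Y z = w.2 by rewrite -zw.
have D1 : is_derive w v (fun w => (Psi w).1) v.1.
  have E : \forall y \near w, y.1 = (Psi y).1.
    apply: filterS (open_nbhs_nbhs (conj Phi_image_open Ew)).
    by move=> _ [y Dy <-]; rewrite PhiK.
  apply: near_eq_is_derive E _.
  exact: (is_der_linear (fst : {linear (R * R)%type -> R})
    w v (fun z => cvg_fst)).
have D2 : is_derive w v (fun w => (Psi w).2) (slope v (Psi w)).
  rewrite Psiw; suff H : (fun h : R => h^-1 *: (((fun w => (Psi w).2) \o shift w)
      (h *: v) - (Psi w).2)) @ 0^' --> slope v z.
    by split; [apply/cvg_ex; exists (slope v z)|exact: cvg_lim H].
  apply/cvgrPdist_le => e e0.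
  have nq : \forall y \near z, D y /\ `|slope v z - slope v y| <= e.
    apply: filterI; first exact: open_nbhs_nbhs.
    have /cvgrPdist_le := smooth_on_continuous _ _ _ _ _ _ (smooth_on_slope v) Dz.
    exact.
  have /nbhs_ballP[r /= r0 zr] := nq.
  near=> h; have h0 : h != 0 by near: h; exact: nbhs_dnbhs_neq.
  have [Bh Eh] : ball z r (Psi (h *: v + w)) /\
      Phi (Psi (h *: v + w)) = h *: v + w.
    by near: h; apply: cvg_within; apply: Psi_line; exact: nbhsx_ballx.
  rewrite Psiw /=; set y := Psi _ in Bh Eh *.
  have seg (s : R) : 0 <= s <= 1 -> ball z r (z + s *: (y - z)).
    by apply: ball_segment => //; exact: ballxx.
  have [s s01] := mvtY z y (fun s s01 => (zr _ (seg s s01)).1).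
  have [Dx xe] := zr _ (seg s s01).
  set x := z + s *: (y - z) in Dx xe *.
  have y1 : y.1 = h * v.1 + w.1 by have := congr1 fst Eh.
  have y2 : Y y = h * v.2 + w.2 by have := congr1 snd Eh.
  rewrite y2 w2 y1 w1 !addrK => E.
  have YX0 : YX x != 0 by rewrite gt_eqF // YX_gt0.
  have -> : h^-1 *: (y.2 - z.2) = slope v x; last exact: xe.
  apply: (mulfI YX0); rewrite [RHS]mulrC /slope divfK //.
  have -> : YX x * (h^-1 *: (y.2 - z.2)) = h^-1 * ((y.2 - z.2) * YX x).
    by rewrite [_ *: _]mulrC; ring.
  have -> : (y.2 - z.2) * YX x = h * (v.2 - v.1 * YT x).
    by rewrite mulrBr E; ring.
  by rewrite mulKf.
have := is_der_pair _ _ _ _ _ _ _ _ _ _ D1 D2.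
by under eq_fun do rewrite -surjective_pairing.
Unshelve. all: by end_near. Qed.

(** Bootstrap: the derivatives of [Psi] are smooth functions of [Psi] itself, so each class C^k
    gives the next one. *)
Lemma smooth_on_Psi : smooth_on (Phi @` D) Psi.
Proof.
have oE := Phi_image_open.
elim=> [|k IH]; first by split => // w; exact: Psi_continuous.
apply: (Ck_on_step _ _ _ _ _ _ (fun v w => (v.1, slope v (Psi w)))) => //.
- by move=> w; exact: Psi_continuous.
- by move=> w v; exact: is_derive_Psi.
- move=> v; apply: Ck_on_pair => //; first exact: Ck_on_cst.
  apply: (Ck_on_comp _ _ _ _ _ D) => //; first exact: findim_plane.
    by move=> _ [z Dz <-]; rewrite PhiK.
  exact: smooth_on_slope.
Qed.

Lemma derive_comp_Psi (N : R * R -> R) z v : smooth_on D N -> D z ->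
  'D_v (fun w => N (Psi w)) (Phi z) =
  v.1 * 'D_((1, 0) : R * R) N z + slope v z * 'D_((0, 1) : R * R) N z.
Proof.
move=> sN Dz; have Ez : (Phi @` D) (Phi z) by exists z.
have dN : differentiable N (Psi (Phi z)).
  rewrite PhiK //; apply: (smooth_on_differentiable _ _ D) => //.
  exact: findim_plane.
have [_ ->] := is_der_comp _ _ _ _ dN (is_derive_Psi _ v Ez).
by rewrite PhiK // (derive_plane _ D).
Qed.

End ChangeOfCoordinates.

(** * Periodic profiles *)

Section Slices.
Variables (R : realType) (V : normedModType R).

Lemma is_derive_curry1 (f : V -> R -> R) (p v : V) (x : R) :
  derivable (fun z : V * R => f z.1 z.2) (p, x) (v, 0) ->
  is_derive p v (f^~ x) ('D_(v, 0) (fun z : V * R => f z.1 z.2) (p, x)).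
Proof.
have EE : (fun h : R => h^-1 *: ((f^~ x \o shift p) (h *: v) - f p x))
    = (fun h => h^-1 *: (((fun z : V * R => f z.1 z.2) \o shift (p, x))
        (h *: (v, 0)) - f p x)).
  by apply/funext => h /=; rewrite scaler0 add0r.
by move=> dg; split; rewrite /derivable /derive EE.
Qed.

Lemma is_derive_curry2 (f : V -> R -> R) (p : V) (x : R) :
  derivable (fun z : V * R => f z.1 z.2) (p, x) (0, 1) ->
  is_derive x (1 : R) (f p) ('D_(0, 1) (fun z : V * R => f z.1 z.2) (p, x)).
Proof.
have EE : (fun h : R => h^-1 *: ((f p \o shift x) (h *: 1) - f p x))
    = (fun h => h^-1 *: (((fun z : V * R => f z.1 z.2) \o shift (p, x))
        (h *: (0, 1)) - f p x)).
  by apply/funext => h /=; rewrite scaler0 add0r.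
by move=> dg; split; rewrite /derivable /derive EE.
Qed.

Variables (D : set V) (f : V -> R -> R).
Hypotheses (openD : open D).
Hypothesis sf : smooth_on (D `*` [set: R]) (fun z => f z.1 z.2).

Lemma open_cylinder : open (D `*` [set: R]).
Proof.
rewrite openE => -[p t] [/= Dp _]; exists (D, setT); last by move=> [q s] [].
by split; [exact: open_nbhs_nbhs|exact: filterT].
Qed.

Lemma is_derive_fiber p x : D p ->
  is_derive x (1 : R) (f p) ('D_(0, 1) (fun z => f z.1 z.2) (p, x)).
Proof.
move=> Dp; have Dpx : (D `*` [set: R]) (p, x) by split.
by apply: is_derive_curry2; apply: Ck_on_derivable (sf 1) Dpx.
Qed.

Lemma derive1_fiber p x : D p ->
  derive1 (f p) x = 'D_(0, 1) (fun z => f z.1 z.2) (p, x).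
Proof.
move=> Dp; have E := derive_val (is_derive := is_derive_fiber p x Dp).
by rewrite derive1E E.
Qed.

Lemma smooth_on_derive1 :
  smooth_on (D `*` [set: R]) (fun z => derive1 (f z.1) z.2).
Proof.
have H := smooth_on_derive _ _ ((0, 1) : V * R) sf.
apply: (smooth_on_ext _ _ _ H); first exact: open_cylinder.
by move=> [p x] [/= Dp _]; rewrite derive1_fiber.
Qed.

Lemma is_derive_derive1 p x : D p ->
  is_derive x (1 : R) (f p) (derive1 (f p) x).
Proof.
by move=> Dp; rewrite (derive1_fiber p x Dp); exact: is_derive_fiber p x Dp.
Qed.

End Slices.

(** * Derivatives of the specific energy *)

Section Energy.
Variables (R : realType) (eps : R -> R -> R).
Hypothesis seps : smooth_energy eps.

Definition half_plane : set (R * R) := [set z : R * R | 0 < z.1].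

Lemma open_half_plane : open half_plane.
Proof.
rewrite openE => -[a b] /= a0; exists ([set x | 0 < x], setT); last by move=> [x y] [].
split; last exact: filterT.
exact: (lt_nbhsr a0).
Qed.

Lemma partial1E (a b : R) : 0 < a ->
  partial1 eps a b = 'D_((1, 0) : R * R) (fun z => eps z.1 z.2) (a, b).
Proof.
move=> a0; rewrite /partial1 derive1E.
have [_ E] := is_derive_curry1 _ _ eps a 1 b
  (Ck_on_derivable _ _ _ _ _ _ (a, b) _ (seps 1) a0).
exact: E.
Qed.

Lemma partial2E (a b : R) : 0 < a ->
  partial2 eps a b = 'D_((0, 1) : R * R) (fun z => eps z.1 z.2) (a, b).
Proof.
move=> a0; rewrite /partial2 derive1E.
have [_ E] := is_derive_curry2 _ _ eps a b
  (Ck_on_derivable _ _ _ _ _ _ (a, b) _ (seps 1) a0).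
exact: E.
Qed.

Lemma smooth_on_partial1 : smooth_on half_plane (fun z => partial1 eps z.1 z.2).
Proof.
have H := smooth_on_derive _ _ ((1, 0) : R * R) seps.
apply: (smooth_on_ext _ open_half_plane _ H).
by move=> [a b] /= a0; rewrite partial1E.
Qed.

Lemma smooth_on_partial2 : smooth_on half_plane (fun z => partial2 eps z.1 z.2).
Proof.
have H := smooth_on_derive _ _ ((0, 1) : R * R) seps.
apply: (smooth_on_ext _ open_half_plane _ H).
by move=> [a b] /= a0; rewrite partial2E.
Qed.

Lemma is_derive_half_plane (V : normedModType R) (g : R -> R -> R)
    (f q : V -> R) (x v : V) (df dq : R) :
  smooth_on half_plane (fun z => g z.1 z.2) -> 0 < f x ->
  is_derive x v f df -> is_derive x v q dq ->
  is_derive x v (fun y => g (f y) (q y))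
    (df * 'D_((1, 0) : R * R) (fun z => g z.1 z.2) (f x, q x) +
     dq * 'D_((0, 1) : R * R) (fun z => g z.1 z.2) (f x, q x)).
Proof.
move=> sg f0 hf hq; have oH := open_half_plane.
have dg := smooth_on_differentiable _ _ _ (fun z => g z.1 z.2) (f x, q x)
  (findim_plane R) oH sg f0.
have := is_der_comp _ (fun y => (f y, q y)) _ _ dg
  (is_der_pair _ _ _ _ _ _ _ _ _ _ hf hq).
by rewrite (derive_plane _ half_plane).
Qed.

Lemma is_derive_eps (V : normedModType R) (f q : V -> R) (x v : V) (df dq : R) :
  0 < f x -> is_derive x v f df -> is_derive x v q dq ->
  is_derive x v (fun y => eps (f y) (q y))
    (df * partial1 eps (f x) (q x) + dq * partial2 eps (f x) (q x)).
Proof. by move=> f0 hf hq; rewrite partial1E // partial2E //; exact: is_derive_half_plane. Qed.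

End Energy.

Section Uniqueness.
Variables (R : realType) (V W : normedModType R).

Lemma is_derive_unique (f : V -> W) (x v : V) (d1 d2 : W) :
  is_derive x v f d1 -> is_derive x v f d2 -> d1 = d2.
Proof. by move=> [_ <-] [_ <-]. Qed.

Lemma is_derive_eqfun (f g : V -> W) (x v : V) (d : W) : (forall y, f y = g y) ->
  is_derive x v f d -> is_derive x v g d.
Proof. by move=> /funext ->. Qed.

End Uniqueness.

(** * First integral and Euler-Lagrange equation of a single profile *)

Section OneProfile.
Variables (R : realType) (eps : R -> R -> R) (V : R -> R) (j l m : R).
Hypothesis seps : smooth_energy eps.
Hypotheses (sV : smooth_on [set: R] V) (V_gt0 : forall x, 0 < V x).

Let dV : R -> R := derive1 V.
Let E x := eps (V x) (dV x).
Let A x := partial1 eps (V x) (dV x).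
Let B x := partial2 eps (V x) (dV x).
Let dB : R -> R := derive1 B.
Let P x := - A x + dB x.

Lemma smooth_on_derive1R (f : R -> R) :
  smooth_on [set: R] f -> smooth_on [set: R] (derive1 f).
Proof.
move=> sf; apply: (smooth_on_ext (fun x => 'D_1 f x)).
- exact: openT.
- by move=> x _; rewrite derive1E.
- exact: smooth_on_derive.
Qed.

Lemma is_derive_smoothR (f : R -> R) x :
  smooth_on [set: R] f -> is_derive x (1 : R) f (derive1 f x).
Proof.
by move=> sf; rewrite derive1E; apply: (smooth_on_is_derive setT) => //.
Qed.

Lemma smooth_on_half_plane_comp (U : normedModType R) (D : set U)
    (g : R -> R -> R) (f q : U -> R) :
  open D -> smooth_on (@half_plane R) (fun z => g z.1 z.2) ->
  (forall x, D x -> 0 < f x) -> smooth_on D f -> smooth_on D q ->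
  smooth_on D (fun x => g (f x) (q x)).
Proof.
move=> oD sg f0 sf sq.
apply: (smooth_on_comp D (@half_plane R) (fun x => (f x, q x))
  (fun z => g z.1 z.2)) => //.
- exact: findim_plane.
- exact: open_half_plane.
- exact: smooth_on_pair.
Qed.

Let sdV : smooth_on [set: R] dV. Proof. exact: smooth_on_derive1R. Qed.
Let oT : open [set: R]. Proof. exact: openT. Qed.

Let sA : smooth_on [set: R] A.
Proof. by apply: smooth_on_half_plane_comp => //; exact: smooth_on_partial1. Qed.

Let sB : smooth_on [set: R] B.
Proof. by apply: smooth_on_half_plane_comp => //; exact: smooth_on_partial2. Qed.

Let sdB : smooth_on [set: R] dB. Proof. exact: smooth_on_derive1R. Qed.

Let sP : smooth_on [set: R] P.
Proof. by apply: smooth_on_add => //; apply: smooth_on_opp. Qed.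

Hypothesis ode : forall x,
  dV x * B x - E x + j ^+ 2 * V x ^+ 2 / 2 + l * V x = - m.

(** Derivative of the first integral [ode]; the factor [dV x] cannot be divided out where it
    vanishes. *)
Lemma euler_lagrange_weak x : dV x * (P x + j ^+ 2 * V x + l) = 0.
Proof.
have hV := is_derive_smoothR V x sV; have hdV := is_derive_smoothR dV x sdV.
have hB := is_derive_smoothR B x sB.
have hE := is_derive_eps _ _ seps _ _ _ _ _ _ _ (V_gt0 x) hV hdV.
rewrite -/(derive1 V) in hV.
have H := is_der_add (is_der_add
  (is_der_add (is_der_mul hdV hB)
    (is_der_opp hE))
  (is_der_mul (is_der_mul
    (is_der_cst _ _ (j ^+ 2)) (is_der_exp 1 hV))
    (is_der_cst _ _ 2^-1)))
  (is_der_mul (is_der_cst _ _ l) hV).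
have Z := is_derive_unique _ _ _ _ _ _ _ _ H (is_derive_eqfun _ _ _ _ _ _ _ _
  (fun y => esym (ode y)) (is_der_cst x (1 : R) (- m))).
apply: etrans Z; rewrite -/dV -/(dV x) -/dB -/(A x) -/(B x) /P.
move: (dV x) (A x) (B x) (dB x) (V x) (derive1 dV x) => v' a b b' v v''.
by field.
Qed.

(** Defect in the Euler-Lagrange equation. *)
Let g x := P x + j ^+ 2 * V x + l.

Let sg : smooth_on [set: R] g.
Proof.
apply: smooth_on_add => //; last exact: smooth_on_cst.
by apply: smooth_on_add => //; apply: smooth_on_mul => //; exact: smooth_on_cst.
Qed.

Lemma derive1_locally_zero (f : R -> R) (U : set R) : open U ->
  (forall x, U x -> f x = 0) -> forall x, U x -> derive1 f x = 0.
Proof.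
move=> oU f0 x Ux; rewrite derive1E -(derive_cst (0 : R) x (1 : R)).
apply: near_eq_derive; apply: filterS (open_nbhs_nbhs (conj oU Ux)).
by move=> y /f0.
Qed.

(** Where [g] is nonzero, [dV] vanishes on a whole neighbourhood, so all the terms of [g] are
    locally constant. *)
Lemma derive1_flux x : g x != 0 -> derive1 g x = 0.
Proof.
move=> gx; pose U := [set y | g y != 0].
have oU : open U.
  apply: (@open_comp _ _ g [set y | y != 0]); last exact: open_neq.
  by move=> y _; exact: (smooth_on_continuous _ _ _ _ _ _ sg I).
have dV0 y : U y -> dV y = 0.
  move=> Uy; have /eqP := euler_lagrange_weak y; rewrite mulf_eq0.
  by rewrite -/(g y) (negbTE Uy) orbF => /eqP.
have ddV0 := derive1_locally_zero _ _ oU dV0.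
have zero (h : R -> R -> R) y : smooth_on (@half_plane R) (fun z => h z.1 z.2) ->
    U y -> is_derive y (1 : R) (fun x => h (V x) (dV x)) 0.
  move=> sh Uy; have := is_derive_half_plane _ _ h V dV y (1 : R) _ _ sh (V_gt0 y)
    (is_derive_smoothR V y sV) (is_derive_smoothR dV y sdV).
  by rewrite ddV0 // -/(dV y) dV0 // !mul0r addr0.
have dB0 y : U y -> dB y = 0.
  move=> Uy; rewrite /dB derive1E; apply: derive_val.
  exact: zero (smooth_on_partial2 _ _ seps) Uy.
have hdB := is_derive_smoothR dB x sdB.
rewrite (derive1_locally_zero _ _ oU dB0 x gx) in hdB.
have hA := zero _ x (smooth_on_partial1 _ _ seps) gx.
have hV := is_derive_smoothR V x sV; rewrite -/(dV x) dV0 // in hV.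
have [_ H] := is_der_add (is_der_add
  (is_der_add (is_der_opp hA) hdB)
  (is_der_mul (is_der_cst _ _ (j ^+ 2)) hV))
  (is_der_cst _ _ l).
by rewrite derive1E H oppr0 !mulr0 !addr0.
Qed.

(** The derivative [2 g g'] of [g ^+ 2] vanishes everywhere, through one factor or the other, so
    [g ^+ 2] is constant: either [g] is identically zero, or it has no zero and the profile is
    constant. *)
Lemma momentum_flux_constant : exists c,
  (forall x, P x + j ^+ 2 * V x = c) /\ (c = - l \/ forall x, dV x = 0).
Proof.
have g2 x : is_derive x (1 : R) (fun x => g x ^+ 2) 0.
  have := is_der_exp 1 (is_derive_smoothR g x sg).
  have [->|/derive1_flux ->] := eqVneq (g x) 0; last by rewrite mulr0.
  by rewrite expr1 mulr0 mul0r.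
have g2c x : g x ^+ 2 = g 0 ^+ 2 := is_derive_0_is_cst x 0 g2.
have [g0|g0] := eqVneq (g 0) 0.
  have gx x : g x = 0 by apply/eqP; rewrite -sqrf_eq0 g2c g0 expr0n.
  exists (- l); split => [x|]; last by left.
  by apply/eqP; rewrite -addr_eq0; apply/eqP; exact: gx.
have gn x : g x != 0 by rewrite -sqrf_eq0 g2c sqrf_eq0.
have dg x : is_derive x (1 : R) g 0.
  by rewrite -(derive1_flux x (gn x)); exact: is_derive_smoothR.
exists (g 0 - l); split => [x|].
  by rewrite -(is_derive_0_is_cst x 0 dg) /g addrK.
right=> x; have /eqP := euler_lagrange_weak x; rewrite mulf_eq0.
by rewrite -/(g x) (negbTE (gn x)) orbF => /eqP.
Qed.

End OneProfile.

Section EulerianEnergy.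
Variables (R : realType) (eps : R -> R -> R).
Hypothesis seps : smooth_energy eps.

Lemma is_derive_scale (f : R -> R) (c t df : R) :
  is_derive (t / c) (1 : R) f df ->
  is_derive t (1 : R) (fun s => f (s / c)) (df / c).
Proof.
move=> hf; have [d1 <-] := hf.
have dl : is_derive t (1 : R) (fun s : R => s / c) (c^-1).
  have := is_der_mul (is_derive_id t (1 : R)) (is_der_cst _ _ c^-1).
  by rewrite /= mulr0 add0r mulr1.
have := is_der_comp f (fun s : R => s / c) t 1 _ dl.
rewrite -[X in 'D_X f _]mulr1.
have [_ ->] := deriveZr _ _ _ f (t / c) 1 c^-1 d1.
by rewrite [_ *: _]mulrC; apply; apply/derivable1_diffP.
Qed.

Lemma derive1_scale (f : R -> R) (c t : R) : derivable f (t / c) 1 ->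
  derive1 (fun s => f (s / c)) t = derive1 f (t / c) / c.
Proof.
move=> df; rewrite !derive1E; apply: derive_val.
by apply: is_derive_scale; exact: derivableP.
Qed.

Lemma partial2_Een (r q : R) : 0 < r ->
  partial2 (Een eps) r q = - partial2 eps r^-1 (- q / r ^+ 3) / r ^+ 2.
Proof.
move=> r0; rewrite {1}/partial2 derive1E.
have rn : r != 0 by rewrite gt_eqF.
have ri : 0 < (fun=> r^-1) q by rewrite /= invr_gt0.
have hq := is_der_mul (is_der_opp
  (is_derive_id q (1 : R))) (is_der_cst q (1 : R) (r ^+ 3)^-1).
have hE := is_der_mul (is_der_cst q (1 : R) r)
  (is_derive_eps _ _ seps _ (fun=> r^-1) _ q _ _ _ ri
    (is_der_cst q (1 : R) r^-1) hq).
apply: etrans (derive_val (is_derive := hE)) _.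
by move: (partial1 _ _ _) (partial2 _ _ _) (eps _ _) => a b c /=; field.
Qed.

Lemma partial1_Een (r q : R) : 0 < r -> partial1 (Een eps) r q =
  eps r^-1 (- q / r ^+ 3) - partial1 eps r^-1 (- q / r ^+ 3) / r +
  3 * q * partial2 eps r^-1 (- q / r ^+ 3) / r ^+ 3.
Proof.
move=> r0; rewrite {1}/partial1 derive1E.
have rn : r != 0 by rewrite gt_eqF.
have ri : 0 < (fun s : R => s^-1) r by rewrite /= invr_gt0.
have hi := is_der_inv r (1 : R) (fun s => s) rn (is_derive_id r (1 : R)).
have r3 : (fun s : R => s ^+ 3) r != 0 by rewrite expf_neq0.
have hq := is_der_mul (is_der_cst r (1 : R) (- q))
  (is_der_inv r _ (fun s : R => s ^+ 3) r3 (is_der_exp 2 (is_derive_id r (1 : R)))).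
have hE := is_der_mul (is_derive_id r (1 : R))
  (is_derive_eps _ _ seps _ (fun s : R => s^-1) _ r _ _ _ ri hi hq).
apply: etrans (derive_val (is_derive := hE)) _.
rewrite /= -/(- q / r ^+ 3).
by move: (partial1 _ _ _) (partial2 _ _ _) (eps _ _) => a b c; field.
Qed.

End EulerianEnergy.

(** * Means under the change of phase *)

Section MassCoordinate.
Variables (R : realType) (Z Rho V : R -> R) (K k : R).
Hypotheses (K0 : 0 < K) (k0 : 0 < k) (Z0 : Z 0 = 0).
Hypothesis dZ : forall x : R, is_derive x (1 : R) Z (Rho x).
Hypotheses (Rho0 : forall x, 0 < Rho x) (RhoV : forall x, Rho x * V (Z x) = 1).
Hypothesis kK : k^-1 = Z K^-1.

(** Change of variables [zeta = Z(xi)], [d zeta = d xi / V], carried out with a primitive of [F]: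
    both sides are [K] times the integral of [F] over one period [k^-1]. *)
Lemma mean_mass_coordinate (F : R -> R) : continuous F ->
  (forall x, {for x, continuous Rho}) ->
  mean (fun t => (V (Z (t / K)))^-1 * F (Z (t / K))) =
  K / k * mean (fun t => F (t / k)).
Proof.
move=> cF cRho; have [H dH] := primitive_ex _ F cF.
have Zc x : {for x, continuous Z}.
  by apply/differentiable_continuous/derivable1_diffP; have [] := dZ x.
(* The primitive [H] is controlled only to the right of -1, hence the need for the sign of [Z]. *)
have Zge x : 0 <= x -> 0 <= Z x.
  move=> x0; have Zw : {within `[0, x], continuous Z} by exact: continuous_subspaceT.
  have dZ' (y : R) : y \in `]0, x[ -> is_derive y (1 : R) Z (Rho y) by [].
  have [c _] := MVT_segment x0 dZ' Zw.
  by rewrite Z0 !subr0 => ->; rewrite mulr_ge0 // ltW.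
have VE x : (V (Z x))^-1 = Rho x.
  have VZ0 : V (Z x) != 0.
    by apply/eqP => V0; have := RhoV x; rewrite V0 mulr0 => /eqP; rewrite eq_sym oner_eq0.
  by apply: (mulIf VZ0); rewrite mulVf // RhoV.
have Kn : K != 0 by rewrite gt_eqF.
have kn : k != 0 by rewrite gt_eqF.
have scale_c (c : R) (f : R -> R) : continuous f -> continuous01 R (fun t => f (t / c)).
  move=> cf t _; apply: (@continuous_comp _ _ _ (fun t : R => t / c) f); last exact: cf.
  by apply: cvgMl; exact: cvg_id.
have -> : mean (fun t => F (t / k)) = k * H (1 / k) - k * H (0 / k).
  apply: (mean_FTC _ _ (fun t => k * H (t / k))); first exact: scale_c.
  move=> t /andP[t0 _]; have tk : 0 <= t / k by rewrite divr_ge0 // ltW.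
  have t1 : -1 < t / k by apply: lt_le_trans tk; rewrite oppr_lt0.
  have D := is_der_mul (is_der_cst _ _ k)
    (is_derive_scale _ _ _ _ _ (dH _ t1)).
  by apply: (is_derive_eq D); rewrite mulr0 addr0; field.
have -> : mean (fun t => (V (Z (t / K)))^-1 * F (Z (t / K))) =
    K * H (Z (1 / K)) - K * H (Z (0 / K)).
  apply: (mean_FTC _ _ (fun t => K * H (Z (t / K)))).
    apply: (scale_c K (fun x => (V (Z x))^-1 * F (Z x))) => x.
    under eq_fun do rewrite VE.
    apply: cvgM; first exact: cRho.
    by apply: (@continuous_comp _ _ _ Z F); [exact: Zc|exact: cF].
  move=> t /andP[t0 _]; have tK : 0 <= t / K by rewrite divr_ge0 // ltW.
  have Z1 : -1 < Z (t / K) by apply: lt_le_trans (Zge _ tK); rewrite oppr_lt0.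
  have dHd : differentiable H (Z (t / K)).
    by apply/derivable1_diffP; have [] := dH _ Z1.
  have hc := is_der_comp H Z _ _ dHd (dZ (t / K)).
  have D := is_der_mul (is_der_cst _ _ K)
    (is_derive_scale _ _ _ _ _ hc).
  apply: (is_derive_eq D).
  have e1 := derive_val (is_derive := deriveZr _ _ _ H (Z (t / K)) 1
    (Rho (t / K)) (ex_derive (is_derive := dH _ Z1))).
  have e2 := derive_val (is_derive := dH _ Z1).
  rewrite e2 (_ : Rho (t / K) *: (1 : R) = Rho (t / K)) in e1; last exact: mulr1.
  by rewrite VE e1 mulr0 addr0 mulrC divfK.
by rewrite !mul0r Z0 !div1r -kK; field.
Qed.

End MassCoordinate.

Lemma vec4E (R : realType) (a b c d : R) :
  (vec4 a b c d 0 0 = a) * (vec4 a b c d 0 1 = b) *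
  (vec4 a b c d 0 2 = c) * (vec4 a b c d 0 3 = d).
Proof. by rewrite /vec4 !mxE. Qed.

Lemma forall_I4 (P : 'I_4 -> Prop) : (forall i, P i) <-> [/\ P 0, P 1, P 2 & P 3].
Proof.
split=> [H|[P0 P1 P2 P3]]; first by split; exact: H.
case=> -[|[|[|[|//]]]] i4.
- by rewrite (_ : Ordinal i4 = 0) //; apply: val_inj.
- by rewrite (_ : Ordinal i4 = 1) //; apply: val_inj.
- by rewrite (_ : Ordinal i4 = 2) //; apply: val_inj.
- by rewrite (_ : Ordinal i4 = 3) //; apply: val_inj.
Qed.

Lemma and4_iff (P0 P1 P2 P3 Q0 Q1 Q2 Q3 : Prop) : (P0 <-> Q0) -> (P1 <-> Q1) ->
  (P2 <-> Q2) -> (P3 <-> Q3) -> [/\ P0, P1, P2 & P3] <-> [/\ Q0, Q1, Q2 & Q3].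
Proof. by move=> [? ?] [? ?] [? ?] [? ?]; split=> -[*]; split; auto. Qed.

Lemma eq0_iff (R : nmodType) (x y : R) : x = y -> (x = 0 <-> y = 0).
Proof. by move=> ->. Qed.

Arguments eq0_iff {R x y}.

(** * Linear algebra *)

Section SelfAdjoint.
Import complex.
Variables (R : realType) (n : nat) (A S : 'M[R]_n.+1).
Hypotheses (symS : S^T = S) (posS : positive_definite S).
Hypothesis selfadj : A *m S = S *m A^T.

Let form (x y : 'rV[R]_n.+1) : R := (x *m S *m y^T) 0 0.

Let formC x y : form x y = form y x.
Proof.
have -> : form x y = ((x *m S *m y^T)^T) 0 0 by rewrite mxE.
by rewrite /form !trmx_mul trmxK symS mulmxA.
Qed.

Let form_ge0 x : 0 <= form x x.
Proof.
have [->|x0] := eqVneq x 0; first by rewrite /form !mul0mx mxE.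
exact/ltW/posS.
Qed.

Let form_eq0 x : form x x = 0 -> x = 0.
Proof. by move=> xx; apply/eqP/negPn/negP => /posS; rewrite -/(form x x) xx ltxx. Qed.

Let formL a b x y z : form (a *: x + b *: y) z = a * form x z + b * form y z.
Proof. by rewrite /form !mulmxDl -!scalemxAl !mxE. Qed.

Let form_adj (C : 'M[R]_n.+1) x y : C *m S = S *m C^T ->
  form (x *m C) y = form x (y *m C).
Proof.
by move=> CS; rewrite /form trmx_mul mulmxA -[x *m S *m _]mulmxA -CS !mulmxA.
Qed.

(** Here [x] and [y] are the real and imaginary parts of an eigenvector for [a + ib]; moving [A]
    from one argument of [form x y] to the other gives [b * (form x x + form y y) = 0]. *)
Lemma selfadjoint_eigenvalue_real (x y : 'rV[R]_n.+1) (a b : R) :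
  x *m A = a *: x - b *: y -> y *m A = b *: x + a *: y ->
  (x != 0) || (y != 0) -> b = 0.
Proof.
move=> xA yA xy0; have := form_adj A x y selfadj.
rewrite xA yA -scaleNr formL [RHS]formC formL (formC y x) => E.
have {E} : b * (form x x + form y y) = 0.
  move: E; move: (form x x) (form y y) (form x y) => xx yy xy E.
  have -> : b * (xx + yy) = b * xx + a * xy - (a * xy + - b * yy) by ring.
  by rewrite E; ring.
move/eqP; rewrite mulf_eq0 => /orP[/eqP //|].
rewrite paddr_eq0 // => /andP[/eqP/form_eq0 x0 /eqP/form_eq0 y0].
by move: xy0; rewrite x0 y0 eqxx.
Qed.

Lemma selfadjoint_horner (q : {poly R}) :
  horner_mx A q *m S = S *m (horner_mx A q)^T.
Proof.
elim/poly_ind: q => [|q c IH]; first by rewrite rmorph0 mul0mx trmx0 mulmx0.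
rewrite rmorphD rmorphM /= horner_mx_X horner_mx_C mulmxDl linearD /= mulmxDr.
congr (_ + _); last by rewrite tr_scalar_mx scalar_mxC.
rewrite -[horner_mx A q * A]/(horner_mx A q *m A) trmx_mul mulmxA -selfadj.
rewrite -!mulmxA -IH !mulmxA; congr (_ *m _).
by apply: esym; apply: comm_mx_horner; exact: comm_mx_refl.
Qed.

Lemma selfadjoint_nilpotent (C : 'M[R]_n.+1) N : C *m S = S *m C^T ->
  C ^+ N = 0 -> C = 0.
Proof.
have sq (D : 'M[R]_n.+1) : D *m S = S *m D^T -> D * D = 0 -> D = 0.
  move=> DS DD; apply/row_matrixP => i; rewrite row0 rowE; apply: form_eq0.
  rewrite form_adj // -mulmxA -[D *m D]/(D * D) DD mulmx0.
  by rewrite /form trmx0 mulmx0 mxE.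
have adjX m : C *m S = S *m C^T -> C ^+ m *m S = S *m (C ^+ m)^T.
  move=> CS; elim: m => [|m IH]; first by rewrite expr0 mul1mx trmx1 mulmx1.
  rewrite exprS -[C * _]/(C *m _) trmx_mul -mulmxA IH mulmxA CS -!mulmxA.
  by congr (_ *m _); rewrite -!trmx_mul; congr (_^T); rewrite -[LHS]exprSr -[RHS]exprS.
move=> CS CN; have : C ^+ (2 ^ N) = 0.
  by rewrite -(subnK (ltnW (ltn_expl N (ltnSn 1)))) exprD CN mulr0.
elim: {CN} N => [|N IH]; first by rewrite expn0 expr1.
by rewrite expnS mul2n -addnn exprD => /sq H; apply: IH; apply: H; exact: adjX.
Qed.

(** The minimal polynomial splits over the complex numbers, and its roots are eigenvalues, hence
    real. *)
Lemma selfadjoint_minpoly_split :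
  exists rs : seq R, mxminpoly A = \prod_(r <- rs) ('X - r%:P).
Proof.
pose C := complex R; pose f : {rmorphism R -> C} := real_complex R.
have [zs Ez] := closed_field_poly_normal (map_poly f (mxminpoly A)).
rewrite (monicP _) ?scale1r in Ez; last by rewrite map_monic mxminpoly_monic.
have real z : z \in zs -> z = f (complex.Re z).
  move=> zzs.
  have rz : root (mxminpoly (map_mx f A)) z.
    by rewrite mxminpoly_map Ez root_prod_XsubC.
  rewrite root_mxminpoly -eigenvalue_root_char in rz.
  have /eigenvalueP[v vA v0] := rz.
  pose x : 'rV[R]_n.+1 := \row_i complex.Re (v 0 i).
  pose y : 'rV[R]_n.+1 := \row_i complex.Im (v 0 i).
  have ReS (F : 'I_n.+1 -> C) : complex.Re (\sum_i F i) = \sum_i complex.Re (F i).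
    by apply: (big_morph (@complex.Re R)) => // -[? ?] [].
  have ImS (F : 'I_n.+1 -> C) : complex.Im (\sum_i F i) = \sum_i complex.Im (F i).
    by apply: (big_morph (@complex.Im R)) => // -[? ?] [].
  have xA : x *m A = complex.Re z *: x - complex.Im z *: y.
    apply/rowP => j; have := congr1 (fun u : 'rV[C]_n.+1 => complex.Re (u 0 j)) vA.
    rewrite !mxE ReS => E; transitivity (complex.Re (z * v 0 j)); last first.
      by case: z (v 0 j) {zzs rz vA E} => [a b] [c d].
    rewrite -E; apply: eq_bigr => i _; rewrite !mxE.
    by case: (v 0 i) => c d /=; rewrite mulr0 subr0.
  have yA : y *m A = complex.Im z *: x + complex.Re z *: y.
    apply/rowP => j; have := congr1 (fun u : 'rV[C]_n.+1 => complex.Im (u 0 j)) vA.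
    rewrite !mxE ImS => E; transitivity (complex.Im (z * v 0 j)); last first.
      by case: z (v 0 j) {zzs rz vA xA E} => [a b] [c d] /=; rewrite addrC.
    rewrite -E; apply: eq_bigr => i _; rewrite !mxE.
    by case: (v 0 i) => c d /=; rewrite mulr0 add0r.
  have xy0 : (x != 0) || (y != 0).
    apply: contraNT v0; rewrite negb_or !negbK => /andP[/eqP x0 /eqP y0].
    apply/eqP/rowP => j; rewrite mxE.
    have := congr1 (fun u : 'rV[R]_n.+1 => u 0 j) x0.
    have := congr1 (fun u : 'rV[R]_n.+1 => u 0 j) y0.
    by rewrite !mxE; case: (v 0 j) => c d /= -> ->.
  have := selfadjoint_eigenvalue_real x y _ _ xA yA xy0.
  by case: z {zzs rz vA xA yA} => a b /= ->.
exists [seq complex.Re z | z <- zs].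
apply: (map_poly_inj f); rewrite Ez rmorph_prod /= big_map.
rewrite [LHS]big_seq [RHS]big_seq; apply: eq_bigr => z zzs.
by rewrite rmorphB /= map_polyX map_polyC /= [in LHS](real z zzs).
Qed.

(** With [g] the product over the distinct roots, the minimal polynomial divides a power of [g], so
    [g] evaluated at [A] is nilpotent and self-adjoint, hence zero: the minimal polynomial divides
    [g], whose roots are simple. *)
Lemma selfadjoint_diagonalizable : diagonalizable A.
Proof.
have [rs Ers] := selfadjoint_minpoly_split.
apply/diagonalizableP; exists (undup rs); first exact: undup_uniq.
set g := \prod_(x <- undup rs) _.
have dvd (l : seq R) : {subset l <= rs} ->
    \prod_(r <- l) ('X - r%:P) %| g ^+ size l.
  elim: l => [|r l IH] lrs; first by rewrite big_nil dvd1p.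
  rewrite big_cons /= exprS dvdp_mul //.
    rewrite dvdp_XsubCl /g root_prod_XsubC mem_undup; apply: lrs.
    exact: mem_head.
  by apply: IH => x xl; apply: lrs; rewrite inE xl orbT.
apply: mxminpoly_min; apply: (selfadjoint_nilpotent _ (size rs)).
  exact: selfadjoint_horner.
have := dvd rs (fun _ h => h); rewrite -Ers => /mxminpoly_minP.
by rewrite rmorphXn.
Qed.

End SelfAdjoint.

Section Jacobian.
Variables (R : realType) (n m : nat).

Lemma rV_sum_coord (f : 'rV[R]_n -> 'rV[R]_m) :
  f = (fun p => \sum_j f p 0 j *: delta_mx 0 j).
Proof. by apply/funext => p; rewrite -row_sum_delta. Qed.

Lemma differentiable_rV (f : 'rV[R]_n -> 'rV[R]_m) p :
  (forall j, differentiable (fun q => f q 0 j) p) -> differentiable f p.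
Proof.
move=> df; rewrite [f]rV_sum_coord.
have -> : (fun p0 => \sum_j f p0 0 j *: delta_mx 0 j) =
    \sum_j (fun p0 => f p0 0 j *: (delta_mx 0 j : 'rV[R]_m)).
  by apply/funext => q; rewrite fct_sumE.
by apply: differentiable_sum => j; exact: differentiableZl.
Qed.

Lemma jacobianE (f : 'rV[R]_n -> 'rV[R]_m) p :
  (forall j, differentiable (fun q => f q 0 j) p) ->
  jacobian f p = \matrix_(i, j) 'D_(delta_mx 0 i) (fun q => f q 0 j) p.
Proof.
move=> df; have dfp := differentiable_rV f p df.
apply/matrixP => i j; rewrite [RHS]mxE.
have -> : jacobian f p i j = ('D_(delta_mx 0 i) f p) 0 j.
  by rewrite deriveEjacobian // -rowE [RHS]mxE.
by rewrite derive_mx ?mxE //; exact: diff_derivable.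
Qed.

End Jacobian.

(** * Transfer of hyperbolicity between two pencils *)

Section HyperbolicTransfer.
Variables (R : realType) (n : nat).

Lemma diagonalizable_affine (X : 'M[R]_n) (a b : R) :
  diagonalizable X -> diagonalizable (a *: X + b%:M).
Proof.
move=> [P Pu /(diagonalizable_forP _ Pu) PX]; exists P => //.
apply/(diagonalizable_forP _ Pu) => i j ij.
rewrite mulmxDr mulmxDl -scalemxAr -scalemxAl scalar_mxC mulmxK //.
rewrite [LHS]mxE [X in X + _]mxE [X in _ + X]mxE PX //.
by rewrite mulr0 add0r (negbTE (_ : i != j)) //; apply: contra ij => /eqP ->.
Qed.

(** The factor [M] cancels: the characteristic matrix on the left is [a *: X + b%:M], with [X] the
    one on the right, and has the same eigenvectors. *)
Lemma hyperbolic_transfer (A B M : 'M[R]_n) (a b : R) : M \in unitmx -> a != 0 ->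
  (((A *m M)^T \in unitmx) /\ diagonalizable
    (invmx (A *m M)^T *m (a *: (B *m M) + b *: (A *m M))^T)) <->
  ((A^T \in unitmx) /\ diagonalizable (invmx A^T *m B^T)).
Proof.
move=> Mu a0; rewrite !unitmx_tr unitmx_mul Mu andbT.
have E : A \in unitmx -> invmx (A *m M)^T *m (a *: (B *m M) + b *: (A *m M))^T =
    a *: (invmx A^T *m B^T) + b%:M.
  move=> Au; rewrite linearD !linearZ /= mulmxDr -!scalemxAr mulVmx; last first.
    by rewrite unitmx_tr unitmx_mul Au.
  rewrite scalemx1; congr (_ *: _ + _).
  have AMu : (A *m M)^T \in unitmx by rewrite unitmx_tr unitmx_mul Au.
  apply: (can_inj (mulKmx AMu)); rewrite mulmxA mulmxV // mul1mx.
  by rewrite !trmx_mul -!mulmxA mulKVmx // unitmx_tr.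
split=> -[Au D]; split; [exact: Au| |exact: Au|]; last first.
  by rewrite (E Au); exact: diagonalizable_affine.
rewrite (E Au) in D.
have := diagonalizable_affine _ a^-1 (- (a^-1 * b)) D.
rewrite scalerDr scalerA (mulVf a0) scale1r scale_scalar_mx -addrA.
by rewrite -raddfD /= subrr raddf0 addr0.
Qed.

End HyperbolicTransfer.

Section Columns.
Variable R : realType.

Definition cols4 (a b c d : 'I_4 -> R) : 'M[R]_4 :=
  \matrix_(i, j) [:: a i; b i; c i; d i]`_j.

Lemma sum_I4 (F : 'I_4 -> R) : \sum_i F i = F 0 + F 1 + F 2 + F 3.
Proof.
rewrite !big_ord_recl big_ord0 addr0 !addrA.
by congr (_ + _ + _ + _); congr F; apply: val_inj.
Qed.

Lemma cols4_mul (a b c d : 'I_4 -> R) (M : 'M[R]_4) :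
  cols4 a b c d *m M =
  \matrix_(i, j) (a i * M 0 j + b i * M 1 j + c i * M 2 j + d i * M 3 j).
Proof. by apply/matrixP => i j; rewrite !mxE sum_I4 !mxE. Qed.

Lemma eq_cols4 (A : 'M[R]_4) (a b c d : 'I_4 -> R) :
  (forall i, A i 0 = a i) -> (forall i, A i 1 = b i) ->
  (forall i, A i 2 = c i) -> (forall i, A i 3 = d i) -> A = cols4 a b c d.
Proof.
move=> A0 A1 A2 A3; apply/matrixP => i; apply/forall_I4.
by split; rewrite ?A0 ?A1 ?A2 ?A3 mxE.
Qed.

End Columns.

(** * Hessians and perspectives *)

Section RowVectors.
Variables (R : realType) (V : normedModType R) (m : nat).

Lemma is_der_rV (f : V -> 'rV[R]_m) (x v : V) (d : 'rV[R]_m) :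
  (forall j, is_derive x v (fun y => f y 0 j) (d 0 j)) -> is_derive x v f d.
Proof.
move=> H; have df : derivable f x v.
  by apply/derivable_mxP => i j; rewrite (ord1 i); have [] := H j.
split => //; rewrite derive_mx //; apply/rowP => j; rewrite mxE.
exact: (derive_val (is_derive := H j)).
Qed.

Lemma Ck_on_rV k (D : set V) (f : V -> 'rV[R]_m) : open D ->
  (forall j, Ck_on k D (fun x => f x 0 j)) -> Ck_on k D f.
Proof.
move=> oD; have cf (g : V -> 'rV[R]_m) x : D x ->
    (forall j, Ck_on 0 D (fun x => g x 0 j)) -> {for x, continuous g}.
  move=> Dx Cg; have -> : g = (fun y => \sum_j g y 0 j *: delta_mx 0 j).
    by apply/funext => y; rewrite -row_sum_delta.
  apply: cvg_big => [|j _]; first exact: add_continuous.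
  by apply: cvgZl; exact: (Cg j).1 Dx.
elim: k f => [|k IH] f Cf; first by split => // x Dx; exact: cf Dx Cf.
apply: (Ck_on_step _ _ _ _ _ _ (fun v x => \row_j 'D_v (fun x => f x 0 j) x)) => //.
- by move=> x Dx; apply: cf => // j; exact: Ck_on0 (Cf j).
- move=> x v Dx; apply: is_der_rV => j; rewrite mxE; apply: derivableP.
  exact: Ck_on_derivable (Cf j) Dx.
- move=> v; apply: IH => j; under eq_fun do rewrite mxE.
  exact: Ck_on_derive (Cf j).
Qed.

Lemma smooth_on_rV (D : set V) (f : V -> 'rV[R]_m) : open D ->
  (forall j, smooth_on D (fun x => f x 0 j)) -> smooth_on D f.
Proof. by move=> oD sf k; apply: Ck_on_rV => // j; exact: sf. Qed.

Lemma is_der_sum n (f : 'I_n -> V -> R) (x v : V) (d : 'I_n -> R) :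
  (forall i, is_derive x v (f i) (d i)) ->
  is_derive x v (fun y => \sum_i f i y) (\sum_i d i).
Proof.
elim: n f d => [|n IH] f d H.
  by rewrite big_ord0; under eq_fun do rewrite big_ord0; exact: is_der_cst.
have -> : (fun y => \sum_i f i y) = (fun y => f ord0 y + \sum_i f (lift ord0 i) y).
  by apply/funext => y; rewrite big_ord_recl.
rewrite big_ord_recl.
exact: (is_der_add (H ord0) (IH _ _ (fun i => H (lift ord0 i)))).
Qed.

End RowVectors.

Section Coordinates.
Context {R : realType}.

Lemma smooth_coord n (D : set 'rV[R]_n) (i : 'I_n) : open D ->
  smooth_on D (fun y : 'rV[R]_n => y 0 i).
Proof.
move=> oD; have @c : {linear 'rV[R]_n -> R}.
  by exists (fun N : 'rV[R]_n => N 0 i); do 2![eexists]; do ?[constructor];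
    rewrite ?mxE// => ? *; rewrite ?mxE//; move=> ?; rewrite !mxE.
by apply: (smooth_on_linear c) => //; exact: coord_continuous.
Qed.

Lemma is_der_coord n (i : 'I_n) (y z : 'rV[R]_n) :
  is_derive y z (fun y : 'rV[R]_n => y 0 i) (z 0 i).
Proof.
have @c : {linear 'rV[R]_n -> R}.
  by exists (fun N : 'rV[R]_n => N 0 i); do 2![eexists]; do ?[constructor];
    rewrite ?mxE// => ? *; rewrite ?mxE//; move=> ?; rewrite !mxE.
have := is_der_linear c y z; apply; exact: coord_continuous.
Qed.

End Coordinates.

Section Hessian.
Variables (R : realType) (m : nat) (O : set 'rV[R]_m) (h : 'rV[R]_m -> R).
Hypotheses (oO : open O) (sh : smooth_on O h).

Lemma derive_coord (x z : 'rV[R]_m) : O x ->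
  'D_z h x = \sum_i z 0 i * 'D_(delta_mx 0 i) h x.
Proof.
move=> Ox; rewrite {1}(row_sum_delta z) (derive_lincomb _ _ _ O) //.
- by move=> y v Oy; exact: Ck_on_derivable (sh 1) Oy.
- move=> y v Oy; exact: smooth_on_continuous (smooth_on_derive _ _ v sh) Oy.
Qed.

End Hessian.

Section HessianForm.
Variables (R : realType) (m : nat) (O : set 'rV[R]_m) (h : 'rV[R]_m -> R).
Hypotheses (oO : open O) (sh : smooth_on O h).

Lemma derive2_coord (x z u : 'rV[R]_m) : O x ->
  'D_u (fun y => 'D_z h y) x =
  \sum_i z 0 i * 'D_u (fun y => 'D_(delta_mx 0 i) h y) x.
Proof.
move=> Ox; have E : 'D_u (fun y => 'D_z h y) x =
    'D_u (fun y => \sum_i z 0 i * 'D_(delta_mx 0 i) h y) x.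
  apply: near_eq_derive; apply: filterS (open_nbhs_nbhs (conj oO Ox)) => y Oy.
  exact: (derive_coord _ _ O).
rewrite E; apply: derive_val; apply: is_der_sum => i.
have d := smooth_on_is_derive _ x u (smooth_on_derive _ _ (delta_mx 0 i) sh) Ox.
by apply: is_derive_eq (is_der_mul (is_der_cst _ _ (z 0 i)) d) _;
  rewrite mulr0 addr0.
Qed.

Lemma hessian_form (x z : 'rV[R]_m) : O x ->
  (z *m hessian h x *m z^T) 0 0 = 'D_z (fun y => 'D_z h y) x.
Proof.
move=> Ox; rewrite derive2_coord // mxE; apply: eq_bigr => j _.
rewrite [z^T _ _]mxE mulrC; congr (_ * _); rewrite mxE.
rewrite (derive_coord _ _ O) //; last exact: smooth_on_derive.
by apply: eq_bigr => i _; rewrite mxE.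
Qed.

Lemma hessian_sym (x : 'rV[R]_m) : O x -> (hessian h x)^T = hessian h x.
Proof.
move=> Ox; apply/matrixP => i j; rewrite !mxE.
exact: (schwarz _ _ O h x _ _ oO (sh 2) Ox).
Qed.

End HessianForm.

(** * Perspective of a convex function *)

Section Perspective.
Variable R : realType.

Lemma vec3E (a b c : R) :
  (vec3 a b c 0 0 = a) * (vec3 a b c 0 1 = b) * (vec3 a b c 0 2 = c).
Proof. by rewrite /vec3 !mxE. Qed.

Lemma forall_I3 (P : 'I_3 -> Prop) : (forall i, P i) <-> [/\ P 0, P 1 & P 2].
Proof.
split=> [H|[P0 P1 P2]]; first by split; exact: H.
case=> -[|[|[|//]]] i3.
- by rewrite (_ : Ordinal i3 = 0) //; apply: val_inj.
- by rewrite (_ : Ordinal i3 = 1) //; apply: val_inj.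
- by rewrite (_ : Ordinal i3 = 2) //; apply: val_inj.
Qed.

Lemma sum_I3 (F : 'I_3 -> R) : \sum_i F i = F 0 + F 1 + F 2.
Proof.
rewrite !big_ord_recl big_ord0 addr0 !addrA.
by congr (_ + _ + _); congr F; apply: val_inj.
Qed.

Definition perspective (y : 'rV[R]_3) : 'rV[R]_3 :=
  vec3 (y 0 0)^-1 (y 0 1 / y 0 0) (y 0 2 / y 0 0).

(** The differential of [perspective] at [y] in the direction [z], multiplied by [y 0 0]. *)
Let zeta (y z : 'rV[R]_3) : 'rV[R]_3 :=
  vec3 0 (z 0 1) (z 0 2) - z 0 0 *: perspective y.

Lemma perspectiveK (y : 'rV[R]_3) : y 0 0 != 0 -> perspective (perspective y) = y.
Proof.
move=> y0; apply/rowP; apply/forall_I3; rewrite /perspective !vec3E invrK.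
by split=> //; rewrite divfK.
Qed.

Let is_der_perspective (y z : 'rV[R]_3) : y 0 0 != 0 ->
  is_derive y z perspective ((y 0 0)^-1 *: zeta y z).
Proof.
move=> y0; have dI := is_der_inv y z (fun y => y 0 0) y0 (is_der_coord _ 0 y z).
have dQ i := is_der_mul (is_der_coord _ i y z) dI.
apply: is_der_rV; apply/forall_I3; rewrite /zeta /perspective !mxE /=.
have E0 : (fun y : 'rV[R]_3 => vec3 (y 0 0)^-1 (y 0 1 / y 0 0) (y 0 2 / y 0 0) 0 0) =
    (fun y => (y 0 0)^-1) by apply/funext => x; rewrite vec3E.
have E1 : (fun y : 'rV[R]_3 => vec3 (y 0 0)^-1 (y 0 1 / y 0 0) (y 0 2 / y 0 0) 0 1) =
    (fun y => y 0 1 / y 0 0) by apply/funext => x; rewrite vec3E.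
have E2 : (fun y : 'rV[R]_3 => vec3 (y 0 0)^-1 (y 0 1 / y 0 0) (y 0 2 / y 0 0) 0 2) =
    (fun y => y 0 2 / y 0 0) by apply/funext => x; rewrite vec3E.
rewrite E0 E1 E2; split.
- by apply: is_derive_eq dI _; move: (y 0 0) (z 0 0) y0 => a b a0; field.
- by apply: is_derive_eq (dQ 1) _;
    move: (y 0 0) (z 0 0) (y 0 1) (z 0 1) y0 => a b c d a0; field.
- by apply: is_derive_eq (dQ 2) _;
    move: (y 0 0) (z 0 0) (y 0 2) (z 0 2) y0 => a b c d a0; field.
Qed.

Let half : set 'rV[R]_3 := [set y : 'rV[R]_3 | 0 < y 0 0].

Let open_half : open half.
Proof.
have -> : half = (fun y : 'rV[R]_3 => y 0 0) @^-1` [set x | 0 < x] by [].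
by apply: open_comp; [move=> y _; exact: coord_continuous|exact: open_gt].
Qed.

Let smooth_perspective : smooth_on half perspective.
Proof.
have s0 : smooth_on half (fun y => (y 0 0)^-1).
  apply: smooth_on_inv => //; last exact: smooth_coord.
  by move=> y y0; rewrite gt_eqF.
have s i : smooth_on half (fun y => y 0 i / y 0 0).
  by apply: smooth_on_mul => //; exact: smooth_coord.
apply: smooth_on_rV => //; apply/forall_I3; split.
- by apply: smooth_on_ext s0 => // y _; rewrite vec3E.
- by apply: smooth_on_ext (s 1) => // y _; rewrite vec3E.
- by apply: smooth_on_ext (s 2) => // y _; rewrite vec3E.
Qed.

Variables (O : set 'rV[R]_3) (h : 'rV[R]_3 -> R).
Hypotheses (oO : open O) (sh : smooth_on O h).

Let O' : set 'rV[R]_3 := [set y : 'rV[R]_3 | 0 < y 0 0 /\ O (perspective y)].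
Let h' (y : 'rV[R]_3) : R := y 0 0 * h (perspective y).

Let half0 y : O' y -> y 0 0 != 0.
Proof. by case=> /gt_eqF ->. Qed.

Lemma open_perspective : open O'.
Proof.
rewrite openE => y [y0 Oy]; have cy : {for y, continuous perspective}.
  exact: smooth_on_continuous smooth_perspective _.
have n1 : nbhs y half by exact: (open_nbhs_nbhs (conj open_half y0)).
have n2 : nbhs y (perspective @^-1` O).
  by apply: cy; exact: (open_nbhs_nbhs (conj oO Oy)).
by apply: filterS2 n1 n2 => x.
Qed.

Let smooth_h_perspective (g : 'rV[R]_3 -> R) : smooth_on O g ->
  smooth_on O' (fun y => g (perspective y)).
Proof.
move=> sg; apply: (smooth_on_comp _ O) => //.
- exact: findim_rV.
- exact: open_perspective.
- by move=> y [].
- by apply: (smooth_on_sub _ _ _ half) smooth_perspective => y [].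
Qed.

Lemma smooth_on_perspective : smooth_on O' h'.
Proof.
apply: smooth_on_mul; first exact: open_perspective.
- by apply: smooth_coord; exact: open_perspective.
- exact: smooth_h_perspective.
Qed.

Let is_der_comp_perspective (g : 'rV[R]_3 -> R) y z : smooth_on O g -> O' y ->
  is_derive y z (fun y => g (perspective y))
    ((y 0 0)^-1 * 'D_(zeta y z) g (perspective y)).
Proof.
move=> sg Oy; have dg : differentiable g (perspective y).
  by apply: (smooth_on_differentiable _ _ O) Oy.2 => //; exact: findim_rV.
apply: is_derive_eq (is_der_comp _ _ _ _ dg (is_der_perspective y z (half0 _ Oy))) _.
have -> := derive_coord _ _ O g oO sg _ ((y 0 0)^-1 *: zeta y z) Oy.2.
have -> := derive_coord _ _ O g oO sg _ (zeta y z) Oy.2.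
by rewrite big_distrr /=; apply: eq_bigr => i _; rewrite [in LHS]mxE mulrA.
Qed.

Lemma derive_perspective y z : O' y ->
  'D_z h' y = z 0 0 * h (perspective y) + 'D_(zeta y z) h (perspective y).
Proof.
move=> Oy.
have D := is_der_mul (is_der_coord _ 0 y z) (is_der_comp_perspective h y z sh Oy).
have -> := derive_val (is_derive := D).
have y0 := half0 _ Oy.
by move: (h _) ('D_(zeta y z) h (perspective y)) => a b; field.
Qed.

(** The derivative of [zeta y z] along [z] is [- z 0 0 / y 0 0] times itself; the first-order terms
    in [h] therefore cancel, and only the second derivative of [h] along [zeta y z] remains. *)
Lemma derive2_perspective y z : O' y ->
  'D_z (fun y => 'D_z h' y) y =
  (y 0 0)^-1 * 'D_(zeta y z) (fun x => 'D_(zeta y z) h x) (perspective y).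
Proof.
move=> Oy; have Op := Oy.2.
have -> : 'D_z (fun y => 'D_z h' y) y = 'D_z (fun y => z 0 0 * h (perspective y) +
    \sum_i zeta y z 0 i * 'D_(delta_mx 0 i) h (perspective y)) y.
  apply: near_eq_derive; apply: filterS (open_nbhs_nbhs (conj open_perspective Oy)) => x Ox.
  rewrite derive_perspective //; congr (_ + _).
  by apply: derive_coord; [exact: oO|exact: sh|exact: Ox.2].
have dz i : is_derive y z (fun y => zeta y z 0 i) (- z 0 0 * ((y 0 0)^-1 * zeta y z 0 i)).
  have dp := is_der_perspective y z (half0 _ Oy).
  have dpi := is_der_comp _ _ _ _ (smooth_on_differentiable _ _ setT
    (fun y : 'rV[R]_3 => y 0 i) _ (findim_rV _ _) openT (smooth_coord _ _ i openT) I) dp.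
  have -> : (fun y => zeta y z 0 i) =
      (fun y => vec3 0 (z 0 1) (z 0 2) 0 i + - (z 0 0 * perspective y 0 i)).
    by apply/funext => x; rewrite !mxE.
  have D := is_der_add (is_der_cst y z (vec3 0 (z 0 1) (z 0 2) 0 i))
    (is_der_opp (is_der_mul (is_der_cst y z (z 0 0)) dpi)).
  apply: is_derive_eq D _.
  have -> := derive_val (is_derive :=
    is_der_coord _ i (perspective y) ((y 0 0)^-1 *: zeta y z)).
  by rewrite mulr0 addr0 add0r mulNr mxE.
have dh i := is_der_comp_perspective _ y z (smooth_on_derive _ _ (delta_mx 0 i) sh) Oy.
have D := is_der_add (is_der_mul (is_der_cst y z (z 0 0)) (is_der_comp_perspective h y z sh Oy))
  (is_der_sum _ _ _ _ _ _ _ (fun i => is_der_mul (dz i) (dh i))).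
have -> := derive_val (is_derive := D).
have -> := derive2_coord _ _ O h oO sh (perspective y) (zeta y z) (zeta y z) Op.
have -> := derive_coord _ _ O h oO sh (perspective y) (zeta y z) Op.
rewrite !sum_I3.
have gen (a b : 'I_3 -> R) (c y0 z0 : R) (t : 'I_3 -> R) : y0 != 0 ->
    z0 * (y0^-1 * (t 0 * a 0 + t 1 * a 1 + t 2 * a 2)) + c * 0 +
      (t 0 * (y0^-1 * b 0) + a 0 * (- z0 * (y0^-1 * t 0)) +
       (t 1 * (y0^-1 * b 1) + a 1 * (- z0 * (y0^-1 * t 1))) +
       (t 2 * (y0^-1 * b 2) + a 2 * (- z0 * (y0^-1 * t 2)))) =
    y0^-1 * (t 0 * b 0 + t 1 * b 1 + t 2 * b 2).
  by move=> y0n; field.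
exact: (gen (fun i => 'D_(delta_mx 0 i) h (perspective y))
  (fun i => 'D_(zeta y z) (fun x => 'D_(delta_mx 0 i) h x) (perspective y))
  _ _ _ (fun i => zeta y z 0 i) (half0 _ Oy)).
Qed.

Lemma zeta_neq0 (y z : 'rV[R]_3) : y 0 0 != 0 -> z != 0 -> zeta y z != 0.
Proof.
move=> y0; apply: contra => /eqP zz; have Z i : zeta y z 0 i = 0 by rewrite zz mxE.
have z0 : z 0 0 = 0.
  move: (Z 0); rewrite /zeta !mxE /= add0r => /eqP; rewrite oppr_eq0 mulf_eq0 invr_eq0.
  by rewrite (negbTE y0) orbF => /eqP.
apply/eqP/rowP; apply/forall_I3; rewrite !mxE; split=> //.
- by move: (Z 1); rewrite /zeta !mxE z0 /= mul0r subr0.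
- by move: (Z 2); rewrite /zeta !mxE z0 /= mul0r subr0.
Qed.

Lemma positive_definite_perspective y : O' y ->
  positive_definite (hessian h (perspective y)) -> positive_definite (hessian h' y).
Proof.
move=> Oy ph z z0; rewrite (hessian_form _ _ O') //.
- rewrite derive2_perspective // mulr_gt0 ?invr_gt0 ?Oy.1 //.
  rewrite -(hessian_form _ _ O) //; last exact: Oy.2.
  by apply: ph; apply: zeta_neq0 => //; exact: half0.
- exact: open_perspective.
- exact: smooth_on_perspective.
Qed.

End Perspective.

Section PerspectiveCoordinates.
Variable R : realType.

Lemma smooth_perspective_coord n (q : 'rV[R]_n -> 'rV[R]_3) (D : set 'rV[R]_n) :
  open D -> (forall x, D x -> q x 0 0 != 0) -> (forall j, smooth_on D (fun x => q x 0 j)) ->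
  forall j, smooth_on D (fun x => perspective R (q x) 0 j).
Proof.
move=> oD q0 sq; have sI : smooth_on D (fun x => (q x 0 0)^-1) by exact: smooth_on_inv.
apply/forall_I3; split.
- by apply: smooth_on_ext sI => // x Ox; rewrite vec3E.
- by apply: smooth_on_ext (smooth_on_mul _ _ _ _ _ oD (sq 1) sI) => // x Ox; rewrite vec3E.
- by apply: smooth_on_ext (smooth_on_mul _ _ _ _ _ oD (sq 2) sI) => // x Ox; rewrite vec3E.
Qed.

End PerspectiveCoordinates.

Section PerspectiveRank.
Variables (R : realType) (n : nat) (Om : set 'rV[R]_n) (q q' : 'rV[R]_n -> 'rV[R]_3).
Hypotheses (oOm : open Om) (sq : forall j, smooth_on Om (fun x => q x 0 j)).
Hypothesis q_gt0 : forall x, Om x -> 0 < q x 0 0.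
Hypothesis qq' : forall x, Om x -> q' x = perspective R (q x).

Let q_neq0 x : Om x -> q x 0 0 != 0.
Proof. by move=> /q_gt0 /gt_eqF ->. Qed.

Lemma rank_perspective p : Om p -> \rank (jacobian q' p) = \rank (jacobian q p).
Proof.
move=> Op; have y0 := q_neq0 p Op.
have dif (g : 'rV[R]_n -> R) : smooth_on Om g -> differentiable g p.
  by move=> sg; apply: (smooth_on_differentiable _ _ Om) => //; exact: findim_rV.
have sI : smooth_on Om (fun x => (q x 0 0)^-1) by exact: smooth_on_inv.
have sQ i : smooth_on Om (fun x => q x 0 i / q x 0 0) by exact: smooth_on_mul.
have e0 x : Om x -> q' x 0 0 = (q x 0 0)^-1 by move=> Ox; rewrite qq' // vec3E.
have e1 x : Om x -> q' x 0 1 = q x 0 1 / q x 0 0 by move=> Ox; rewrite qq' // vec3E.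
have e2 x : Om x -> q' x 0 2 = q x 0 2 / q x 0 0 by move=> Ox; rewrite qq' // vec3E.
have near (f g : 'rV[R]_n -> R) u : (forall x, Om x -> f x = g x) ->
    'D_u f p = 'D_u g p.
  by move=> fg; apply: near_eq_derive; apply: filterS (open_nbhs_nbhs (conj oOm Op)).
have sq' : forall j, smooth_on Om (fun x => q' x 0 j).
  apply/forall_I3; split.
  - by apply: smooth_on_ext sI => // x Ox; rewrite e0.
  - by apply: smooth_on_ext (sQ 1) => // x Ox; rewrite e1.
  - by apply: smooth_on_ext (sQ 2) => // x Ox; rewrite e2.
have dq i u := smooth_on_is_derive _ p u (sq i) Op.
have dI u := is_der_inv p u (fun x => q x 0 0) y0 (dq 0 u).
have dQ i u := is_der_mul (dq i u) (dI u).
have d0 u := etrans (near _ _ u e0) (derive_val (is_derive := dI u)).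
have d1 u := etrans (near _ _ u e1) (derive_val (is_derive := dQ 1 u)).
have d2 u := etrans (near _ _ u e2) (derive_val (is_derive := dQ 2 u)).
pose y i := q p 0 i.
pose cols3 (a b c : 'I_3 -> R) : 'M[R]_3 := \matrix_(i, j) [:: a i; b i; c i]`_j.
pose M := cols3 (fun i => [:: - (y 0 ^+ 2)^-1; 0; 0]`_i)
  (fun i => [:: - y 1 / y 0 ^+ 2; (y 0)^-1; 0]`_i)
  (fun i => [:: - y 2 / y 0 ^+ 2; 0; (y 0)^-1]`_i).
(* This is [M] at the image point, [perspective] being an involution. *)
pose M' := cols3 (fun i => [:: - y 0 ^+ 2; 0; 0]`_i)
  (fun i => [:: - (y 1 * y 0); y 0; 0]`_i) (fun i => [:: - (y 2 * y 0); 0; y 0]`_i).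
have MM : M *m M' = 1%:M.
  apply/matrixP => i j; rewrite !mxE sum_I3 !mxE /=; rewrite -/(y 0) in y0.
  move: (y 0) (y 1) (y 2) y0 => a b c a0.
  by move: i j; do 2 (apply/forall_I3; split); rewrite /= ?mulr0n ?mulr1n; field.
have -> : jacobian q' p = jacobian q p *m M.
  rewrite !jacobianE; [|by move=> j; exact: dif..].
  apply/matrixP => i; apply/forall_I3; rewrite !mxE !sum_I3 !mxE /= /y.
  have := d0 (delta_mx 0 i); have := d1 (delta_mx 0 i); have := d2 (delta_mx 0 i).
  move: ('D_(delta_mx 0 i) (fun x => q x 0 0) p) ('D_(delta_mx 0 i) (fun x => q x 0 1) p)
    ('D_(delta_mx 0 i) (fun x => q x 0 2) p) => a b c E2 E1 E0.
  by split; [apply: etrans E0 _|apply: etrans E1 _|apply: etrans E2 _];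
    move: (q p 0 0) (q p 0 1) (q p 0 2) y0 => x0 x1 x2 y0; field.
by apply: mxrankMfree; rewrite row_free_unit; exact: (mulmx1_unit MM).1.
Qed.

Lemma strictly_convex_perspective (f f' : 'rV[R]_n -> R) p : Om p ->
  (forall x, Om x -> f' x = f x / q x 0 0) ->
  strictly_convex_in q f p -> strictly_convex_in q' f' p.
Proof.
move=> Op ff' [rk [h [ O H]]]; have [oO Oq sh fh ph] := H.
have K x : Om x -> perspective R (q' x) = q x.
  by move=> Ox; rewrite qq' // perspectiveK //; exact: q_neq0.
have q'0 x : Om x -> q' x 0 0 = (q x 0 0)^-1 by move=> Ox; rewrite qq' // vec3E.
split; first by rewrite rank_perspective.
have Oq' : 0 < q' p 0 0 /\ O (perspective R (q' p)).
  by rewrite K // q'0 // invr_gt0 q_gt0.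
exists (fun y : 'rV[R]_3 => y 0 0 * h (perspective R y)).
exists [set y : 'rV[R]_3 | 0 < y 0 0 /\ O (perspective R y)]; split; [| | | |].
- exact: open_perspective.
- exact: Oq'.
- exact: smooth_on_perspective.
- apply: filterS2 fh (open_nbhs_nbhs (conj oOm Op)) => x fhx Ox.
  by rewrite ff' // fhx K // q'0 // mulrC.
- apply: (positive_definite_perspective _ _ _ oO sh _ Oq').
  by rewrite K.
Qed.

End PerspectiveRank.

(** * Symmetrizable systems *)

Section Symmetrizer.
Variables (R : realType) (n : nat).
Local Notation M := 'M[R]_n.+1.

Lemma positive_definite_unit (S : M) : positive_definite S -> S \in unitmx.
Proof.
move=> pS; rewrite -row_free_unit -kermx_eq0; apply/negPn/negP => /rowV0Pn[z].
move=> /sub_kermxP zS z0; have := pS z z0.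
by rewrite zS mul0mx mxE ltxx.
Qed.

(** The factor [N] cancels and the matrix becomes [- (Y^-T J S Y^T)], which is self-adjoint for the
    positive definite form [Y^-T S^-1 Y^-1]. This is the symmetrization of a system
    [d_t y = d_x (J grad eta)], with [S] the Hessian of [eta]. *)
Lemma diagonalizable_symmetrized (Y N S J : M) : Y \in unitmx -> N \in unitmx ->
  S^T = S -> positive_definite S -> J^T = J ->
  diagonalizable (invmx (Y *m N)^T *m (- (Y *m S *m J *m N))^T).
Proof.
move=> Yu Nu symS pS symJ; have Su := positive_definite_unit S pS.
have Ytu : Y^T \in unitmx by rewrite unitmx_tr.
have YNu : (Y *m N)^T \in unitmx by rewrite unitmx_tr unitmx_mul Yu.
have EX : invmx (Y *m N)^T *m (- (Y *m S *m J *m N))^T =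
    - (invmx Y^T *m J *m S *m Y^T).
  apply: (can_inj (mulKmx YNu)); rewrite mulKVmx //.
  rewrite mulmxN !trmx_mul linearN /= !trmx_mul symS symJ; congr (- _).
  by rewrite -!mulmxA mulKVmx.
rewrite EX; have symI : (invmx S)^T = invmx S by rewrite trmx_inv symS.
apply: (selfadjoint_diagonalizable _ _ _ (invmx Y^T *m invmx S *m invmx Y)).
- by rewrite !trmx_mul symI !trmx_inv trmxK mulmxA.
- move=> z z0; have := pS (z *m invmx Y^T *m invmx S).
  rewrite !trmx_mul symI !trmx_inv trmxK !mulmxA mulmxKV //.
  apply; apply: contra z0 => /eqP e; apply/eqP.
  have -> : z = z *m invmx Y^T *m invmx S *m S *m Y^T.
    by rewrite mulmxKV // mulmxKV.
  by rewrite e !mul0mx.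
- rewrite linearN /= !trmx_mul trmx_inv !trmxK symS symJ mulmxN mulNmx; congr (- _).
  by rewrite -!mulmxA mulKVmx // mulKmx // mulKmx // mulKVmx.
Qed.

End Symmetrizer.

(** * Hessian of a function of dependent variables *)

Section GradientHessian.
Variables (R : realType) (n m : nat) (D : set 'rV[R]_n) (O : set 'rV[R]_m).
Variables (q : 'rV[R]_n -> 'rV[R]_m) (f : 'rV[R]_n -> R) (h : 'rV[R]_m -> R).
Variable beta : 'I_m -> 'rV[R]_n -> R.
Hypotheses (oD : open D) (oO : open O) (DO : forall x, D x -> O (q x)).
Hypotheses (sq : forall j, smooth_on D (fun x => q x 0 j)) (sh : smooth_on O h).
Hypotheses (sb : forall j, smooth_on D (beta j)) (fh : forall x, D x -> f x = h (q x)).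
Hypothesis df : forall x u, D x -> 'D_u f x = \sum_i beta i x * 'D_u (fun y => q y 0 i) x.

Lemma full_rank_eq0 (J : 'M[R]_(n, m)) (c : 'I_m -> R) : \rank J = m ->
  (forall i, \sum_j c j * J i j = 0) -> forall j, c j = 0.
Proof.
move=> rJ cJ j; have : row_free J^T by rewrite /row_free mxrank_tr rJ.
move=> /row_free_inj inj; have : (\row_j c j) = 0 :> 'rV[R]_m.
  apply: inj; rewrite mul0mx; apply/rowP => i; rewrite !mxE -[RHS](cJ i).
  by apply: eq_bigr => l _; rewrite !mxE.
by move=> /rowP/(_ j); rewrite !mxE.
Qed.

Lemma derive_chain (g : 'rV[R]_m -> R) x u : smooth_on O g -> D x ->
  is_derive x u (fun y => g (q y))
    (\sum_i 'D_u (fun y => q y 0 i) x * 'D_(delta_mx 0 i) g (q x)).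
Proof.
move=> sg Dx; have Ox := DO x Dx.
have dg : differentiable g (q x).
  by apply: (smooth_on_differentiable _ _ O) => //; exact: findim_rV.
have dq : is_derive x u q (\row_i 'D_u (fun y => q y 0 i) x).
  apply: is_der_rV => i; rewrite mxE; exact: smooth_on_is_derive (sq i) Dx.
apply: is_derive_eq (is_der_comp _ _ _ _ dg dq) _.
have -> := derive_coord _ _ O g oO sg (q x) (\row_i 'D_u (fun y => q y 0 i) x) Ox.
by apply: eq_bigr => i _; rewrite mxE.
Qed.

Variable p : 'rV[R]_n.
Hypotheses (Dp : D p) (rk : \rank (jacobian q p) = m).

Let jac i j : jacobian q p i j = 'D_(delta_mx 0 i) (fun y => q y 0 j) p.
Proof.
rewrite jacobianE ?mxE // => l.
by apply: (smooth_on_differentiable _ _ D) => //; exact: findim_rV.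
Qed.

Let gam i x := 'D_(delta_mx 0 i) h (q x) + - beta i x.

Let gam0 x u : D x -> \sum_i gam i x * 'D_u (fun y => q y 0 i) x = 0.
Proof.
move=> Dx; have E := derive_val (is_derive := derive_chain h x u sh Dx).
have E' : 'D_u f x = 'D_u (fun y => h (q y)) x.
  by apply: near_eq_derive; apply: filterS (open_nbhs_nbhs (conj oD Dx)).
have := df x u Dx; rewrite E' E => H.
transitivity (\sum_i 'D_u (fun y => q y 0 i) x * 'D_(delta_mx 0 i) h (q x)
    - \sum_i beta i x * 'D_u (fun y => q y 0 i) x); last by rewrite H subrr.
by rewrite -sumrB; apply: eq_bigr => i _; rewrite /gam mulrDl mulNr [X in X + _]mulrC.
Qed.

(** Here [gam] is the difference between the gradient of [h] and [beta], and [\sum_i gam i dq_i = 0]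
    on [D]. The rank is known at [p] only: it gives [gam = 0] at [p], which removes the second
    derivatives of [q] once the relation is differentiated, and then gives [d gam = 0] at [p]. *)
Lemma gradient_hessian u i :
  'D_u (beta i) p = \sum_j 'D_u (fun y => q y 0 j) p * hessian h (q p) j i.
Proof.
have gp j : gam j p = 0.
  apply: (full_rank_eq0 _ (fun j => gam j p) rk) => l.
  by rewrite -[RHS](gam0 p (delta_mx 0 l) Dp); apply: eq_bigr => l' _; rewrite jac.
have dgam j : is_derive p u (gam j)
    (\sum_l 'D_u (fun y => q y 0 l) p * hessian h (q p) l j + - 'D_u (beta j) p).
  apply: is_der_add; last by apply: is_der_opp; exact: smooth_on_is_derive (sb j) Dp.
  apply: is_derive_eq (derive_chain _ p u (smooth_on_derive _ _ (delta_mx 0 j) sh) Dp) _.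
  by apply: eq_bigr => l _; rewrite mxE.
have dgp j : 'D_u (gam j) p = 0.
  apply: (full_rank_eq0 _ (fun j => 'D_u (gam j) p) rk) => l.
  have dq j' := smooth_on_is_derive _ p u
    (smooth_on_derive _ _ (delta_mx 0 l) (sq j')) Dp.
  have DS := is_der_sum _ _ _ _ _ _ _ (fun j' => is_der_mul (dgam j') (dq j')).
  have Z : 'D_u (fun x => \sum_i gam i x * 'D_(delta_mx 0 l) (fun y => q y 0 i) x) p = 0.
    apply: etrans (derive_cst (0 : R) p u); apply: near_eq_derive.
    apply: filterS (open_nbhs_nbhs (conj oD Dp)) => x Dx; exact: gam0.
  move: Z; have -> := derive_val (is_derive := DS) => Z; rewrite -[RHS]Z.
  apply: eq_bigr => j' _; rewrite gp mul0r add0r jac mulrC; congr (_ * _).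
  exact: (derive_val (is_derive := dgam j')).
have := dgp i; have -> := derive_val (is_derive := dgam i).
by move/eqP; rewrite subr_eq0 => /eqP ->.
Qed.

End GradientHessian.

(** * The modulated Euler-Korteweg systems *)

Section EulerKorteweg.
Variables (R : realType) (eps : R -> R -> R) (Om : set 'rV[R]_4).
Variables (K : 'rV[R]_4 -> R) (Rho U : 'rV[R]_4 -> R -> R).
Variables (k : 'rV[R]_4 -> R) (V W : 'rV[R]_4 -> R -> R).
Hypotheses (seps : smooth_energy eps) (oOm : open Om).
Hypothesis EP : eulerian_profiles eps K Rho U Om.
Hypothesis LP : lagrangian_profiles eps k V W Om.
Hypothesis CP : corresponding_profiles Om K Rho U k V W.

Section Profiles.

(** This and the next definitions are the counterparts of [k_dv0], [eps0], [epsvy0] and [p0] in the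
    phase before rescaling, with [profile_A] as an ingredient of the last; they are smooth jointly
    in parameter and phase. *)
Definition profile_dV p x := derive1 (V p) x.
Definition profile_E p x := eps (V p x) (profile_dV p x).
Definition profile_A p x := partial1 eps (V p x) (profile_dV p x).
Definition profile_B p x := partial2 eps (V p x) (profile_dV p x).
Definition profile_P p x := - profile_A p x + derive1 (profile_B p) x.

Local Notation dV := profile_dV.
Local Notation E := profile_E.
Local Notation A := profile_A.
Local Notation B := profile_B.
Local Notation P := profile_P.
Local Notation T := (Om `*` [set: R]).
Local Notation smooth2 f := (smooth_on T (fun z => f z.1 z.2)).

Let oT : open T. Proof. exact: open_cylinder. Qed.

Lemma smooth_dV : smooth2 dV.
Proof. by apply: smooth_on_derive1 => //; exact: V_smooth LP. Qed.

Lemma smooth_half_plane (g : R -> R -> R) :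
  smooth_on (@half_plane R) (fun z => g z.1 z.2) ->
  smooth2 (fun p x => g (V p x) (dV p x)).
Proof.
move=> sg; apply: (smooth_on_half_plane_comp _ _ T g (fun z => V z.1 z.2)
  (fun z => dV z.1 z.2)) => //.
- by move=> [p x] [/= Op _]; exact: (V_gt0 LP).
- exact: V_smooth LP.
- exact: smooth_dV.
Qed.

Lemma smooth_A : smooth2 A.
Proof. by apply: smooth_half_plane; exact: smooth_on_partial1. Qed.
Lemma smooth_B : smooth2 B.
Proof. by apply: smooth_half_plane; exact: smooth_on_partial2. Qed.
Lemma smooth_E : smooth2 E.
Proof. exact: smooth_half_plane. Qed.
Lemma smooth_P : smooth2 P.
Proof.
apply: smooth_on_add; [exact: oT| |].
  by apply: smooth_on_opp; [exact: oT|exact: smooth_A].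
by apply: (smooth_on_derive1 _ _ _ B) => //; exact: smooth_B.
Qed.

Lemma smooth_fiber (f : 'rV[R]_4 -> R -> R) p : Om p -> smooth2 f ->
  smooth_on [set: R] (f p).
Proof.
move=> Op sf; apply: (smooth_on_comp _ T (fun x : R => (p, x))
  (fun z => f z.1 z.2)) => //.
- by apply: findim_pair; [exact: findim_rV|exact: findim_R].
- exact: openT.
- apply: smooth_on_pair; [exact: openT|apply: smooth_on_cst; exact: openT|].
  by apply: (smooth_on_linear (idfun : {linear R -> R}));
    [exact: openT|move=> x; exact: cvg_id].
Qed.

Lemma k_dv0E p t : Om p -> k_dv0 k V p t = dV p (t / k p).
Proof.
move=> Op; rewrite /k_dv0 /v0 derive1_scale.
  by rewrite mulrC divfK // gt_eqF // (k_gt0 LP).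
exact: Ck_on_derivable (smooth_fiber V p Op (V_smooth LP) 1) I.
Qed.

Lemma eps0E p t : Om p -> eps0 eps k V p t = E p (t / k p).
Proof. by move=> Op; rewrite /eps0 k_dv0E. Qed.

Lemma epsvy0E p t : Om p -> epsvy0 eps k V p t = B p (t / k p).
Proof. by move=> Op; rewrite /epsvy0 k_dv0E. Qed.

Lemma p0E p t : Om p -> p0 eps k V p t = P p (t / k p).
Proof.
move=> Op; rewrite /p0 k_dv0E //; congr (_ + _).
have -> : epsvy0 eps k V p = (fun s => B p (s / k p)).
  by apply/funext => s; exact: epsvy0E.
have dB : derivable (B p) (t / k p) 1.
  exact: Ck_on_derivable (smooth_fiber B p Op smooth_B 1) I.
have kn : k p != 0 by rewrite gt_eqF // (k_gt0 LP).
transitivity (k p * (derive1 (B p) (t / k p) / k p)).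
  by congr (_ * _); exact: derive1_scale R (B p) (k p) t dB.
by move: (derive1 _ _) => b; rewrite mulrC divfK.
Qed.

(* A constant profile may satisfy the first-order equation without satisfying the
   Euler-Lagrange equation with the multiplier lambda, whence the alternative. *)
Lemma flux_constants p : Om p -> exists c d : R,
  [/\ forall x, P p x = c - par_j p ^+ 2 * V p x,
      forall x, E p x + V p x * P p x - dV p x * B p x =
                d - par_j p ^+ 2 * V p x ^+ 2 / 2
    & (c = - par_lambda p /\ d = par_mu p) \/ forall x, dV p x = 0].
Proof.
move=> Op; have sVp := smooth_fiber V p Op (V_smooth LP).
have V0 x : 0 < V p x by exact: (V_gt0 LP).
have ode x := lagr_ode LP x Op.
have [c [cP ccase]] := momentum_flux_constant _ _ _ _ _ _ seps sVp V0 ode.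
have PE x : P p x = c - par_j p ^+ 2 * V p x by rewrite -(cP x) addrK.
have GE x : E p x + V p x * P p x - dV p x * B p x =
    par_mu p + (par_lambda p + c) * V p x - par_j p ^+ 2 * V p x ^+ 2 / 2.
  have o := ode x; rewrite -/(dV p x) -/(E p x) -/(B p x) in o.
  by rewrite PE -[par_mu p]opprK -o; field.
case: ccase => [cl|dV0].
  exists c, (par_mu p); split=> //; last by left.
  by move=> x; rewrite GE cl subrr mul0r addr0.
(* For a constant profile the term linear in [V] is itself a constant and is absorbed into [d]. *)
exists c, (par_mu p + (par_lambda p + c) * V p 0); split => //; last by right.
move=> x; rewrite GE; congr (_ + _ - _); congr (_ * _).
apply: (@is_derive_0_is_cst R (V p) x 0) => y.
by rewrite -(dV0 y); exact: is_derive_smoothR.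
Qed.

Lemma smooth_on_base (f : 'rV[R]_4 -> R) : smooth_on Om f -> smooth2 (fun p _ => f p).
Proof.
move=> sf; apply: (smooth_on_comp T Om (fun z => z.1) f) => //.
- exact: findim_rV.
- by move=> z [].
- by apply: (smooth_on_linear (fst : {linear ('rV[R]_4 * R)%type -> 'rV[R]_4}));
    [|move=> z; exact: cvg_fst].
Qed.

Lemma smooth_rescaled (f : 'rV[R]_4 -> R -> R) : smooth2 f ->
  smooth2 (fun p t => f p (t / k p)).
Proof.
move=> sf; apply: (smooth_on_comp T T (fun z => (z.1, z.2 / k z.1))
  (fun z => f z.1 z.2)) => //.
- by apply: findim_pair; [exact: findim_rV|exact: findim_R].
- have s1 : smooth_on T (fun z => z.1).
    by apply: (smooth_on_linear (fst : {linear ('rV[R]_4 * R)%type -> 'rV[R]_4}));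
      [|move=> z; exact: cvg_fst].
  have s2 : smooth_on T (fun z => z.2).
    by apply: (smooth_on_linear (snd : {linear ('rV[R]_4 * R)%type -> R}));
      [|move=> z; exact: cvg_snd].
  apply: smooth_on_pair => //; apply: smooth_on_mul => //.
  apply: smooth_on_inv => //; first by move=> [p x] [/= Op _]; by rewrite gt_eqF // (k_gt0 LP).
  exact: smooth_on_base (k_smooth LP).
Qed.

Lemma lag_mean_smooth (f : 'rV[R]_4 -> R -> R) : smooth2 f ->
  smooth_on Om (fun p => mean (fun t => f p (t / k p))).
Proof.
move=> sf; apply: (smooth_on_mean _ _ Om T (fun z => f z.1 (z.2 / k z.1))) => //.
exact: smooth_rescaled.
Qed.

Lemma lag_cont (f : 'rV[R]_4 -> R -> R) p : Om p -> smooth2 f ->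
  continuous01 R (fun t => f p (t / k p)).
Proof.
move=> Op sf t _.
apply: (@continuous_comp _ _ _ (fun t : R => t / k p) (f p)).
  by apply: cvgMl; exact: cvg_id.
by apply: smooth_on_continuous (smooth_fiber f p Op sf) _.
Qed.

End Profiles.

(** * Eulerian means in terms of Lagrangian ones *)

Section Correspondence.

Local Notation dV := profile_dV.
Local Notation E := profile_E.
Local Notation A := profile_A.
Local Notation B := profile_B.
Local Notation P := profile_P.
Local Notation T := (Om `*` [set: R]).
Local Notation smooth2 f := (smooth_on T (fun z => f z.1 z.2)).

Section Pointwise.
Variables (p : 'rV[R]_4) (Z : R -> R).
Hypotheses (Op : Om p) (dZ : forall x : R, is_derive x (1 : R) Z (Rho p x)).
Hypothesis RhoV : forall x, Rho p x * V p (Z x) = 1.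
Hypothesis UW : forall x, U p x = W p (Z x).

Let V0 x : 0 < V p x. Proof. exact: (V_gt0 LP). Qed.
Let Vn x : V p x != 0. Proof. by rewrite gt_eqF. Qed.
Let sV : smooth_on [set: R] (V p).
Proof. exact: smooth_fiber _ _ Op (V_smooth LP). Qed.
Let sB : smooth_on [set: R] (B p).
Proof. exact: smooth_fiber _ _ Op (smooth_B). Qed.

Lemma RhoE x : Rho p x = (V p (Z x))^-1.
Proof. by apply: (mulIf (Vn (Z x))); rewrite RhoV mulVf. Qed.

Lemma is_derive_comp_Z (f : R -> R) x : smooth_on [set: R] f ->
  is_derive x (1 : R) (fun y => f (Z y)) (derive1 f (Z x) / V p (Z x)).
Proof.
move=> sf; have df := is_derive_smoothR R f (Z x) sf.
have dff : differentiable f (Z x) by apply/derivable1_diffP; have [] := df.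
have H := is_der_comp f Z _ _ dff (dZ x).
have e := derive_val (is_derive :=
  deriveZr _ _ _ f (Z x) 1 (Rho p x) (ex_derive (is_derive := df))).
rewrite (_ : Rho p x *: (1 : R) = Rho p x) in e; last exact: mulr1.
by rewrite e -derive1E RhoE [_ *: _]mulrC in H.
Qed.

Lemma derive1_Rho x : derive1 (Rho p) x = - dV p (Z x) / V p (Z x) ^+ 3.
Proof.
have -> : Rho p = (fun y => (V p (Z y))^-1) by apply/funext => y; exact: RhoE.
have H := is_der_inv _ _ _ (Vn (Z x)) (is_derive_comp_Z (V p) x sV).
rewrite derive1E (derive_val (is_derive := H)) -/(dV p (Z x)).
by move: (Vn (Z x)) (dV p (Z x)) => vn d; field.
Qed.

Lemma rho0E t : rho0 K Rho p t = (V p (Z (t / K p)))^-1.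
Proof. exact: RhoE. Qed.

Lemma u0E t : u0 K U p t = par_sigma p + par_j p * V p (Z (t / K p)).
Proof. by rewrite /u0 UW -(lagr_mass LP (Z (t / K p)) Op) subrK. Qed.

Lemma K_drho0E t :
  K_drho0 K Rho p t = - dV p (Z (t / K p)) / V p (Z (t / K p)) ^+ 3.
Proof.
have Kn : K p != 0 by rewrite gt_eqF // (K_gt0 EP).
have dRho : derivable (Rho p) (t / K p) 1.
  exact: Ck_on_derivable (smooth_fiber Rho p Op (Rho_smooth EP) 1) I.
rewrite -derive1_Rho; transitivity (K p * (derive1 (Rho p) (t / K p) / K p)).
  by congr (_ * _); exact: derive1_scale R (Rho p) (K p) t dRho.
by move: (derive1 _ _) => b; rewrite mulrC divfK.
Qed.

Let invE t : (rho0 K Rho p t)^-1 = V p (Z (t / K p)).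
Proof. by rewrite rho0E invrK. Qed.

Let slopeE t : - K_drho0 K Rho p t / rho0 K Rho p t ^+ 3 = dV p (Z (t / K p)).
Proof.
rewrite rho0E K_drho0E.
by move: (Vn (Z (t / K p))) (dV p (Z (t / K p))) => vn d; field.
Qed.

Let rho0_gt0 t : 0 < rho0 K Rho p t.
Proof. exact: (Rho_gt0 EP). Qed.

Lemma E0E t : E0 eps K Rho p t = E p (Z (t / K p)) / V p (Z (t / K p)).
Proof. by rewrite /E0 /Een invE slopeE rho0E mulrC. Qed.

Lemma Erhox0E t : Erhox0 eps K Rho p t =
  - (V p (Z (t / K p)) ^+ 2 * B p (Z (t / K p))).
Proof.
rewrite /Erhox0 partial2_Een // invE slopeE rho0E -/(B p (Z (t / K p))).
by move: (Vn (Z (t / K p))) (B p (Z (t / K p))) => vn b; field.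
Qed.

(** Capillary form of a thermodynamic identity: the Eulerian chemical potential is the specific
    energy plus pressure times specific volume, minus [v_y] times the derivative of [eps] in
    [v_y]. *)
Lemma g0E t : g0 eps K Rho p t = E p (Z (t / K p)) +
  V p (Z (t / K p)) * P p (Z (t / K p)) - dV p (Z (t / K p)) * B p (Z (t / K p)).
Proof.
have Kn : K p != 0 by rewrite gt_eqF // (K_gt0 EP).
rewrite /g0 partial1_Een // invE slopeE.
have -> : Erhox0 eps K Rho p = (fun s => - (V p (Z (s / K p)) ^+ 2 * B p (Z (s / K p)))).
  by apply/funext => s; exact: Erhox0E.
have H := is_derive_scale R _ (K p) t _ (is_der_opp (is_der_mul
  (is_der_exp 1 (is_derive_comp_Z (V p) (t / K p) sV))
  (is_derive_comp_Z (B p) (t / K p) sB))).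
rewrite derive1E (derive_val (is_derive := H)) rho0E K_drho0E.
rewrite -/(dV p (Z (t / K p))) /P -/(E p (Z (t / K p))) -/(A p (Z (t / K p)))
  -/(B p (Z (t / K p))).
move: (Vn (Z (t / K p))) (B p (Z (t / K p))) (dV p (Z (t / K p)))
  (E p (Z (t / K p))) (A p (Z (t / K p))) (derive1 (B p) (Z (t / K p))) => vn b d e a db.
by field; rewrite vn Kn.
Qed.

End Pointwise.

Lemma smooth_V : smooth2 V. Proof. exact: V_smooth LP. Qed.
Let sB := smooth_B.
Let sE := smooth_E.
Let sP := smooth_P.
Let sdV := smooth_dV.

Definition mean_pow n p : R := mean (fun t => V p (t / k p) ^+ n).

Section Means.
Variable p : 'rV[R]_4.
Hypothesis Op : Om p.

Let cVn n : continuous01 R (fun t => V p (t / k p) ^+ n).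
Proof.
apply: (lag_cont (fun p x => V p x ^+ n) p Op).
by apply: smooth_on_exp; [exact: open_cylinder|exact: smooth_V].
Qed.

Let cadd f g : continuous01 R f -> continuous01 R g ->
  continuous01 R (fun t => f t + g t).
Proof. by move=> cf cg t t01; apply: cvgD; [exact: cf|exact: cg]. Qed.

Let cscale a f : continuous01 R f -> continuous01 R (fun t => a * f t).
Proof. by move=> cf t t01; apply: cvgM; [exact: cvg_cst|exact: cf]. Qed.

Let ccst a : continuous01 R (fun=> a).
Proof. by move=> t _; exact: cvg_cst. Qed.

(** Apart from those of [eps0] and [E0] alone, the means all reduce to integrals of such cubics in
    [V], with an additional factor [V^-1] on the Eulerian side. *)
Let poly3 (b0 b1 b2 b3 x : R) := b0 + b1 * x ^+ 1 + b2 * x ^+ 2 + b3 * x ^+ 3.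

Lemma mean_poly3 b0 b1 b2 b3 : mean (fun t => poly3 b0 b1 b2 b3 (V p (t / k p))) =
  b0 + b1 * mean_pow 1 p + b2 * mean_pow 2 p + b3 * mean_pow 3 p.
Proof.
rewrite /poly3 (meanD R (fun t => b0 + b1 * V p (t / k p) ^+ 1 +
  b2 * V p (t / k p) ^+ 2) (fun t => b3 * V p (t / k p) ^+ 3));
  [|by do ?[apply: cadd|exact: cscale|exact: ccst]|exact: cscale].
rewrite (meanD R (fun t => b0 + b1 * V p (t / k p) ^+ 1)
  (fun t => b2 * V p (t / k p) ^+ 2));
  [|by do ?[apply: cadd|exact: cscale|exact: ccst]|exact: cscale].
rewrite (meanD R (fun=> b0) (fun t => b1 * V p (t / k p) ^+ 1));
  [|exact: ccst|exact: cscale].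
by rewrite mean_cst !meanZ.
Qed.

Let sVp : smooth_on [set: R] (V p).
Proof. exact: smooth_fiber _ _ Op (V_smooth LP). Qed.

Let cV : continuous (V p).
Proof. by move=> x; exact: smooth_on_continuous sVp _. Qed.

Let cpoly3 b0 b1 b2 b3 : continuous (fun x => poly3 b0 b1 b2 b3 (V p x)).
Proof.
have cX n : continuous (fun x => V p x ^+ n).
  elim: n => [|n IH] x; first exact: cvg_cst.
  under eq_fun do rewrite exprS.
  by apply: cvgM; [exact: cV|exact: IH].
move=> x; do ?apply: cvgD; do ?[exact: cvg_cst|apply: cvgM; [exact: cvg_cst|exact: cX]].
Qed.

Let Kk_mean Z (F : R -> R) :
  Z 0 = 0 -> (forall x : R, is_derive x (1 : R) Z (Rho p x)) ->
  (forall x, Rho p x * V p (Z x) = 1) -> (k p)^-1 = Z (K p)^-1 ->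
  continuous F ->
  mean (fun t => (V p (Z (t / K p)))^-1 * F (Z (t / K p))) =
  K p / k p * mean (fun t => F (t / k p)).
Proof.
move=> Z0 dZ RV kK cF; apply: (mean_mass_coordinate _ Z (Rho p) (V p)) => //.
- exact: (K_gt0 EP).
- exact: (k_gt0 LP).
- by move=> x; exact: (Rho_gt0 EP).
- move=> x; apply: smooth_on_continuous (smooth_fiber Rho p Op (Rho_smooth EP)) _.
  by [].
Qed.

(** Pointwise, [U] and [W] are affine in [V], and [flux_constants] makes the pressure and the
    chemical potential polynomials in [V]; [mean_mass_coordinate] then carries the Eulerian means to
    the Lagrangian phase. *)
Lemma mean_dictionary : exists c d : R,
  let m1 := mean_pow 1 p in let m2 := mean_pow 2 p in
  let s := par_sigma p in let j := par_j p in
  [/\ (c = - par_lambda p /\ d = par_mu p) \/ (forall x, dV p x = 0),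
      0 < m1 /\ K p = k p / m1,
      [/\ mean_v k V p = m1, mean_w k W p = s + j * m1,
          mean_vw k V W p = s * m1 + j * m2,
          mean (fun t => w0 k W p t ^+ 2) = s ^+ 2 + 2 * s * j * m1 + j ^+ 2 * m2 &
          FL eps k V W p = vec4 (- (j * k p)) (- (s + j * m1)) (c - j ^+ 2 * m1)
            (d - s ^+ 2 / 2 - s * j * m1 - j ^+ 2 * m2)],
      [/\ mean_rho K Rho p = m1^-1, mean_rhou K Rho U p = (s + j * m1) / m1,
          mean_u K U p = (s * m1 + j * m2) / m1,
          mean (fun t => rho0 K Rho p t * u0 K U p t ^+ 2) =
            (s ^+ 2 + 2 * s * j * m1 + j ^+ 2 * m2) / m1 &
          mean (E0 eps K Rho p) = mean (eps0 eps k V p) / m1] &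
      FE eps K Rho U p = vec4 (s * K p) ((s + j * m1) / m1)
        (s ^+ 2 / 2 + s * j * m2 / m1 + d)
        ((s ^+ 2 + 2 * s * j * m1) / m1 + c)].
Proof.
have [Z [Z0 dZ RV UW kK]] := CP p Op.
have [c [d [PE GE cd]]] := flux_constants p Op.
exists c, d; set m1 := mean_pow 1 p; set m2 := mean_pow 2 p; set m3 := mean_pow 3 p.
cbv zeta; set s := par_sigma p; set j := par_j p.
have k0 : 0 < k p by exact: (k_gt0 LP).
have K0 : 0 < K p by exact: (K_gt0 EP).
have kn : k p != 0 by rewrite gt_eqF.
have Kn : K p != 0 by rewrite gt_eqF.
have Vn x : V p x != 0 by rewrite gt_eqF // (V_gt0 LP).
have WE x : W p x = s + j * V p x by rewrite /s -(lagr_mass LP x Op) subrK.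
have KM F := Kk_mean Z F Z0 dZ RV kK.
have Lm f b0 b1 b2 b3 : (forall t, f t = poly3 b0 b1 b2 b3 (V p (t / k p))) ->
    mean f = b0 + b1 * m1 + b2 * m2 + b3 * m3.
  by move=> fE; rewrite -mean_poly3; apply: eq_mean => t _; exact: fE.
have Em f b0 b1 b2 b3 : (forall t, f t = (V p (Z (t / K p)))^-1 *
      poly3 b0 b1 b2 b3 (V p (Z (t / K p)))) ->
    mean f = K p / k p * (b0 + b1 * m1 + b2 * m2 + b3 * m3).
  move=> fE; rewrite -mean_poly3 -(KM (fun x => poly3 b0 b1 b2 b3 (V p x))) //.
  by apply: eq_mean => t _; exact: fE.
have one : K p / k p * m1 = 1.
  have H : mean (fun=> 1) = K p / k p * (0 + 1 * m1 + 0 * m2 + 0 * m3).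
    by apply: Em => t; rewrite /poly3 !mul0r !addr0 add0r mul1r expr1 mulVf.
  by rewrite mean_cst in H; rewrite [RHS]H; ring.
have m10 : 0 < m1.
  by rewrite -(pmulr_rgt0 _ (divr_gt0 K0 k0)) one.
have mn : m1 != 0 by rewrite gt_eqF.
have Kk : K p / k p = m1^-1 by apply: (mulIf mn); rewrite one mulVf.
have KE : K p = k p / m1 by rewrite -Kk; field.
have rE := rho0E p Z Op RV.
have uE := u0E p Z Op UW; rewrite -/s -/j in uE.
have eE := E0E p Z Op dZ RV.
have gE := g0E p Z Op dZ RV.
have qE := K_drho0E p Z Op dZ RV.
have xE := Erhox0E p Z Op dZ RV.
have mrhou : mean_rhou K Rho U p = (s + j * m1) / m1.
  rewrite /mean_rhou (Em _ s j 0 0); first by rewrite Kk; ring.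
  by move=> t; rewrite rE uE /poly3; ring.
split => //.
- split.
  + by rewrite /mean_v (Lm _ 0 1 0 0) ?/poly3; [ring|move=> t; rewrite /v0 /poly3; ring].
  + by rewrite /mean_w (Lm _ s j 0 0); [ring|move=> t; rewrite /w0 WE /poly3; ring].
  + by rewrite /mean_vw (Lm _ 0 s j 0); [ring|move=> t; rewrite /v0 /w0 WE /poly3; ring].
  + by rewrite (Lm _ (s ^+ 2) (2 * s * j) (j ^+ 2) 0); [ring|move=> t; rewrite /w0 WE /poly3; ring].
  + rewrite /FL /mean_w (Lm (w0 k W p) s j 0 0); last by move=> t; rewrite /w0 WE /poly3; ring.
    rewrite (Lm (p0 eps k V p) c (- j ^+ 2) 0 0); last first.
      by move=> t; rewrite p0E // PE -/j /poly3; ring.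
    rewrite (Lm _ (d - s ^+ 2 / 2) (- s * j) (- j ^+ 2) 0); last first.
      move=> t; rewrite p0E // eps0E //.
      rewrite epsvy0E // k_dv0E //.
      rewrite /v0 /w0 WE; have := GE (t / k p); rewrite -/j.
      move: (V p (t / k p)) (P p _) (E p _) (dV p _) (B p _) => v q e v' b G.
      have -> : e = d - j ^+ 2 * v ^+ 2 / 2 - v * q + v' * b by rewrite -G; ring.
      by rewrite /poly3; field.
    by congr vec4; ring.
- split.
  + rewrite /mean_rho (Em _ 1 0 0 0); first by rewrite Kk; ring.
    by move=> t; rewrite rE /poly3; ring.
  + exact: mrhou.
  + rewrite /mean_u (Em _ 0 s j 0); first by rewrite Kk; ring.
    by move=> t; rewrite uE /poly3; move: (Vn (Z (t / K p))) => vn; field.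
  + rewrite (Em _ (s ^+ 2) (2 * s * j) (j ^+ 2) 0); first by rewrite Kk; ring.
    by move=> t; rewrite uE rE /poly3; ring.
  + have -> : mean (E0 eps K Rho p) =
        mean (fun t => (V p (Z (t / K p)))^-1 * E p (Z (t / K p))).
      by apply: eq_mean => t _; rewrite eE mulrC.
    rewrite KM; last first.
      move=> x; apply: smooth_on_continuous (smooth_fiber E p Op sE) _.
      by [].
    rewrite Kk mulrC; congr (_ / _); apply: eq_mean => t _.
    by rewrite (eps0E).
(* The terms in the mean of [V ^+ 3] cancel between [u0 ^+ 2 / 2] and [g0]. *)
- rewrite /FE mrhou.
  rewrite (Em (fun t => u0 K U p t ^+ 2 / 2) 0 (s ^+ 2 / 2) (s * j) (j ^+ 2 / 2)); last first.
    by move=> t; rewrite uE /poly3; move: (Vn (Z (t / K p))) => vn; field.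
  rewrite (Em (g0 eps K Rho p) 0 d 0 (- j ^+ 2 / 2)); last first.
    by move=> t; rewrite gE GE -/j /poly3; move: (Vn (Z (t / K p))) => vn; field.
  rewrite (Em _ (s ^+ 2) (2 * s * j + c) 0 0); last first.
    move=> t; rewrite uE rE gE eE qE xE PE -/j /poly3.
    move: (Vn (Z (t / K p))) (B p (Z (t / K p))) (dV p (Z (t / K p)))
      (E p (Z (t / K p))) => vn b v' e.
    by field.
  rewrite Kk; congr vec4; move: mn (mean_pow 3 p) => mn m3'; field.
    exact: mn.
  exact: mn.
Qed.

End Means.
End Correspondence.

(** * Exchange of the two systems in mass coordinates *)

Section Transfer.

Local Notation v := (mean_v k V).
Local Notation w := (mean_w k W).
Local Notation vw := (mean_vw k V W).
Local Notation F2 := (fun p => FL eps k V W p 0 2).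
Local Notation F3 := (fun p => FL eps k V W p 0 3).

Lemma mean_v_gt0 p : Om p -> 0 < v p.
Proof.
move=> Op.
by have [c [d [_ [m0 _] [-> _ _ _ _] _ _]]] :=
  mean_dictionary p Op.
Qed.

(** Each Eulerian pair is [(A / v, B + w A / v)] with [(A, B)] equal to [(k, - j k)], [(1, 0)],
    [(vw, F3)] and [(w, F2)] in this order: the third and fourth laws exchange their places. *)
Lemma euler_of_lagrange p : Om p ->
  [/\ WE K Rho U p = vec4 (k p / v p) (v p)^-1 (vw p / v p) (w p / v p),
      FE eps K Rho U p = vec4 (- (par_j p * k p) + w p * (k p / v p)) (w p / v p)
        (F3 p + w p * (vw p / v p)) (F2 p + w p * (w p / v p)),
      w p = par_sigma p + par_j p * v p &
      energyE eps K Rho U p = energyL eps k V W p / v p].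
Proof.
move=> Op.
have [c [d [_ [m0 KE] [vE wE vwE ww FLE] [rhoE rhouE uE ruuE EE] FEE]]] :=
  mean_dictionary p Op.
have mn : mean_pow 1 p != 0 by rewrite gt_eqF.
rewrite /WE FEE FLE !vec4E rhoE rhouE uE vE vwE wE KE.
rewrite /energyE /energyL rhouE rhoE ruuE EE ww wE.
move: (mean_pow 1 p) (mean_pow 2 p) mn (mean (eps0 _ _ _ _)) => m1 m2 mn me.
split=> //; last by field.
by congr vec4; field.
Qed.

Let oT : open (Om `*` [set: R]). Proof. exact: open_cylinder. Qed.
Let sV : smooth_on (Om `*` [set: R]) (fun z => V z.1 z.2).
Proof. exact: V_smooth LP. Qed.
Let sW : smooth_on (Om `*` [set: R]) (fun z => W z.1 z.2).
Proof. exact: W_smooth LP. Qed.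

Lemma smooth_mean_v : smooth_on Om v.
Proof. exact: (lag_mean_smooth V). Qed.

Lemma smooth_mean_w : smooth_on Om w.
Proof. exact: (lag_mean_smooth W). Qed.

Lemma smooth_mean_vw : smooth_on Om vw.
Proof.
apply: (lag_mean_smooth (fun p x => V p x * W p x)).
exact: smooth_on_mul.
Qed.

Lemma smooth_F2 : smooth_on Om F2.
Proof.
have sP := smooth_P.
apply: (smooth_on_ext _ oOm _ (lag_mean_smooth _ sP)).
move=> p Op; rewrite !vec4E; apply: eq_mean => t _.
by rewrite (p0E).
Qed.

Lemma smooth_F3 : smooth_on Om F3.
Proof.
have sP := smooth_P.
have sE := smooth_E.
have sB := smooth_B.
have sdV := smooth_dV.
apply: (smooth_on_ext _ oOm _ (lag_mean_smooth
  (fun p x => - (W p x ^+ 2 / 2) + V p x * profile_P p x +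
    profile_E p x - profile_dV p x * profile_B p x) _)).
- move=> p Op; rewrite !vec4E; apply: eq_mean => t _.
  rewrite p0E // eps0E //.
  by rewrite epsvy0E // (k_dv0E).
- apply: smooth_on_add => //; last by apply: smooth_on_opp => //; exact: smooth_on_mul.
  apply: smooth_on_add => //; apply: smooth_on_add => //; last exact: smooth_on_mul.
  apply: smooth_on_opp => //; apply: smooth_on_mul => //; last exact: smooth_on_cst.
  exact: smooth_on_exp.
Qed.

Lemma FL01 p : FL eps k V W p 0 0 = - (par_j p * k p) /\ FL eps k V W p 0 1 = - w p.
Proof. by rewrite !vec4E. Qed.

Section Solution.
Variables (D : set (R * R)) (P : R * R -> 'rV[R]_4).
Hypotheses (oD : open D) (sP : smooth_on D P) (PD : P @` D `<=` Om).

Let DP z : D z -> Om (P z). Proof. by move=> Dz; apply: PD; exists z. Qed.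

Lemma smooth_along (f : 'rV[R]_4 -> R) : smooth_on Om f -> smooth_on D (fun z => f (P z)).
Proof.
move=> sf; apply: (smooth_on_comp D Om P f) => //; exact: findim_rV.
Qed.

Let sv := smooth_along _ smooth_mean_v.
Let sw := smooth_along _ smooth_mean_w.
Let vn z : D z -> v (P z) != 0. Proof. by move=> /DP/mean_v_gt0; rewrite lt0r => /andP[]. Qed.

Lemma near_D (f g : R * R -> R) z u : D z -> (forall y, D y -> f y = g y) ->
  'D_u f z = 'D_u g z.
Proof.
move=> Dz fg; apply: near_eq_derive; apply: filterS (open_nbhs_nbhs (conj oD Dz)).
exact: fg.
Qed.

Let is_der (f : 'rV[R]_4 -> R) z u : smooth_on Om f -> D z ->
  is_derive z u (fun z => f (P z)) ('D_u (fun z => f (P z)) z).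
Proof. by move=> /smooth_along sf Dz; exact: smooth_on_is_derive sf Dz. Qed.

Let DT (f : 'rV[R]_4 -> R) z := 'D_((1, 0) : R * R) (fun z => f (P z)) z.
Let DX (f : 'rV[R]_4 -> R) z := 'D_((0, 1) : R * R) (fun z => f (P z)) z.

(* The Eulerian law of the density A/v with flux B + w A/v, in terms of the
   Lagrangian law of A with flux B and of the conservation of mass. *)
Lemma transform_law (A B : 'rV[R]_4 -> R) z : D z ->
  smooth_on Om A -> smooth_on Om B ->
  'D_((1, 0) : R * R) (fun y => A (P y) / v (P y)) z +
  'D_((0, 1) : R * R) (fun y => B (P y) + w (P y) * (A (P y) / v (P y))) z =
  (DT A z + w (P z) * DX A z + v (P z) * DX B z) / v (P z) -
  A (P z) / v (P z) ^+ 2 * (DT v z + w (P z) * DX v z - v (P z) * DX w z).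
Proof.
move=> Dz sA sB.
have quot u := is_der_mul (is_der A z u sA Dz)
  (is_der_inv z u (fun y => v (P y)) (vn z Dz) (is_der v z u smooth_mean_v Dz)).
rewrite (derive_val (is_derive := quot (1, 0))).
have flux := is_der_add (is_der B z (0, 1) sB Dz)
  (is_der_mul (is_der w z (0, 1) smooth_mean_w Dz) (quot (0, 1))).
rewrite (derive_val (is_derive := flux)) /DT /DX.
move: (vn z Dz) => vz.
move: ('D_(1, 0) (fun y => A (P y)) z) ('D_(0, 1) (fun y => A (P y)) z)
  ('D_(0, 1) (fun y => B (P y)) z) ('D_(1, 0) (fun y => v (P y)) z)
  ('D_(0, 1) (fun y => v (P y)) z) ('D_(0, 1) (fun y => w (P y)) z) =>
  AT AX BX vT vX wX.
move: vz; move: (v (P z)) (w (P z)) (A (P z)) => v0 w0 A0 vz; field.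
exact: vz.
Qed.

Lemma mean_rhoE p : Om p -> mean_rho K Rho p = (v p)^-1.
Proof. by move=> /euler_of_lagrange[/(congr1 (fun u : 'rV[R]_4 => u 0 1))]; rewrite !vec4E. Qed.

Lemma mean_rhouE p : Om p -> mean_rhou K Rho U p = w p / v p.
Proof. by move=> /euler_of_lagrange[/(congr1 (fun u : 'rV[R]_4 => u 0 3))]; rewrite !vec4E. Qed.

Lemma mass_coordinate_ex : simply_connected D ->
  solves_on (WE K Rho U) (FE eps K Rho U) D P ->
  exists Y : R * R -> R, mass_coordinate K Rho U D P Y.
Proof.
move=> scD sol.
have sa : smooth_on D (fun z => mean_rho K Rho (P z)).
  apply: (smooth_on_ext (fun z => (v (P z))^-1)) => //.
    by move=> z Dz; rewrite mean_rhoE //; exact: DP.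
  exact: smooth_on_inv.
have sb : smooth_on D (fun z => mean_rhou K Rho U (P z)).
  apply: (smooth_on_ext (fun z => w (P z) / v (P z))) => //.
    by move=> z Dz; rewrite mean_rhouE //; exact: DP.
  by apply: smooth_on_mul => //; exact: smooth_on_inv.
have cl z : D z -> 'D_((1, 0) : R * R) (fun z => mean_rho K Rho (P z)) z +
    'D_((0, 1) : R * R) (fun z => mean_rhou K Rho U (P z)) z = 0.
  move=> Dz; have := sol z Dz 1.
  rewrite (_ : (fun y => WE K Rho U (P y) 0 1) = fun z => mean_rho K Rho (P z)).
    rewrite (_ : (fun y => FE eps K Rho U (P y) 0 1) = fun z => mean_rhou K Rho U (P z)) //.
    by apply/funext => y; rewrite vec4E.
  by apply/funext => y; rewrite vec4E.
have [Y sY pY] := potential_ex _ _ _ _ oD sa sb cl scD.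
exists Y; split => // z Dz; split.
  by apply: is_derive_eq (pY z (0, 1) Dz) _; rewrite /= mul1r mul0r subr0.
by apply: is_derive_eq (pY z (1, 0) Dz) _; rewrite /= mul1r mul0r sub0r.
Qed.

Lemma euler_law (A B : 'rV[R]_4 -> R) (i : 'I_4) z : D z ->
  smooth_on Om A -> smooth_on Om B ->
  (forall p, Om p -> WE K Rho U p 0 i = A p / v p) ->
  (forall p, Om p -> FE eps K Rho U p 0 i = B p + w p * (A p / v p)) ->
  'D_((1, 0) : R * R) (fun y => WE K Rho U (P y) 0 i) z +
  'D_((0, 1) : R * R) (fun y => FE eps K Rho U (P y) 0 i) z =
  (DT A z + w (P z) * DX A z + v (P z) * DX B z) / v (P z) -
  A (P z) / v (P z) ^+ 2 * (DT v z + w (P z) * DX v z - v (P z) * DX w z).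
Proof.
move=> Dz sA sB WEi FEi; rewrite -transform_law //.
by congr (_ + _); apply: near_D => // y Dy; [rewrite WEi|rewrite FEi] => //; exact: DP.
Qed.

Variable Y : R * R -> R.
Hypothesis mY : mass_coordinate K Rho U D P Y.
Let Phi (z : R * R) : R * R := (z.1, Y z).

Lemma mass_coordinate_gt0 z : D z -> 0 < 'D_((0, 1) : R * R) Y z.
Proof.
move=> Dz; have [[_ ->] _] := mY.2 z Dz.
by rewrite mean_rhoE ?invr_gt0 ?mean_v_gt0 //; exact: DP.
Qed.

(** At fixed [Y] the time derivative is the material derivative [d_T + w d_X]; together with
    [slopeX], by which the derivative in [Y] is [v d_X], this is the Lagrangian change of frame. *)
Lemma slopeT z : D z -> slope _ Y ((1, 0) : R * R) z = w (P z).
Proof.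
move=> Dz; have [[_ YX] [_ YT]] := mY.2 z Dz; have Op := DP z Dz.
rewrite /slope YX YT /= mean_rhoE // mean_rhouE //.
by move: (vn z Dz) => vz; field.
Qed.

Lemma slopeX z : D z -> slope _ Y ((0, 1) : R * R) z = v (P z).
Proof.
move=> Dz; have [[_ YX] _] := mY.2 z Dz; have Op := DP z Dz.
by rewrite /slope YX /= mean_rhoE // mul0r subr0 invrK mul1r.
Qed.

Variable Psi : R * R -> R * R.
Hypothesis PhiK : forall z, D z -> Psi (Phi z) = z.

Lemma lagrange_law (A A' B : 'rV[R]_4 -> R) z : D z ->
  (forall p, A' p = A p) -> smooth_on Om A -> smooth_on Om B ->
  'D_((1, 0) : R * R) (fun y => A' (P (Psi y))) (Phi z) +
  'D_((0, 1) : R * R) (fun y => B (P (Psi y))) (Phi z) =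
  DT A z + w (P z) * DX A z + v (P z) * DX B z.
Proof.
move=> Dz /funext -> sA sB.
rewrite (derive_comp_Psi _ D Y oD mY.1 mass_coordinate_gt0 Psi PhiK
  (fun z => A (P z)) z (1, 0) (smooth_along _ sA) Dz).
rewrite (derive_comp_Psi _ D Y oD mY.1 mass_coordinate_gt0 Psi PhiK
  (fun z => B (P z)) z (0, 1) (smooth_along _ sB) Dz).
by rewrite slopeT // slopeX // /= mul1r mul0r add0r.
Qed.

(** By [euler_law] and [lagrange_law] both systems are linear combinations of the same four
    Lagrangian residuals; the Eulerian ones carry extra multiples of the residual of [v]. *)
Lemma solves_on_transfer : solves_on (WE K Rho U) (FE eps K Rho U) D P <->
  solves_on (WL k V W) (FL eps k V W) (Phi @` D) (P \o Psi).
Proof.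
have s0 := k_smooth LP.
have sj := smooth_coord _ Om (@Ordinal 4 0 isT) oOm.
have sFL0 : smooth_on Om (fun p => FL eps k V W p 0 0).
  apply: (smooth_on_ext (fun p => - (par_j p * k p))) => //.
    by move=> p _; rewrite (FL01 p).1.
  by apply: smooth_on_opp => //; apply: smooth_on_mul => //; exact: sj.
have sFL1 : smooth_on Om (fun p => FL eps k V W p 0 1).
  apply: (smooth_on_ext (fun p => - w p)) => //.
    by move=> p _; rewrite (FL01 p).2.
  by apply: smooth_on_opp => //; exact: smooth_mean_w.
have c1 : smooth_on Om (fun=> 1 : R) by exact: smooth_on_cst.
have c0 : smooth_on Om (fun=> 0 : R) by exact: smooth_on_cst.
have WL0 p : WL k V W p 0 0 = k p by rewrite vec4E.
have WL1 p : WL k V W p 0 1 = v p by rewrite vec4E.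
have WL2 p : WL k V W p 0 2 = w p by rewrite vec4E.
have WL3 p : WL k V W p 0 3 = vw p by rewrite vec4E.
have L0 z (Dz : D z) := lagrange_law _ _ _ z Dz WL0 s0 sFL0.
have L1 z (Dz : D z) := lagrange_law _ _ _ z Dz WL1 smooth_mean_v sFL1.
have L2 z (Dz : D z) := lagrange_law _ _ _ z Dz WL2 smooth_mean_w smooth_F2.
have L3 z (Dz : D z) := lagrange_law _ _ _ z Dz WL3 smooth_mean_vw smooth_F3.
have E0 z (Dz : D z) := euler_law k (fun p => FL eps k V W p 0 0) 0 z Dz s0 sFL0
  (fun p Op => ltac:(by have [-> _ _ _] := euler_of_lagrange p Op; rewrite vec4E))
  (fun p Op => ltac:(by have [_ -> _ _] := euler_of_lagrange p Op; rewrite (FL01 p).1 vec4E)).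
have E1 z (Dz : D z) := euler_law (fun=> 1) (fun=> 0) 1 z Dz c1 c0
  (fun p Op => ltac:(by have [-> _ _ _] := euler_of_lagrange p Op; rewrite vec4E mul1r))
  (fun p Op => ltac:(by have [_ -> _ _] := euler_of_lagrange p Op; rewrite vec4E add0r mul1r)).
have E2 z (Dz : D z) := euler_law vw F3 2 z Dz smooth_mean_vw smooth_F3
  (fun p Op => ltac:(by have [-> _ _ _] := euler_of_lagrange p Op; rewrite vec4E))
  (fun p Op => ltac:(by have [_ -> _ _] := euler_of_lagrange p Op; rewrite vec4E)).
have E3 z (Dz : D z) := euler_law w F2 3 z Dz smooth_mean_w smooth_F2
  (fun p Op => ltac:(by have [-> _ _ _] := euler_of_lagrange p Op; rewrite vec4E))
  (fun p Op => ltac:(by have [_ -> _ _] := euler_of_lagrange p Op; rewrite vec4E)).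
have eqs z (Dz : D z) :
  (forall i : 'I_4, 'D_((1, 0) : R * R) (fun y => WE K Rho U (P y) 0 i) z +
    'D_((0, 1) : R * R) (fun y => FE eps K Rho U (P y) 0 i) z = 0) <->
  (forall i : 'I_4, 'D_((1, 0) : R * R) (fun y => WL k V W (P (Psi y)) 0 i) (Phi z) +
    'D_((0, 1) : R * R) (fun y => FL eps k V W (P (Psi y)) 0 i) (Phi z) = 0).
  apply: iff_trans (forall_I4 _) _; apply: iff_trans _ (iff_sym (forall_I4 _)).
  apply: iff_trans (and4_iff _ _ _ _ _ _ _ _ (eq0_iff (E0 z Dz)) (eq0_iff (E1 z Dz))
    (eq0_iff (E2 z Dz)) (eq0_iff (E3 z Dz))) _.
  apply: iff_trans _ (iff_sym (and4_iff _ _ _ _ _ _ _ _ (eq0_iff (L0 z Dz)) (eq0_iff (L1 z Dz))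
    (eq0_iff (L2 z Dz)) (eq0_iff (L3 z Dz)))).
  have DXFL1 : DX (fun p => FL eps k V W p 0 1) z = - DX w z.
    rewrite /DX (_ : (fun y => FL eps k V W (P y) 0 1) = (fun y => - w (P y))).
      exact: (derive_val (is_derive := is_der_opp
        (is_der w z (0, 1) smooth_mean_w Dz))).
    by apply/funext => y; rewrite (FL01 (P y)).2.
  have DT1 : DT (fun=> 1) z = 0 by exact: derive_cst.
  have DX1 : DX (fun=> 1) z = 0 by exact: derive_cst.
  have DX0 : DX (fun=> 0) z = 0 by exact: derive_cst.
  rewrite DXFL1 DT1 DX1 DX0.
  have vz := vn z Dz.
  move: (DT k z) (DX k z) (DX _ z) (DT v z) (DX v z) (DX w z) (DT w z) (DX _ z)
    (DT vw z) (DX vw z) (DX _ z) => kT kX b0 vT vX wX wT b2 uT uX b3.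
  rewrite !mulr0 !addr0 mul0r sub0r mulrN.
  move: vz; move: (v (P z)) (w (P z)) (k (P z)) (vw (P z)) => v0 w0 k0 u0 vz.
  (* Residual of the law of [v]. The Eulerian mass law, the case [A = 1], reads [- m / v ^+ 2 = 0],
     which clears the other three laws. *)
  set m := vT + _ - _.
  have clean (A e : R) : A / v0 - e * m = 0 -> m = 0 -> A = 0.
    move=> + m0; rewrite m0 mulr0 subr0 => /eqP.
    by rewrite mulf_eq0 invr_eq0 (negbTE vz) orbF => /eqP.
  split=> -[H0 H1 H2 H3].
    have m0 : m = 0.
      move/eqP: H1; rewrite oppr_eq0 !mulf_eq0 oner_eq0 invr_eq0 sqrf_eq0 (negbTE vz) /=.
      by move=> /eqP.
    by split; [exact: clean H0 m0|exact: m0|exact: clean H3 m0|exact: clean H2 m0].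
  by rewrite H0 H1 H2 H3 !mul0r !mulr0 !subr0 oppr0.
split=> sol.
  by move=> _ [z Dz <-]; exact: (eqs z Dz).1 (sol z Dz).
move=> z Dz; have Ez : (Phi @` D) (Phi z) by exists z.
exact: (eqs z Dz).2 (sol (Phi z) Ez).
Qed.

End Solution.
End Transfer.

(** * Simultaneous hyperbolicity *)

Section HyperbolicEquivalence.

Local Notation v := (mean_v k V).
Local Notation w := (mean_w k W).
Local Notation vw := (mean_vw k V W).
Local Notation FL := (FL eps k V W).
Local Notation WL := (WL k V W).
Local Notation FE := (FE eps K Rho U).
Local Notation WE := (WE K Rho U).

Variable p : 'rV[R]_4.
Hypothesis Op : Om p.

Let s_k := k_smooth LP.
Let s_v := smooth_mean_v.
Let s_w := smooth_mean_w.
Let s_vw := smooth_mean_vw.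
Let s_2 := smooth_F2.
Let s_3 := smooth_F3.

Let vn : v p != 0.
Proof. by rewrite gt_eqF // (mean_v_gt0). Qed.

Lemma smooth_F0 : smooth_on Om (fun p => FL p 0 0).
Proof.
apply: (smooth_on_ext (fun p => - (par_j p * k p))) => //.
  by move=> q _; rewrite (FL01 _).1.
by apply: smooth_on_opp => //; apply: smooth_on_mul => //; exact: smooth_coord.
Qed.

Lemma smooth_F1 : smooth_on Om (fun p => FL p 0 1).
Proof.
apply: (smooth_on_ext (fun p => - w p)) => //.
  by move=> q _; rewrite (FL01 _).2.
exact: smooth_on_opp.
Qed.

Lemma smooth_diff (f : 'rV[R]_4 -> R) : smooth_on Om f -> differentiable f p.
Proof. by move=> sf; apply: (smooth_on_differentiable _ _ Om) => //; exact: findim_rV. Qed.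

Lemma near_Om (f g : 'rV[R]_4 -> R) u : (forall q, Om q -> f q = g q) ->
  'D_u f p = 'D_u g p.
Proof.
by move=> fg; apply: near_eq_derive; apply: filterS (open_nbhs_nbhs (conj oOm Op)).
Qed.

Lemma jacobian_WL : jacobian WL p =
  cols4 R (fun i => 'D_(delta_mx 0 i) k p) (fun i => 'D_(delta_mx 0 i) v p)
    (fun i => 'D_(delta_mx 0 i) w p) (fun i => 'D_(delta_mx 0 i) vw p).
Proof.
have E0 : (fun q => WL q 0 0) = k by apply/funext => q; rewrite vec4E.
have E1 : (fun q => WL q 0 1) = v by apply/funext => q; rewrite vec4E.
have E2 : (fun q => WL q 0 2) = w by apply/funext => q; rewrite vec4E.
have E3 : (fun q => WL q 0 3) = vw by apply/funext => q; rewrite vec4E.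
rewrite jacobianE; last first.
  by apply/forall_I4; split; rewrite ?E0 ?E1 ?E2 ?E3; apply: smooth_diff.
by apply: eq_cols4 => i; rewrite mxE ?E0 ?E1 ?E2 ?E3.
Qed.

Lemma jacobian_FL : jacobian FL p =
  cols4 R (fun i => 'D_(delta_mx 0 i) (fun q => FL q 0 0) p)
    (fun i => - 'D_(delta_mx 0 i) w p)
    (fun i => 'D_(delta_mx 0 i) (fun q => FL q 0 2) p)
    (fun i => 'D_(delta_mx 0 i) (fun q => FL q 0 3) p).
Proof.
rewrite jacobianE; last first.
  by apply/forall_I4; split; apply: smooth_diff; [exact: smooth_F0|exact: smooth_F1| |].
apply: eq_cols4 => i; rewrite mxE //.
rewrite (_ : (fun q => FL q 0 1) = fun q => - w q).
  have dw := smooth_on_is_derive _ p (delta_mx 0 i) s_w Op.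
  exact: (derive_val (is_derive := is_der_opp dw)).
by apply/funext => q; rewrite (FL01 _).2.
Qed.

Lemma derive_euler_law (A B : 'rV[R]_4 -> R) (j : 'I_4) u :
  smooth_on Om A -> smooth_on Om B ->
  (forall q, Om q -> WE q 0 j = A q / v q) ->
  (forall q, Om q -> FE q 0 j = B q + w q * (A q / v q)) ->
  [/\ differentiable (fun q => WE q 0 j) p,
      differentiable (fun q => FE q 0 j) p,
      'D_u (fun q => WE q 0 j) p = 'D_u A p / v p - A p / v p ^+ 2 * 'D_u v p &
      'D_u (fun q => FE q 0 j) p = 'D_u B p + A p / v p * 'D_u w p +
        w p * ('D_u A p / v p - A p / v p ^+ 2 * 'D_u v p)].
Proof.
move=> sA sB WEj FEj.
have vn' q : Om q -> v q != 0.
  by move=> Oq; rewrite gt_eqF // (mean_v_gt0).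
have sQ : smooth_on Om (fun q => A q / v q).
  by apply: smooth_on_mul => //; exact: smooth_on_inv.
have sF : smooth_on Om (fun q => B q + w q * (A q / v q)).
  by apply: smooth_on_add => //; exact: smooth_on_mul.
have dA := smooth_on_is_derive _ p u sA Op.
have dB := smooth_on_is_derive _ p u sB Op.
have dv := smooth_on_is_derive _ p u s_v Op.
have dw := smooth_on_is_derive _ p u s_w Op.
have dQ := is_der_mul dA (is_der_inv p u v vn dv).
have dF := is_der_add dB (is_der_mul dw dQ).
have EW : smooth_on Om (fun q => WE q 0 j).
  by apply: (smooth_on_ext _ oOm _ sQ) => q Oq; rewrite WEj.
have EF : smooth_on Om (fun q => FE q 0 j).
  by apply: (smooth_on_ext _ oOm _ sF) => q Oq; rewrite FEj.
split; [exact: smooth_diff|exact: smooth_diff| |].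
- rewrite (near_Om _ _ u WEj) (derive_val (is_derive := dQ)).
  by move: ('D_u A p) ('D_u v p) (v p) vn => a b c cn; field.
- rewrite (near_Om _ _ u FEj) (derive_val (is_derive := dF)).
  by move: ('D_u A p) ('D_u v p) ('D_u w p) ('D_u B p) (v p) vn => a b e g c cn; field.
Qed.

(** Transposed Jacobian of the map from the densities of (L), in the order [(k, v, w, vw)], to those
    of (E). *)
Let M : 'M[R]_4 := cols4 R
  (fun i => [:: (v p)^-1; - k p / v p ^+ 2; 0; 0]`_i)
  (fun i => [:: 0; - (v p ^+ 2)^-1; 0; 0]`_i)
  (fun i => [:: 0; - vw p / v p ^+ 2; 0; (v p)^-1]`_i)
  (fun i => [:: 0; - w p / v p ^+ 2; (v p)^-1; 0]`_i).

(** This is [M] at the image point, the map between the densities being an involution. *)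
Let M' : 'M[R]_4 := cols4 R
  (fun i => [:: v p; - (k p * v p); 0; 0]`_i)
  (fun i => [:: 0; - v p ^+ 2; 0; 0]`_i)
  (fun i => [:: 0; - (w p * v p); 0; v p]`_i)
  (fun i => [:: 0; - (vw p * v p); v p; 0]`_i).

Let Mu : M \in unitmx.
Proof.
have MM : M *m M' = 1%:M.
  rewrite cols4_mul; apply/matrixP => i j; rewrite !mxE /=.
  move: (v p) (w p) (vw p) (k p) vn => v0 w0 u0 k0 vn0.
  by move: i j; do 2 (apply/forall_I4; split); rewrite /= ?mulr0n ?mulr1n; field.
exact: (mulmx1_unit MM).1.
Qed.

(** The same [M] serves the fluxes because the Lagrangian flux of [v] is [- w]: the second row of
    [M] then produces the term [A / v * dw] in the differential of [w A / v]. *)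
Lemma jacobian_euler : jacobian WE p = jacobian WL p *m M /\
  jacobian FE p = v p *: (jacobian FL p *m M) + w p *: (jacobian WL p *m M).
Proof.
have eul q Oq := euler_of_lagrange q Oq.
have c1 : smooth_on Om (fun=> 1 : R) by exact: smooth_on_cst.
have c0 : smooth_on Om (fun=> 0 : R) by exact: smooth_on_cst.
have L0 u := derive_euler_law k (fun q => FL q 0 0) 0 u s_k smooth_F0
  (fun q Oq => ltac:(by have [-> _ _ _] := eul q Oq; rewrite vec4E))
  (fun q Oq => ltac:(by have [_ -> _ _] := eul q Oq; rewrite (FL01 _).1 vec4E)).
have L1 u := derive_euler_law (fun=> 1) (fun=> 0) 1 u c1 c0
  (fun q Oq => ltac:(by have [-> _ _ _] := eul q Oq; rewrite vec4E mul1r))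
  (fun q Oq => ltac:(by have [_ -> _ _] := eul q Oq; rewrite vec4E add0r mul1r)).
have L2 u := derive_euler_law vw (fun q => FL q 0 3) 2 u s_vw s_3
  (fun q Oq => ltac:(by have [-> _ _ _] := eul q Oq; rewrite vec4E))
  (fun q Oq => ltac:(by have [_ -> _ _] := eul q Oq; rewrite vec4E)).
have L3 u := derive_euler_law w (fun q => FL q 0 2) 3 u s_w s_2
  (fun q Oq => ltac:(by have [-> _ _ _] := eul q Oq; rewrite vec4E))
  (fun q Oq => ltac:(by have [_ -> _ _] := eul q Oq; rewrite vec4E)).
have dW : forall j, differentiable (fun q => WE q 0 j) p.
  apply/forall_I4; split;
    [by case: (L0 0)|by case: (L1 0)|by case: (L2 0)|by case: (L3 0)].
have dF : forall j, differentiable (fun q => FE q 0 j) p.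
  apply/forall_I4; split;
    [by case: (L0 0)|by case: (L1 0)|by case: (L2 0)|by case: (L3 0)].
have z1 u : 'D_u (fun=> 1 : R) p = 0 by exact: derive_cst.
have z0 u : 'D_u (fun=> 0 : R) p = 0 by exact: derive_cst.
rewrite (jacobianE _ _ _ _ _ dW) (jacobianE _ _ _ _ _ dF) jacobian_WL jacobian_FL.
rewrite !cols4_mul; split; apply/matrixP => i; apply/forall_I4; rewrite !mxE /=.
  have [_ _ e0 _] := L0 (delta_mx 0 i); have [_ _ e1 _] := L1 (delta_mx 0 i).
  have [_ _ e2 _] := L2 (delta_mx 0 i); have [_ _ e3 _] := L3 (delta_mx 0 i).
  rewrite z1 in e1.
  move: ('D_(delta_mx 0 i) k p) ('D_(delta_mx 0 i) v p) ('D_(delta_mx 0 i) w p)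
    ('D_(delta_mx 0 i) vw p) e0 e1 e2 e3 => dk dv dw du e0 e1 e2 e3.
  by split; [apply: etrans e0 _|apply: etrans e1 _|apply: etrans e2 _|apply: etrans e3 _];
    move: (v p) (w p) (vw p) (k p) vn => v0 w0 u0 k0 vn0; field.
have [_ _ _ e0] := L0 (delta_mx 0 i); have [_ _ _ e1] := L1 (delta_mx 0 i).
have [_ _ _ e2] := L2 (delta_mx 0 i); have [_ _ _ e3] := L3 (delta_mx 0 i).
rewrite z1 z0 in e1.
move: ('D_(delta_mx 0 i) k p) ('D_(delta_mx 0 i) v p) ('D_(delta_mx 0 i) w p)
  ('D_(delta_mx 0 i) vw p) ('D_(delta_mx 0 i) (fun q => FL q 0 0) p)
  ('D_(delta_mx 0 i) (fun q => FL q 0 2) p) ('D_(delta_mx 0 i) (fun q => FL q 0 3) p)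
  e0 e1 e2 e3 => dk dv dw du d0 d2 d3 e0 e1 e2 e3.
by split; [apply: etrans e0 _|apply: etrans e1 _|apply: etrans e2 _|apply: etrans e3 _];
  move: (v p) (w p) (vw p) (k p) vn => v0 w0 u0 k0 vn0; field.
Qed.

Lemma hyperbolic_equivalence : hyperbolic_at WE FE p <-> hyperbolic_at WL FL p.
Proof.
rewrite /hyperbolic_at; have [-> ->] := jacobian_euler.
exact: hyperbolic_transfer Mu vn.
Qed.

End HyperbolicEquivalence.

(** * Equivalence of the two convexity conditions *)

Section ConvexEquivalence.

Local Notation v := (mean_v k V).
Local Notation w := (mean_w k W).
Local Notation vw := (mean_vw k V W).

Let v_neq0 p : Om p -> v p != 0.
Proof.
by move=> Op; rewrite gt_eqF // (mean_v_gt0).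
Qed.

Let k_neq0 p : Om p -> k p != 0.
Proof. by move=> Op; rewrite gt_eqF // (k_gt0 LP). Qed.

Lemma varsE_perspective p : Om p ->
  varsE K Rho U p = perspective R (varsL k V W p).
Proof.
move=> Op; have [e _ _ _] := euler_of_lagrange p Op.
have := congr1 (fun u : 'rV[R]_4 => u 0 0) e; have := congr1 (fun u : 'rV[R]_4 => u 0 1) e.
have := congr1 (fun u : 'rV[R]_4 => u 0 2) e; have := congr1 (fun u : 'rV[R]_4 => u 0 3) e.
rewrite /varsE /perspective /varsL /DE /DeltaL !vec4E !vec3E => -> -> -> ->.
move: (v_neq0 p Op) (k_neq0 p Op); move: (v p) (k p) (w p) (vw p) => a b c d a0 b0.
by congr vec3; field; rewrite a0 b0.
Qed.

Lemma smooth_varsL j : smooth_on Om (fun p => varsL k V W p 0 j).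
Proof.
have s_k := k_smooth LP.
have s_v := smooth_mean_v.
have s_w := smooth_mean_w.
have s_vw := smooth_mean_vw.
move: j; apply/forall_I3; split.
- by apply: smooth_on_ext s_v => // x Ox; rewrite vec3E.
- by apply: smooth_on_ext s_k => // x Ox; rewrite vec3E.
- apply: (smooth_on_ext (fun p => (vw p + - (v p * w p)) * (k p)^-1)) => //.
    by move=> x Ox; rewrite vec3E.
  apply: smooth_on_mul => //; last exact: smooth_on_inv.
  by apply: smooth_on_add => //; apply: smooth_on_opp => //; exact: smooth_on_mul.
Qed.

(** [perspective] is an involution exchanging the variables, and dividing by the first variable
    exchanges the energies, so [strictly_convex_perspective] serves in both directions. *)
Lemma convex_equivalence p : Om p ->
  strictly_convex_in (varsL k V W) (energyL eps k V W) p <->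
  strictly_convex_in (varsE K Rho U) (energyE eps K Rho U) p.
Proof.
move=> Op.
have vL0 x : Om x -> 0 < varsL k V W x 0 0.
  by move=> Ox; rewrite vec3E; exact: (mean_v_gt0).
have vE0 x : Om x -> varsE K Rho U x 0 0 = (v x)^-1.
  by move=> Ox; rewrite varsE_perspective // !vec3E.
have eE x : Om x -> energyE eps K Rho U x = energyL eps k V W x / v x.
  by move=> Ox; have [] := euler_of_lagrange x Ox.
split; apply: (strictly_convex_perspective _ _ Om) => //.
- exact: smooth_varsL.
- exact: varsE_perspective.
- by move=> x Ox; rewrite eE // vec3E.
- move=> j.
  apply: (smooth_on_ext (fun x => perspective R (varsL k V W x) 0 j)) => //.
    by move=> x Ox; rewrite varsE_perspective.
  apply: smooth_perspective_coord => //; last exact: smooth_varsL.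
  by move=> x Ox; rewrite gt_eqF // vL0.
- by move=> x Ox; rewrite vE0 // invr_gt0 (mean_v_gt0).
- by move=> x Ox; rewrite varsE_perspective // perspectiveK // gt_eqF // vL0.
- by move=> x Ox; rewrite eE // vE0 // invrK divfK // v_neq0.
Qed.

End ConvexEquivalence.

(** * First variation of the action *)

Section Gibbs.

Local Notation dV := profile_dV.
Local Notation E := profile_E.
Local Notation A := profile_A.
Local Notation B := profile_B.
Local Notation P := profile_P.
Local Notation T := (Om `*` [set: R]).
Local Notation smooth2 f := (smooth_on T (fun z : 'rV[R]_4 * R => f z.1 z.2)).

Let oT : open T. Proof. exact: open_cylinder. Qed.
Let sk := k_smooth LP.
Let kn p : Om p -> k p != 0.
Proof. by move=> Op; rewrite gt_eqF // (k_gt0 LP). Qed.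

Let a (z : 'rV[R]_4 * R) : R := V z.1 (z.2 / k z.1).

Let sa : smooth_on T a.
Proof. exact: (smooth_rescaled V (V_smooth LP)). Qed.

Let bE z : T z -> dV z.1 (z.2 / k z.1) = k z.1 * 'D_(0, 1) a z.
Proof.
case: z => p t [/= Op _]; have e := k_dv0E p t Op.
rewrite -e; congr (_ * _); exact: (derive1_fiber _ _ _ (v0 k V) sa p t Op).
Qed.

(** Lagrangian whose Euler-Lagrange equation is that of the profile. It equals [dV * B] on profiles,
    but in this form its variation produces the Euler-Lagrange expression and an explicit dependence
    on the parameters. *)
Definition profile_L (p : 'rV[R]_4) (x : R) : R :=
  E p x - par_j p ^+ 2 / 2 * V p x ^+ 2 - par_lambda p * V p x - par_mu p.

Local Notation L := profile_L.

Lemma smooth_L : smooth2 L.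
Proof.
have sV := V_smooth LP.
have sc i : smooth2 (fun (p : 'rV[R]_4) (_ : R) => p 0 i).
  exact: (smooth_on_base (fun p : 'rV[R]_4 => p 0 i) (smooth_coord _ _ i oOm)).
have sE := smooth_E.
apply: smooth_on_add => //; last by apply: smooth_on_opp => //; exact: sc.
apply: smooth_on_add => //.
  apply: smooth_on_add => //; apply: smooth_on_opp => //; apply: smooth_on_mul => //.
    apply: smooth_on_mul => //; last exact: smooth_on_cst.
    by apply: smooth_on_exp => //; exact: sc.
  by apply: smooth_on_exp.
by apply: smooth_on_opp => //; apply: smooth_on_mul => //; exact: sc.
Qed.

Lemma L_ode p x : Om p -> L p x = dV p x * B p x.
Proof.
move=> Op; have o := lagr_ode LP x Op; rewrite /L -[par_mu p]opprK -o.
rewrite -/(dV p x) -/(E p x) -/(B p x); move: (dV p x * B p x) (E p x) => d e.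
by field.
Qed.

(** Action of the profile: the integral of [profile_L] over one period [(k p)^-1]. *)
Definition theta (p : 'rV[R]_4) : R := (k p)^-1 * mean (fun t => L p (t / k p)).

Lemma smooth_theta : smooth_on Om theta.
Proof.
apply: smooth_on_mul => //; first by apply: smooth_on_inv => //; exact: sk.
exact: (lag_mean_smooth L smooth_L).
Qed.

Section Derivative.
Variables (p u : 'rV[R]_4).
Hypothesis Op : Om p.
Hypothesis EL : forall x, P p x = - par_lambda p - par_j p ^+ 2 * V p x.

Let Da (q : 'rV[R]_4) (t : R) : R := 'D_(u, 0) a (q, t).
(** Boundary term of the first variation. *)
Let G (q : 'rV[R]_4) (t : R) : R := B q (t / k q) * Da q t.

Let sDa : smooth2 Da.
Proof.
by apply: smooth_on_ext (smooth_on_derive _ _ ((u, 0) : 'rV[R]_4 * R) sa) => // -[q t].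
Qed.

Let sG : smooth2 G.
Proof.
apply: smooth_on_mul => //; apply: (smooth_rescaled B).
exact: (smooth_B).
Qed.

Let kn0 : k p != 0. Proof. exact: kn. Qed.

Let V_shift x : V p (x + (k p)^-1) = V p x.
Proof. exact: (V_periodic LP). Qed.

(** The variation is taken at fixed rescaled phase, where every profile has period 1; at fixed
    [zeta] the period would move with the parameter and the variation need not be periodic. *)
Let G_periodic : G p 1 = G p 0.
Proof.
have dVs : dV p (0 + (k p)^-1) = dV p 0.
  have dV1 x := is_derive_derive1 _ _ _ V (V_smooth LP) p x Op.
  have sVp := smooth_fiber V p Op (V_smooth LP).
  have d1 : is_derive (0 : R) (1 : R) (fun y : R => y + (k p)^-1) 1.
    by apply: is_derive_eq (is_der_add (is_derive_id (0 : R) (1 : R))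
      (is_der_cst (0 : R) (1 : R) (k p)^-1)) _; rewrite addr0.
  have dd : differentiable (V p) (0 + (k p)^-1).
    by apply/derivable1_diffP; have [] := dV1 (0 + (k p)^-1).
  have := is_der_comp (V p) (fun y : R => y + (k p)^-1) _ _ dd d1.
  have -> : (fun y => V p (y + (k p)^-1)) = V p by apply/funext => y; exact: V_shift.
  move=> D; have := derive_val (is_derive := D).
  by rewrite /profile_dV !derive1E => ->.
have -> : G p 1 = B p (0 + (k p)^-1) * Da p 1 by rewrite /G mul1r add0r.
rewrite /G mul0r /profile_B V_shift dVs; congr (_ * _).
have c t : Da p t = 'D_u (fun q => a (q, t)) p.
  have T1 : T (p, t) by [].
  have := is_derive_curry1 _ _ (fun q t => a (q, t)) p u t.
  have -> : (fun z : 'rV[R]_4 * R => a (z.1, z.2)) = a by apply/funext => -[].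
  move=> H; have D := H (Ck_on_derivable _ _ _ _ _ _ (p, t) (u, 0) (sa 1) T1).
  by have := derive_val (is_derive := D).
rewrite !c; apply: near_eq_derive; apply: filterS (open_nbhs_nbhs (conj oOm Op)) => q Oq.
by rewrite /a /= mul1r mul0r -(V_periodic LP 0 Oq) add0r.
Qed.

Let j := par_j p.
Let dj := par_j u.

(** The Euler-Lagrange equation turns the terms in the variation of [v0] into the total derivative
    of [G]; the variation of [k] contributes [L / k] because [dV * B = L]; the rest is the explicit
    dependence on the parameters. *)
Let density_derivative t : 'D_(u, 0) (fun z : 'rV[R]_4 * R => L z.1 (z.2 / k z.1)) (p, t) =
  k p * derive1 (G p) t + ('D_u k p / k p * L p (t / k p) -
    (j * dj * V p (t / k p) ^+ 2 + par_lambda u * V p (t / k p) + par_mu u)).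
Proof.
have Tpt : T (p, t) by [].
have da := smooth_on_is_derive _ (p, t) ((u, 0) : 'rV[R]_4 * R) sa Tpt.
have base (f : 'rV[R]_4 -> R) : smooth_on Om f ->
    is_derive ((p, t) : 'rV[R]_4 * R) (u, 0) (fun z => f z.1) ('D_u f p).
  move=> sf; have s1 := smooth_on_base f sf.
  have D := smooth_on_is_derive _ (p, t) ((u, 0) : 'rV[R]_4 * R) s1 Tpt.
  have C := is_derive_curry1 _ _ (fun q (_ : R) => f q) p u t
    (Ck_on_derivable _ _ _ _ _ _ (p, t) (u, 0) (s1 1) Tpt).
  by have -> := derive_val (is_derive := C).
have dk := base _ sk.
have par i : is_derive ((p, t) : 'rV[R]_4 * R) (u, 0) (fun z => z.1 0 i) (u 0 i).
  apply: is_derive_eq (base _ (smooth_coord _ _ i oOm)) _.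
  exact: (derive_val (is_derive := is_der_coord _ i p u)).
pose a' (z : 'rV[R]_4 * R) := 'D_(0, 1) a z.
have sa' : smooth_on T a' by exact: smooth_on_derive.
have da' := smooth_on_is_derive _ (p, t) ((u, 0) : 'rV[R]_4 * R) sa' Tpt.
have db : is_derive ((p, t) : 'rV[R]_4 * R) (u, 0) (fun z => dV z.1 (z.2 / k z.1))
    (k p * 'D_(u, 0) a' (p, t) + a' (p, t) * 'D_u k p).
  have [D1 D2] := is_der_mul dk da'.
  have N : \forall z \near (p, t), k z.1 * a' z = dV z.1 (z.2 / k z.1).
    by apply: filterS (open_nbhs_nbhs (conj oT Tpt)) => z Tz; rewrite bE.
  split; first exact: near_eq_derivable N D1.
  by rewrite -D2; apply: esym; exact: near_eq_derive.
(* Variation in the parameter and derivation in the phase commute. *)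
have sc : 'D_(u, 0) a' (p, t) = derive1 (Da p) t.
  rewrite (derive1_fiber _ _ _ Da sDa p t Op).
  have -> : (fun z : 'rV[R]_4 * R => Da z.1 z.2) = (fun z => 'D_(u, 0) a z).
    by apply/funext => -[].
  exact: (schwarz _ _ T a (p, t) (u, 0) (0, 1) oT (sa 2) Tpt).
have dB : is_derive t (1 : R) (fun s => B p (s / k p)) (derive1 (B p) (t / k p) / k p).
  have D := is_derive_derive1 _ _ _ B (smooth_B) p (t / k p) Op.
  exact: is_derive_scale.
have dG : derive1 (G p) t = B p (t / k p) * derive1 (Da p) t +
    Da p t * (derive1 (B p) (t / k p) / k p).
  have D := is_der_mul dB (is_derive_derive1 _ _ _ Da sDa p t Op).
  by rewrite derive1E; have := derive_val (is_derive := D).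
have Vp : 0 < V p (t / k p) by exact: (V_gt0 LP).
have dE := is_derive_eps _ eps seps _ a (fun z => dV z.1 (z.2 / k z.1)) (p, t) (u, 0) _ _ Vp da db.
have dj2 := is_der_exp 1 (par (@Ordinal 4 0 isT)).
have da2 := is_der_exp 1 da.
have D := is_der_add (is_der_add (is_der_add dE
  (is_der_opp (is_der_mul (is_der_mul dj2 (is_der_cst _ _ 2^-1)) da2)))
  (is_der_opp (is_der_mul (par (@Ordinal 4 2 isT)) da)))
  (is_der_opp (par (@Ordinal 4 3 isT))).
apply: etrans (derive_val (is_derive := D)) _.
have eb : dV p (t / k p) = k p * a' (p, t) := bE (p, t) Tpt.
have := EL (t / k p); have := L_ode p (t / k p) Op.
rewrite sc dG eb /profile_P -[Da p t]/('D_(u, 0) a (p, t)) /= => -> Ep.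
have -> : partial1 eps (a (p, t)) (k p * a' (p, t)) =
    derive1 (B p) (t / k p) + par_lambda p + j ^+ 2 * V p (t / k p).
  have <- : A p (t / k p) = partial1 eps (a (p, t)) (k p * a' (p, t)) by rewrite -eb.
  move: Ep; rewrite -/j; move: (A _ _) (derive1 _ _) (V _ _) => x y z Ep.
  have -> : x = y - (- x + y) by ring.
  by rewrite Ep; ring.
have -> : partial2 eps (a (p, t)) (k p * a' (p, t)) = B p (t / k p) by rewrite -eb.
rewrite -[a (p, t)]/(V p (t / k p)) -/(par_j p) -/(par_lambda p) -/(par_j u).
rewrite -/(par_lambda u) -/(par_mu u) -/j -/dj.
move: ('D_(u, 0) a (p, t)) (derive1 (B p) (t / k p)) (B p (t / k p)) (derive1 (Da p) t) (a' (p, t))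
  ('D_u k p) (V p (t / k p)) (k p) kn0 => x0 x1 x2 x3 x4 x5 x6 x7 x8.
by field.
Qed.

(** The total derivative has mean zero, and the variation of [k] inside the mean cancels that of the
    prefactor [(k p)^-1]. *)
Lemma derive_theta : 'D_u theta p =
  - (k p)^-1 * (j * dj * mean_pow 2 p + par_lambda u * mean_v k V p + par_mu u).
Proof.
have sL := smooth_rescaled L smooth_L.
have TE q (t : R) : Om q -> 0 <= t <= 1 -> T (q, t) by [].
have D := smooth_on_is_derive_mean _ _ Om T _ p u oOm oT TE sL Op.
have dk := smooth_on_is_derive _ p u sk Op.
have M := is_der_mul (is_der_inv p u k kn0 dk) D.
apply: etrans (derive_val (is_derive := M)) _.
rewrite (eq_mean _ _ _ (fun t _ => density_derivative t)).
have cS (f : 'rV[R]_4 -> R -> R) : smooth2 f -> continuous01 R (f p).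
  by move=> sf t _; apply: smooth_on_continuous (smooth_fiber f p Op sf) _.
have cG : continuous01 R (derive1 (G p)).
  exact: (cS (fun q t => derive1 (G q) t) (smooth_on_derive1 _ _ _ G oOm sG)).
have cL : continuous01 R (fun t => L p (t / k p)) by exact: (cS (fun q t => L q (t / k q))).
have cV : continuous01 R (fun t => V p (t / k p)).
  exact: (cS (fun q t => V q (t / k q)) sa).
have cadd f g : continuous01 R f -> continuous01 R g ->
    continuous01 R (fun t => f t + g t).
  by move=> cf cg t t01; apply: cvgD; [exact: cf|exact: cg].
have cmul f g : continuous01 R f -> continuous01 R g ->
    continuous01 R (fun t => f t * g t).
  by move=> cf cg t t01; apply: cvgM; [exact: cf|exact: cg].
have ccst c : continuous01 R (fun=> c) by move=> t _; exact: cvg_cst.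
have cV2 : continuous01 R (fun t => V p (t / k p) ^+ 2) by exact: cmul.
pose Q t := j * dj * V p (t / k p) ^+ 2 + par_lambda u * V p (t / k p) + par_mu u.
have cQ : continuous01 R Q.
  have c1 : continuous01 R (fun t => j * dj * V p (t / k p) ^+ 2) by exact: cmul (ccst _) cV2.
  have c2 : continuous01 R (fun t => par_lambda u * V p (t / k p)) by exact: cmul (ccst _) cV.
  exact: cadd _ _ (cadd _ _ c1 c2) (ccst (par_mu u)).
have FTC : mean (derive1 (G p)) = 0.
  have dG (t : R) : 0 <= t <= 1 -> is_derive t (1 : R) (G p) (derive1 (G p) t).
    by move=> _; exact: (is_derive_derive1 _ _ _ G sG).
  by rewrite (mean_FTC _ _ (G p) cG dG) G_periodic subrr.
rewrite (meanD _ (fun t => k p * derive1 (G p) t)); [|exact: cmul|]; last first.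
  apply: cadd; first exact: cmul.
  have cQ' : continuous01 R (fun t => - (Q t)).
    by move=> t t01; apply: cvgN; exact: cQ t01.
  exact: cQ'.
rewrite (meanB _ (fun t => 'D_u k p / k p * L p (t / k p))); [|exact: cmul|exact: cQ].
rewrite (meanD _ (fun t => j * dj * V p (t / k p) ^+ 2 +
  par_lambda u * V p (t / k p))) //; last first.
  by apply: cadd; exact: cmul.
rewrite (meanD _ (fun t => j * dj * V p (t / k p) ^+ 2)); [|exact: cmul..].
rewrite mean_cst !meanZ // FTC -/(mean_pow 2 p) -[mean (fun t => V p (t / k p))]/(mean_v k V p).
move: (mean (fun t => L p (t / k p))) ('D_u k p) (mean_pow 2 p) (mean_v k V p) (k p) kn0.
move=> x0 x1 x2 x3 x4 x5.
by field.
Qed.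

End Derivative.
End Gibbs.

(** * Convexity implies hyperbolicity *)

Section ConvexHyperbolic.

Local Notation v := (mean_v k V).
Local Notation w := (mean_w k W).
Local Notation vw := (mean_vw k V W).
Local Notation m2 := (mean_pow 2).
Local Notation th := theta.
Local Notation e := (energyL eps k V W).
Local Notation q := (varsL k V W).
Local Notation FL := (FL eps k V W).
Local Notation dV := profile_dV.
Local Notation T := (Om `*` [set: R]).
Local Notation dl := (fun p => DeltaL k V W p / k p).

Let oT : open T. Proof. exact: open_cylinder. Qed.
Let kn p : Om p -> k p != 0.
Proof. by move=> Op; rewrite gt_eqF // (k_gt0 LP). Qed.

Let sk := k_smooth LP.
Let sv := smooth_mean_v.
Let sw := smooth_mean_w.
Let sq := smooth_varsL.
Let sth := smooth_theta.

Let sm2 : smooth_on Om m2.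
Proof.
apply: (lag_mean_smooth (fun p x => V p x ^+ 2)).
by apply: smooth_on_exp => //; exact: V_smooth LP.
Qed.

Let sdl : smooth_on Om dl.
Proof. by apply: smooth_on_ext (sq 2) => // x Ox; rewrite vec3E. Qed.

Let qE : [/\ (fun x => q x 0 0) = v, (fun x => q x 0 1) = k & (fun x => q x 0 2) = dl].
Proof. by split; apply/funext => x; rewrite vec3E. Qed.

Lemma mean_w_vwE p : Om p -> [/\ w p = par_sigma p + par_j p * v p,
  vw p = v p * w p + k p * dl p, k p * dl p = par_j p * (m2 p - v p ^+ 2) &
  e p = mean (eps0 eps k V p) + par_j p ^+ 2 * (m2 p - v p ^+ 2) / 2].
Proof.
move=> Op; have [c [d [_ _ [vE wE vwE ww _] _ _]]] :=
  mean_dictionary p Op.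
have E : DeltaL k V W p = par_j p * (m2 p - v p ^+ 2).
  rewrite /DeltaL vwE wE vE.
  by move: (mean_pow 1 p) (m2 p) (par_j p) (par_sigma p) => a b j s; ring.
have kd : k p * dl p = DeltaL k V W p by rewrite mulrC divfK // kn.
split; [by rewrite wE vE|by rewrite kd /DeltaL addrC subrK|by rewrite kd|].
rewrite /energyL ww wE vE.
by move: (mean_pow 1 p) (m2 p) (par_j p) (par_sigma p) => a b j s; field.
Qed.

(** Mean of the definition of [profile_L], rewritten with [k delta = j (m2 - v^2)]. *)
Lemma energyL_theta p : Om p -> e p = k p * (th p + par_j p * dl p) +
  par_j p ^+ 2 * v p ^+ 2 / 2 + par_lambda p * v p + par_mu p.
Proof.
move=> Op; have [_ _ kd ->] := mean_w_vwE p Op.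
have c0 f := lag_cont f p Op.
have sE := smooth_E.
have mE : mean (eps0 eps k V p) = mean (fun t => profile_E p (t / k p)).
  by apply: eq_mean => t _; exact: eps0E p t Op.
have tE : k p * th p = mean (eps0 eps k V p) -
    (par_mu p + par_lambda p * mean_pow 1 p + par_j p ^+ 2 / 2 * m2 p + 0 * mean_pow 3 p).
  rewrite /theta mulrA mulfV ?kn // mul1r mE.
  rewrite -(mean_poly3 p Op) -meanB.
  - by apply: eq_mean => t _; rewrite /profile_L mul0r addr0; ring.
  - exact: c0 sE.
  - move=> t t01.
    have cX (n : nat) : {for t, continuous (fun s : R => V p (s / k p) ^+ n)}.
      apply: (c0 (fun p x => V p x ^+ n) _ t t01).
      by apply: smooth_on_exp => //; exact: V_smooth LP.
    have cZ (c : R) (n : nat) : {for t, continuous (fun s : R => c * V p (s / k p) ^+ n)}.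
      by apply: cvgM; [exact: cvg_cst|exact: cX].
    apply: cvgD (cZ _ 3); apply: cvgD (cZ _ 2).
    by apply: cvgD (cZ _ 1); exact: cvg_cst.
rewrite (mulrDr (k p)) tE (mulrCA (k p)) kd -[v p]/(mean_pow 1 p).
by move: (mean _) (mean_pow 1 p) (m2 p) (mean_pow 3 p) => a b c d; field.
Qed.

(* Delta is j times the variance of v0, which has a critical point at a constant
   profile, so that the third column of the Jacobian vanishes there. *)
Lemma nonconstant_profile p : Om p -> \rank (jacobian q p) = 3%N ->
  exists x, dV p x != 0.
Proof.
move=> Op rk; apply: contrapT => H.
have dV0 x : dV p x = 0.
  by apply: contrapT => /eqP Hx; apply: H; exists x.
have [E0 E1 E2] := qE.
have Vc x : V p x = V p 0.
  apply: (@is_derive_0_is_cst R (V p) x 0) => y.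
  by rewrite -(dV0 y); exact: (is_derive_derive1 _ _ _ V (V_smooth LP) p y Op).
have vE : v p = V p 0.
  transitivity (mean (fun=> V p 0)); last exact: mean_cst.
  by apply: eq_mean => t _; exact: Vc.
have var0 u : 'D_u (fun x => m2 x + - v x ^+ 2) p = 0.
  (* The variance is the mean of the square of [v0 - v], and the derivative of this square keeps a
     factor which vanishes when [v0] is constant. *)
  pose g (z : 'rV[R]_4 * R) : R := V z.1 (z.2 / k z.1) + - v z.1.
  have sg : smooth_on T g.
    apply: smooth_on_add => //.
      exact: (smooth_rescaled V (V_smooth LP)).
    by apply: smooth_on_opp => //; exact: (smooth_on_base v sv).
  have sg2 := smooth_on_exp _ _ _ g 2 oT sg.
  have TE x (t : R) : Om x -> 0 <= t <= 1 -> T (x, t) by [].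
  have D := smooth_on_is_derive_mean _ _ Om T _ p u oOm oT TE sg2 Op.
  have E : 'D_u (fun x => m2 x + - v x ^+ 2) p = 'D_u (fun x => mean (fun t => g (x, t) ^+ 2)) p.
    apply: near_eq_derive; apply: filterS (open_nbhs_nbhs (conj oOm Op)) => x Ox.
    transitivity (v x ^+ 2 + (- 2 * v x) * mean_pow 1 x + 1 * m2 x + 0 * mean_pow 3 x).
      by rewrite -[v x]/(mean_pow 1 x); ring.
    rewrite -(mean_poly3 x Ox); apply: eq_mean => t _.
    by rewrite /g /=; ring.
  apply: etrans E _; apply: etrans (derive_val (is_derive := D)) _.
  rewrite -[RHS](mean_cst R 0); apply: eq_mean => t _.
  have Tpt : T (p, t) by [].
  have dg := smooth_on_is_derive _ (p, t) ((u, 0) : 'rV[R]_4 * R) sg Tpt.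
  apply: etrans (derive_val (is_derive := is_der_exp 1 dg)) _.
  by rewrite /g /= Vc vE subrr expr1 mulr0 mul0r.
have dl0 u : 'D_u dl p = 0.
  have svar : smooth_on Om (fun x => m2 x + - v x ^+ 2).
    by apply: smooth_on_add => //; apply: smooth_on_opp => //; exact: smooth_on_exp.
  have sjk : smooth_on Om (fun x => par_j x * (k x)^-1).
    by apply: smooth_on_mul => //; [exact: smooth_coord|exact: smooth_on_inv].
  have D := is_der_mul (smooth_on_is_derive _ p u sjk Op)
    (smooth_on_is_derive _ p u svar Op).
  have E : 'D_u dl p = 'D_u (fun x => (par_j x * (k x)^-1) * (m2 x + - v x ^+ 2)) p.
    apply: near_eq_derive; apply: filterS (open_nbhs_nbhs (conj oOm Op)) => x Ox.
    have [_ _ kd _] := mean_w_vwE x Ox.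
    apply: (mulfI (kn x Ox)); rewrite kd.
    by move: (m2 x) (v x) (par_j x) (k x) (kn x Ox) => a b c d d0; field.
  apply: etrans E _; apply: etrans (derive_val (is_derive := D)) _.
  have -> : m2 p + - v p ^+ 2 = 0.
    rewrite vE -(mean_cst R (V p 0 ^+ 2)) -[m2 p]/(mean (fun t => V p (t / k p) ^+ 2)).
    by rewrite (eq_mean R _ (fun=> V p 0 ^+ 2)) ?subrr // => t _; rewrite Vc.
  have -> := var0 u; by rewrite mulr0 mul0r addr0.
have J2 i : jacobian q p i 2 = 0.
  rewrite jacobianE ?mxE ?E2 // => j.
  by apply: (smooth_on_differentiable _ _ Om) => //; exact: findim_rV.
have := full_rank_eq0 _ _ _ _ (fun j => (j == 2)%:R) rk _ 2.
rewrite eqxx => H1; have /eqP : (1 : R) = 0.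
  apply: H1 => i; rewrite sum_I3 J2.
  by rewrite mulr0 addr0 !mul0r addr0.
by rewrite oner_eq0.
Qed.

(** A phase where [dV] is nonzero remains so for nearby parameters; this selects the first
    alternative of [flux_constants] on a neighbourhood and makes the fluxes explicit in the
    parameters. *)
Lemma nonconstant_domain p (N : set 'rV[R]_4) : Om p -> \rank (jacobian q p) = 3%N ->
  nbhs p N -> exists D : set 'rV[R]_4, [/\ open D, D p, D `<=` Om, D `<=` N &
    forall x, D x ->
    [/\ forall y, profile_P x y = - par_lambda x - par_j x ^+ 2 * V x y,
        FL x 0 2 = - par_lambda x - par_j x ^+ 2 * v x &
        FL x 0 3 = par_mu x - w x ^+ 2 / 2 - par_j x ^+ 2 * v x ^+ 2 / 2
          - par_j x * (k x * dl x)]].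
Proof.
move=> Op rk Np; have [x0 dVx0] := nonconstant_profile p Op rk.
have cdV : {for p, continuous (fun x => dV x x0)}.
  apply: (continuous_section R _ _ (fun z => dV z.1 z.2)).
  exact: smooth_on_continuous (smooth_dV) _.
have n1 : \forall x \near p, dV x x0 != 0.
  have N0 : nbhs (dV p x0) [set y : R | y != 0].
    by apply: open_nbhs_nbhs; split; [exact: open_neq|].
  exact: cdV N0.
exists (interior [set x | [/\ Om x, N x & dV x x0 != 0]]); split.
- exact: open_interior.
- rewrite /interior /=; near=> x; split; near: x => //.
  exact: open_nbhs_nbhs.
- by move=> x /interior_subset[].
- by move=> x /interior_subset[].
move=> x /interior_subset[Ox _ dVx].
have [c [d [cd _ [vE wE _ _ FLE] _ _]]] :=
  mean_dictionary x Ox.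
have [c' [d' [PE _ cd']]] := flux_constants x Ox.
have [wj _ kd _] := mean_w_vwE x Ox.
have {cd}[cl dm] : c = - par_lambda x /\ d = par_mu x.
  by case: cd => // dV0; move: dVx; rewrite dV0 eqxx.
have {cd'}[cl' _] : c' = - par_lambda x /\ d' = par_mu x.
  by case: cd' => // dV0; move: dVx; rewrite dV0 eqxx.
split; first by move=> y; rewrite PE cl'.
- by rewrite FLE vec4E cl vE.
- rewrite kd wj FLE vec4E dm vE.
  by move: (mean_pow 1 x) (m2 x) (par_j x) (par_sigma x) => a b j s; field.
Unshelve. all: by end_near. Qed.

Let beta (i : 'I_3) (x : 'rV[R]_4) : R :=
  [:: par_lambda x + par_j x ^+ 2 * v x; th x + par_j x * dl x; par_j x * k x]`_i.

Let sp (i : 'I_4) : smooth_on Om (fun x : 'rV[R]_4 => x 0 i).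
Proof. exact: smooth_coord. Qed.

Let dpar (i : 'I_4) (x u : 'rV[R]_4) :
  is_derive x u (fun x : 'rV[R]_4 => x 0 i) (u 0 i).
Proof. exact: is_der_coord. Qed.

Let EL (x : 'rV[R]_4) : Prop := forall y,
  profile_P x y = - par_lambda x - par_j x ^+ 2 * V x y.

Lemma smooth_beta i : smooth_on Om (beta i).
Proof.
have sj : smooth_on Om (fun x : 'rV[R]_4 => par_j x) by exact: sp.
move: i; apply/forall_I3; split.
- apply: smooth_on_add => //; first exact: sp.
  by apply: smooth_on_mul => //; exact: smooth_on_exp.
- by apply: smooth_on_add => //; exact: smooth_on_mul.
- exact: smooth_on_mul.
Qed.

(** Once [derive_theta] is inserted in the derivative of [energyL_theta], the differentials of [j],
    [lambda] and [mu] cancel, since [j m2 = k delta + j v^2]. *)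
Lemma energyL_gradient x u : Om x -> EL x ->
  'D_u e x = \sum_i beta i x * 'D_u (fun y => q y 0 i) x.
Proof.
move=> Ox ELx; have [E0 E1 E2] := qE.
have [_ _ kd _] := mean_w_vwE x Ox.
have dk := smooth_on_is_derive _ x u sk Ox.
have dv := smooth_on_is_derive _ x u sv Ox.
have dd := smooth_on_is_derive _ x u sdl Ox.
have dt := smooth_on_is_derive _ x u sth Ox.
have dj := dpar (@Ordinal 4 0 isT) x u.
have dla := dpar (@Ordinal 4 2 isT) x u.
have dmu := dpar (@Ordinal 4 3 isT) x u.
have D := is_der_add (is_der_add (is_der_add
  (is_der_mul dk (is_der_add dt (is_der_mul dj dd)))
  (is_der_mul (is_der_mul (is_der_exp 1 dj)
    (is_der_exp 1 dv)) (is_der_cst x u 2^-1)))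
  (is_der_mul dla dv)) dmu.
have E : 'D_u e x = 'D_u (fun x => k x * (th x + par_j x * dl x) +
    par_j x ^+ 2 * v x ^+ 2 / 2 + par_lambda x * v x + par_mu x) x.
  apply: near_eq_derive; apply: filterS (open_nbhs_nbhs (conj oOm Ox)) => y Oy.
  exact: energyL_theta y Oy.
apply: etrans E _; apply: etrans (derive_val (is_derive := D)) _.
rewrite sum_I3 E0 E1 E2 /beta /=.
have -> := derive_theta x u Ox ELx.
rewrite -!/(par_j _) -!/(par_lambda _) -!/(par_mu _).
have m2E : par_j x * m2 x = k x * dl x + par_j x * v x ^+ 2.
  by rewrite kd; ring.
have -> : par_j x * par_j u * m2 x = (k x * dl x + par_j x * v x ^+ 2) * par_j u.
  by rewrite -m2E; ring.
move: ('D_u k x) ('D_u v x) ('D_u dl x) (th x) (v x) (DeltaL k V W x / k x) (k x) (kn x Ox).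
move: (par_j x) (par_lambda x) (par_mu x) (par_j u) (par_lambda u) (par_mu u).
by move=> x1 x2 x3 x4 x5 x6 x7 x8 x9 x10 x11 x12 x13 x14; field.
Qed.

(** * Symmetrization at a point of strict convexity *)

Section Point.
Variables (p : 'rV[R]_4) (D : set 'rV[R]_4).
Hypotheses (oD : open D) (Dp : D p) (DOm : D `<=` Om).
Hypothesis ELD : forall x, D x -> EL x.

Let Op : Om p. Proof. exact: DOm. Qed.

Let sig : 'rV[R]_4 := delta_mx 0 (@Ordinal 4 1 isT).

(* The differential of theta does not involve sigma, so its mixed second
   derivatives in sigma and in the other parameters vanish. *)
Lemma sigma_derivatives :
  [/\ 'D_sig v p = 0, 'D_sig k p = 0 & 'D_sig dl p = 0].
Proof.
have dk := smooth_on_is_derive _ p sig sk Op.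
have dv := smooth_on_is_derive _ p sig sv Op.
have dm := smooth_on_is_derive _ p sig sm2 Op.
have dd := smooth_on_is_derive _ p sig sdl Op.
have dI := is_der_inv p sig k (kn p Op) dk.
pose A (u x : 'rV[R]_4) := par_j x * par_j u * m2 x + par_lambda u * v x + par_mu u.
have thE x u : D x -> 'D_u th x = - (k x)^-1 * A u x.
  by move=> Dx; exact: (derive_theta x u (DOm x Dx) (ELD x Dx)).
have Z u : 'D_sig (fun x => - (k x)^-1 * A u x) p = 0.
  transitivity ('D_sig (fun x => 'D_u th x) p).
    apply: near_eq_derive; apply: filterS (open_nbhs_nbhs (conj oD Dp)) => x Dx.
    by rewrite thE.
  apply: etrans (schwarz _ _ Om th p sig u oOm (sth 2) Op) _.
  apply: etrans (derive_cst (0 : R) p u); apply: near_eq_derive.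
  apply: filterS (open_nbhs_nbhs (conj oD Dp)) => x Dx; rewrite thE // /A.
  by rewrite /par_j /par_lambda /par_mu /sig !mxE /= mulr0 !mul0r !addr0 mulr0.
have dj := dpar (@Ordinal 4 0 isT) p sig.
have dA u := is_der_add (is_der_add
  (is_der_mul (is_der_mul dj (is_der_cst p sig (par_j u))) dm)
  (is_der_mul (is_der_cst p sig (par_lambda u)) dv))
  (is_der_cst p sig (par_mu u)).
have DZ u := is_der_mul (is_der_opp dI) (dA u).
have ZZ u := etrans (esym (derive_val (is_derive := DZ u))) (Z u).
have j0 : sig 0 (@Ordinal 4 0 isT) = 0 by rewrite /sig mxE.
have kd := fun x Ox => let: And4 _ _ H _ := mean_w_vwE x Ox in H.
have DD : k p * 'D_sig dl p + dl p * 'D_sig k p =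
    par_j p * ('D_sig m2 p - 2%:R * v p ^+ 1 * 'D_sig v p).
  have D1 := is_der_mul dk dd.
  have D2 := is_der_mul dj
    (is_der_add dm (is_der_opp (is_der_exp 1 dv))).
  apply: etrans (esym (derive_val (is_derive := D1))) _.
  transitivity ('D_sig (fun x => par_j x * (m2 x + - v x ^+ 2)) p).
    apply: near_eq_derive; apply: filterS (open_nbhs_nbhs (conj oOm Op)) => x Ox.
    exact: kd.
  by apply: etrans (derive_val (is_derive := D2)) _; rewrite j0 mulr0 addr0.
(* The directions of [mu], [lambda] and [j], in this order, give the vanishing of the derivatives of
   [k], of [v] and, up to the factor [j], of [m2]; [DD] then settles [delta]. *)
have c (u : 'rV[R]_4) a b c : par_j u = a -> par_lambda u = b -> par_mu u = c ->
    (k p)^-1 * (a * par_j p * 'D_sig m2 p + b * 'D_sig v p) =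
    (k p ^+ 2)^-1 * 'D_sig k p * (par_j p * a * m2 p + b * v p + c).
  move=> ja lb mc; have := ZZ u; rewrite j0 ja lb mc -/(par_j p).
  move: ('D_sig m2 p) ('D_sig v p) ('D_sig k p) (m2 p) (v p) (k p) (kn p Op).
  move=> x0 x1 x2 x3 x4 x5 x50 H; apply/eqP; rewrite -subr_eq0 -(oppr0 R) -H; apply/eqP.
  by field.
have k0 : 'D_sig k p = 0.
  have := c (delta_mx 0 (@Ordinal 4 3 isT)) 0 0 1.
  rewrite /par_j /par_lambda /par_mu !mxE /= => /(_ erefl erefl erefl) /eqP.
  rewrite !mul0r !mulr0 !mul0r !add0r mulr0 mulr1 eq_sym mulf_eq0 invr_eq0 expf_eq0 /=.
  by rewrite (negbTE (kn p Op)) => /eqP.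
rewrite k0 in c DD.
have v0 : 'D_sig v p = 0.
  have := c (delta_mx 0 (@Ordinal 4 2 isT)) 0 1 0.
  rewrite /par_j /par_lambda /par_mu !mxE /= => /(_ erefl erefl erefl) /eqP.
  rewrite !mul0r !mulr0 !mul0r !add0r mul1r mulf_eq0 invr_eq0.
  by rewrite (negbTE (kn p Op)) => /eqP.
rewrite v0 in c DD.
have jm : par_j p * 'D_sig m2 p = 0.
  have := c (delta_mx 0 (@Ordinal 4 0 isT)) 1 0 0.
  rewrite -/(par_j p) /par_lambda /par_mu {1}/par_j !mxE /= => /(_ erefl erefl erefl) /eqP.
  rewrite !mulr0 !mul0r addr0 mul1r mulf_eq0 invr_eq0.
  by rewrite (negbTE (kn p Op)) => /eqP.
split=> //; move: DD; rewrite !mulr0 addr0 subr0 jm => /eqP.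
by rewrite mulf_eq0 (negbTE (kn p Op)) => /eqP.
Qed.

Hypothesis FL2 : forall x, D x -> FL x 0 2 = - par_lambda x - par_j x ^+ 2 * v x.
Hypothesis FL3 : forall x, D x -> FL x 0 3 = par_mu x - w x ^+ 2 / 2 -
  par_j x ^+ 2 * v x ^+ 2 / 2 - par_j x * (k x * dl x).

Let dbeta i u := smooth_on_is_derive _ p u (smooth_beta i) Op.

(** Up to sign, the fluxes of [k] and [w] are conjugate variables; the last identity is a
    Gibbs-Duhem relation, in which [derive_theta] eliminates the differential of [mu]. *)
Lemma derive_fluxL u : [/\ 'D_u (fun x => FL x 0 0) p = - 'D_u (beta 2) p,
  'D_u (fun x => FL x 0 2) p = - 'D_u (beta 0) p &
  'D_u (fun x => FL x 0 3) p = - (w p * 'D_u w p + v p * 'D_u (beta 0) p +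
    dl p * 'D_u (beta 2) p + k p * 'D_u (beta 1) p)].
Proof.
have near (f g : 'rV[R]_4 -> R) : (forall x, D x -> f x = g x) -> 'D_u f p = 'D_u g p.
  by move=> fg; apply: near_eq_derive; apply: filterS (open_nbhs_nbhs (conj oD Dp)).
split.
- rewrite (near _ (fun x => - beta 2 x)); last by move=> x _; rewrite (FL01 _).1.
  exact: (derive_val (is_derive := is_der_opp (dbeta 2 u))).
- rewrite (near _ (fun x => - beta 0 x)); last by move=> x Dx; rewrite FL2 // /beta /= opprD.
  exact: (derive_val (is_derive := is_der_opp (dbeta 0 u))).
rewrite (near _ _ FL3).
have [_ _ kd _] := mean_w_vwE p Op.
have dk := smooth_on_is_derive _ p u sk Op.
have dv := smooth_on_is_derive _ p u sv Op.
have dw := smooth_on_is_derive _ p u sw Op.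
have dd := smooth_on_is_derive _ p u sdl Op.
have dt := smooth_on_is_derive _ p u sth Op.
have dj := dpar (@Ordinal 4 0 isT) p u.
have dla := dpar (@Ordinal 4 2 isT) p u.
have dmu := dpar (@Ordinal 4 3 isT) p u.
have half := is_der_cst p u (2^-1 : R).
have D0 := is_der_add dla (is_der_mul (is_der_exp 1 dj) dv).
have D1 := is_der_add dt (is_der_mul dj dd).
have D2 := is_der_mul dj dk.
have D3 := is_der_add (is_der_add (is_der_add dmu
  (is_der_opp (is_der_mul (is_der_exp 1 dw) half)))
  (is_der_opp (is_der_mul (is_der_mul
    (is_der_exp 1 dj) (is_der_exp 1 dv)) half)))
  (is_der_opp (is_der_mul dj (is_der_mul dk dd))).
apply: etrans (derive_val (is_derive := D3)) _.
have -> : 'D_u (beta 0) p = _ := derive_val (is_derive := D0).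
have -> : 'D_u (beta 1) p = _ := derive_val (is_derive := D1).
have -> : 'D_u (beta 2) p = _ := derive_val (is_derive := D2).
have -> := derive_theta p u Op (ELD p Dp).
rewrite -!/(par_j _) -!/(par_lambda _) -!/(par_mu _).
have m2E : par_j p * m2 p = k p * dl p + par_j p * v p ^+ 2.
  by rewrite kd; ring.
have -> : par_j p * par_j u * m2 p = (k p * dl p + par_j p * v p ^+ 2) * par_j u.
  by rewrite -m2E; ring.
move: ('D_u k p) ('D_u v p) ('D_u w p) ('D_u dl p) (v p) (w p) (DeltaL k V W p / k p)
  (k p) (kn p Op).
move: (par_j p) (par_j u) (par_lambda u) (par_mu u).
by move=> x1 x2 x3 x4 x5 x6 x7 x8 x9 x10 x11 x12 x13; field.
Qed.

Hypothesis rk : \rank (jacobian q p) = 3%N.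
Variable H : 'M[R]_3.
Hypotheses (symH : H^T = H) (posH : positive_definite H).
Hypothesis dbetaH : forall u i,
  'D_u (beta i) p = \sum_l 'D_u (fun y => q y 0 l) p * H l i.

Let dd (f : 'rV[R]_4 -> R) (i : 'I_4) : R := 'D_(delta_mx 0 i) f p.
(** In the variables [y = (v, w, k, delta)] the system reads [d_t y = d_x (J grad eta)] with
    [eta = w^2/2 + h]: [J] exchanges [v] with [w] and [k] with [delta], [S] is the Hessian of [eta],
    and [N] passes from [dy] to the densities, using [vw = v w + k delta]. *)
Let Y : 'M[R]_4 := cols4 R (dd v) (dd w) (dd k) (dd dl).
Let N : 'M[R]_4 := cols4 R (fun i => [:: 0; 0; 1; 0]`_i) (fun i => [:: 1; 0; 0; 0]`_i)
  (fun i => [:: 0; 1; 0; 0]`_i) (fun i => [:: w p; v p; dl p; k p]`_i).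
Let J : 'M[R]_4 := cols4 R (fun i => [:: 0; 1; 0; 0]`_i) (fun i => [:: 1; 0; 0; 0]`_i)
  (fun i => [:: 0; 0; 0; 1]`_i) (fun i => [:: 0; 0; 1; 0]`_i).
Let S : 'M[R]_4 := cols4 R (fun i => [:: H 0 0; 0; H 1 0; H 2 0]`_i)
  (fun i => [:: 0; 1; 0; 0]`_i) (fun i => [:: H 0 1; 0; H 1 1; H 2 1]`_i)
  (fun i => [:: H 0 2; 0; H 1 2; H 2 2]`_i).

Let N_unit : N \in unitmx.
Proof.
pose N' : 'M[R]_4 := cols4 R (fun i => [:: 0; 1; 0; 0]`_i) (fun i => [:: 0; 0; 1; 0]`_i)
  (fun i => [:: 1; 0; 0; 0]`_i)
  (fun i => [:: - dl p / k p; - w p / k p; - v p / k p; (k p)^-1]`_i).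
have NN : N *m N' = 1%:M.
  rewrite cols4_mul; apply/matrixP => i j; rewrite !mxE /=.
  move: (kn p Op); move: (v p) (w p) (DeltaL k V W p / k p) (k p) => v0 w0 u0 k0 k00.
  by move: i j; do 2 (apply/forall_I4; split); rewrite /= ?mulr0n ?mulr1n; field.
exact: (mulmx1_unit NN).1.
Qed.

Let J_sym : J^T = J.
Proof. by apply/matrixP => i j; rewrite !mxE; move: i j; do 2 (apply/forall_I4; split). Qed.

Let S_sym : S^T = S.
Proof.
have h i j : H j i = H i j by rewrite -[in RHS]symH mxE.
by apply/matrixP => i j; rewrite !mxE; move: i j; do 2 (apply/forall_I4; split) => /=.
Qed.

Let S_pos : positive_definite S.
Proof.
move=> z z0; pose y := vec3 (z 0 0) (z 0 2) (z 0 3).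
have E : (z *m S *m z^T) 0 0 = z 0 1 ^+ 2 + (y *m H *m y^T) 0 0.
  by rewrite !mxE sum_I4 sum_I3 !mxE !sum_I4 !sum_I3 !mxE /=; ring.
rewrite E; have [y0|yn] := eqVneq y 0; last first.
  by rewrite ltr_wpDl ?sqr_ge0 // posH.
rewrite y0 !mul0mx mxE addr0 lt_neqAle sqr_ge0 andbT eq_sym sqrf_eq0.
apply: contra z0 => /eqP z1; apply/eqP/rowP; apply/forall_I4; rewrite !mxE.
have c i : y 0 i = 0 by rewrite y0 mxE.
by move: (c 0) (c 1) (c 2); rewrite /y !vec3E => -> -> ->.
Qed.

Let jac_varsL i : [/\ jacobian q p i 0 = dd v i, jacobian q p i 1 = dd k i &
  jacobian q p i 2 = dd dl i].
Proof.
have [E0 E1 E2] := qE; rewrite jacobianE ?mxE ?E0 ?E1 ?E2; first by split.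
by move=> l; apply: (smooth_on_differentiable _ _ Om) => //; exact: findim_rV.
Qed.

(** Along [sigma] only [w] varies, with derivative 1, so a linear relation between the four
    differentials cannot involve that of [w]; the other three are independent by the rank
    condition. *)
Let Y_unit : Y \in unitmx.
Proof.
rewrite -unitmx_tr -row_free_unit -kermx_eq0; apply/negPn/negP => /rowV0Pn[z].
move=> /sub_kermxP zY z0.
have zi i : z 0 0 * dd v i + z 0 1 * dd w i + z 0 2 * dd k i + z 0 3 * dd dl i = 0.
  have := congr1 (fun u : 'rV[R]_4 => u 0 i) zY.
  by rewrite !mxE sum_I4 !mxE.
have [sv0 sk0 sd0] := sigma_derivatives.
have w1 : dd w (@Ordinal 4 1 isT) = 1.
  have dv := smooth_on_is_derive _ p sig sv Op.
  have Dw := is_der_add (dpar (@Ordinal 4 1 isT) p sig)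
    (is_der_mul (dpar (@Ordinal 4 0 isT) p sig) dv).
  transitivity ('D_sig (fun x => par_sigma x + par_j x * v x) p).
    apply: near_eq_derive; apply: filterS (open_nbhs_nbhs (conj oOm Op)) => x Ox.
    by have [] := mean_w_vwE x Ox.
  apply: etrans (derive_val (is_derive := Dw)) _.
  by rewrite sv0 mulr0 add0r /sig !mxE /= mulr0 addr0.
have z1 : z 0 1 = 0.
  have := zi (@Ordinal 4 1 isT); rewrite w1 /dd -/sig sv0 sk0 sd0.
  by rewrite !mulr0 add0r !addr0 mulr1.
pose c (l : 'I_3) := [:: z 0 0; z 0 2; z 0 3]`_l.
have c0 := full_rank_eq0 _ _ _ _ c rk.
have {}c0 l : c l = 0.
  apply: c0 => i; have [e0 e1 e2] := jac_varsL i.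
  rewrite sum_I3 e0 e1 e2 /c /= -[RHS](zi i) z1 mul0r addr0; ring.
case/negP: z0; apply/eqP/rowP; apply/forall_I4; rewrite !mxE.
by move: (c0 0) (c0 1) (c0 2); rewrite /c /= => -> -> ->.
Qed.

(* Row differentials of (v, w, k, delta) are the rows of Y, so that the densities
   and the fluxes have Jacobians Y N and - Y S J N. *)
Lemma hyperbolicL_of_hessian : hyperbolic_at (WL k V W) FL p.
Proof.
have [E0 E1 E2] := qE.
have YS : Y *m S *m J = cols4 R (dd w) (dd (beta 0)) (dd (beta 2)) (dd (beta 1)).
  have db l i : dd (beta l) i = dd v i * H 0 l + dd k i * H 1 l + dd dl i * H 2 l.
    by rewrite /dd dbetaH sum_I3 E0 E1 E2.
  rewrite cols4_mul; apply/matrixP => i; apply/forall_I4.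
  rewrite !mxE !sum_I4 !mxE /= !db.
  by move: (dd v i) (dd w i) (dd k i) (dd dl i) => *; split; ring.
have WLE : jacobian (WL k V W) p = Y *m N.
  have Dvw i : 'D_(delta_mx 0 i) vw p = w p * dd v i + v p * dd w i + dl p * dd k i + k p * dd dl i.
    have dk := smooth_on_is_derive _ p (delta_mx 0 i) sk Op.
    have dv := smooth_on_is_derive _ p (delta_mx 0 i) sv Op.
    have dw := smooth_on_is_derive _ p (delta_mx 0 i) sw Op.
    have ddl := smooth_on_is_derive _ p (delta_mx 0 i) sdl Op.
    have Dv := is_der_add (is_der_mul dv dw)
      (is_der_mul dk ddl).
    transitivity ('D_(delta_mx 0 i) (fun x => v x * w x + k x * dl x) p).
      apply: near_eq_derive; apply: filterS (open_nbhs_nbhs (conj oOm Op)) => x Ox.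
      by have [] := mean_w_vwE x Ox.
    apply: etrans (derive_val (is_derive := Dv)) _; rewrite /dd.
    move: ('D_(delta_mx 0 i) v p) ('D_(delta_mx 0 i) w p) ('D_(delta_mx 0 i) k p)
      ('D_(delta_mx 0 i) dl p) => *.
    by ring.
  rewrite (jacobian_WL p Op) cols4_mul.
  apply/matrixP => i; apply/forall_I4; rewrite !mxE /= Dvw -!/(dd _ i).
  by move: (dd v i) (dd w i) (dd k i) (dd dl i) => *; split; ring.
have FLE : jacobian FL p = - (Y *m S *m J *m N).
  rewrite (jacobian_FL p Op) YS cols4_mul.
  apply/matrixP => i; apply/forall_I4; rewrite !mxE /=.
  by have [-> -> ->] := derive_fluxL (delta_mx 0 i); rewrite /dd; split; ring.
split; first by rewrite unitmx_tr WLE unitmx_mul Y_unit.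
by rewrite WLE FLE; exact: diagonalizable_symmetrized.
Qed.

End Point.

(** Positivity is used at [p] alone, but the representation [e = h(q)] holds near [p]; on a smaller
    neighbourhood without constant profiles the gradient of [e] is [beta], whose derivatives at [p]
    are then read off the Hessian of [h]. *)
Lemma convex_hyperbolic p : Om p -> strictly_convex_in q e p ->
  hyperbolic_at (WL k V W) FL p.
Proof.
move=> Op [rk [h [ O H]]]; have [oO Oq sh eh ph] := H.
have cq : {for p, continuous q}.
  by apply: smooth_on_continuous (smooth_on_rV _ _ _ _ _ oOm sq) Op.
have nO : nbhs p (q @^-1` O) by apply: cq; exact: (open_nbhs_nbhs (conj oO Oq)).
have [D [oD Dp DOm DN facts]] := nonconstant_domain p
  _ Op rk (filterI eh nO).
have ELD x : D x -> EL x by move=> Dx; have [] := facts x Dx.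
apply: (hyperbolicL_of_hessian p D oD Dp DOm ELD) (hessian h (q p)) _ _ _.
- by move=> x Dx; have [] := facts x Dx.
- by move=> x Dx; have [] := facts x Dx.
- exact: rk.
- exact: (hessian_sym _ _ O).
- exact: ph.
apply: (gradient_hessian _ _ _ D O q e h) => //.
- by move=> x /DN[].
- by move=> l; apply: smooth_on_sub (sq l).
- by move=> l; apply: smooth_on_sub (smooth_beta l).
- by move=> x /DN[].
- by move=> x u Dx; apply: energyL_gradient; [exact: DOm|exact: ELD].
Qed.

End ConvexHyperbolic.

End EulerKorteweg.

Theorem theorem2 (R : realType) (eps : R -> R -> R) (Om : set 'rV[R]_4)
    (K : 'rV[R]_4 -> R) (Rho U : 'rV[R]_4 -> R -> R)
    (k : 'rV[R]_4 -> R) (V W : 'rV[R]_4 -> R -> R) :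
  smooth_energy eps -> open Om ->
  eulerian_profiles eps K Rho U Om ->
  lagrangian_profiles eps k V W Om ->
  corresponding_profiles Om K Rho U k V W ->
  [/\ (* existence of the mass Lagrangian coordinate of a solution of (E) *)
      forall (D : set (R * R)) (P : R * R -> 'rV[R]_4),
        open D -> simply_connected D ->
        smooth_on D P -> P @` D `<=` Om ->
        solves_on (WE K Rho U) (FE eps K Rho U) D P ->
        exists Y : R * R -> R, mass_coordinate K Rho U D P Y,
      (* Phi : (T, X) |-> (S, Y) = (T, Y) is a smooth change of coordinates on
         every open set where it is injective (e.g. where the sets of constant
         T are intervals, in particular on small balls), and it transforms (E)
         into (L) *)
      forall (D : set (R * R)) (P : R * R -> 'rV[R]_4) (Y : R * R -> R),
        open D -> smooth_on D P -> P @` D `<=` Om ->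
        mass_coordinate K Rho U D P Y ->
        let Phi := fun z : R * R => (z.1, Y z) in
        ((forall T : R, is_interval [set X | D (T, X)]) ->
           {in D &, injective Phi}) /\
        ({in D &, injective Phi} ->
           open (Phi @` D) /\
           exists Psi : R * R -> R * R,
             [/\ smooth_on (Phi @` D) Psi, {in D, cancel Phi Psi}
               & solves_on (WE K Rho U) (FE eps K Rho U) D P <->
                 solves_on (WL k V W) (FL eps k V W) (Phi @` D) (P \o Psi)]),
      (* simultaneous hyperbolicity *)
      forall p, Om p ->
        (hyperbolic_at (WE K Rho U) (FE eps K Rho U) p <->
         hyperbolic_at (WL k V W) (FL eps k V W) p)
    & (* convexity *)
      forall p, Om p ->
        [/\ energyE eps K Rho U p = mean_rho K Rho p * energyL eps k V W p,
            strictly_convex_in (varsL k V W) (energyL eps k V W) p <->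
            strictly_convex_in (varsE K Rho U) (energyE eps K Rho U) p
          & strictly_convex_in (varsL k V W) (energyL eps k V W) p ->
            hyperbolic_at (WE K Rho U) (FE eps K Rho U) p /\
            hyperbolic_at (WL k V W) (FL eps k V W) p]].
Proof.
move=> seps oOm EP LP CP; split.
- move=> D P oD scD sP PD sol.
  exact: (mass_coordinate_ex _ _ _ _ _ _ _ _ _ seps oOm EP LP CP D P oD sP PD scD sol).
- move=> D P Y oD sP PD mY Phi; have sY := mY.1.
  have YX z := mass_coordinate_gt0 _ _ _ _ _ _ _ _ _ seps oOm EP LP CP D P PD Y mY z.
  split=> [itv|injPhi]; first exact: (interval_slices_injective _ _ _ oD sY YX itv).
  split; first exact: (Phi_image_open _ _ _ oD sY YX).
  have [Psi PhiK] := coordinate_inverse_ex _ _ _ injPhi.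
  exists Psi; split.
  + exact: (smooth_on_Psi _ _ _ oD sY YX Psi PhiK).
  + by move=> z; rewrite inE; exact: PhiK.
  + exact: (solves_on_transfer _ _ _ _ _ _ _ _ _ seps oOm EP LP CP D P oD sP PD Y mY Psi PhiK).
- move=> p Op.
  exact: (hyperbolic_equivalence _ _ _ _ _ _ _ _ _ seps oOm EP LP CP p Op).
- move=> p Op; split.
  + have [_ _ _ ->] := euler_of_lagrange _ _ _ _ _ _ _ _ _ seps oOm EP LP CP p Op.
    by rewrite (mean_rhoE _ _ _ _ _ _ _ _ _ seps oOm EP LP CP p Op) mulrC.
  + exact: (convex_equivalence _ _ _ _ _ _ _ _ _ seps oOm EP LP CP p Op).
  + move=> cvx.
    have hL := convex_hyperbolic _ _ _ _ _ _ _ _ _ seps oOm EP LP CP p Op cvx.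
    split; last exact: hL.
    by apply/(hyperbolic_equivalence _ _ _ _ _ _ _ _ _ seps oOm EP LP CP p Op).
Qed.
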